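(* Suppose $n=2$ and the cost structure is separable. If marginal investment costs are sufficiently concave, there exists $\theta_0\in[0,1]$ such that the score ceiling auction (with threshold $\theta_0$) is an optimal mechanism, i.e. it achieves the bound $\overline U_{asy}$ and solves the full problem (P).
   Context: Setting. A buyer procures one contract from two firms $i=1,2$ (firm 1 is the ''favored'' one). Types $\theta_i\in[0,1]$ are private, independent with cdf $F$ and strictly positive density $f$. Separable cost structure: the buyer's value of quality is $V(q)=q$; the production (winner-pay) cost is $C^P(q,\theta)=\alpha\theta$ with $\alpha>0$; the investment (all-pay) cost is $C^I(q,\theta)=g(q)$ with $g'>0$, $g''>0$. Standing assumptions for this structure: $J(\theta)=\theta+F(\theta)/f(\theta)$ is strictly increasing; $g(0)=g'(0)=0$ (so $g'(q)>0$ is meant for $q>0$); $g'(q)>1$ at $q=\infty$ (for all large $q$). Firm $i$'s payoff is $t_i-\alpha\theta_iz_i-g(q_i)$; the buyer's payoff is $\sum_i(q_iz_i-t_i)$ ($z_i$ share of the contract, $t_i$ transfer to firm $i$). Sufficient concavity. Let $\xi(z)=1-J(F^{-1}(1-z))$. Marginal investment costs are sufficiently concave iff the function $q\mapsto\alpha\,\xi(g'(q))-q$ is strictly quasi-concave (where $\xi(g'(q))$ is defined). Mechanisms and problem (P). A mechanism $\mathcal M$ consists of message sets $M_i$ and functions $z_i(\mathbf m,\mathbf q)$, $t_i(\mathbf m,\mathbf q)$. After $\mathcal M$ is announced, each firm learns its type, then chooses quality $q_i\ge0$, then a message $m_i\in M_i$; a strategy is $\sigma_i(\theta_i)=(m_i(\theta_i),q_i(\theta_i))$.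 Problem (P): maximize the buyer's expected utility over pairs $(\mathcal M,\bm\sigma)$ such that $\bm\sigma$ is a (buyer-suggested) Bayes–Nash equilibrium of $\mathcal M$ (for every firm and every type $\theta_i$ in the support, $\sigma_i(\theta_i)$ maximizes interim expected payoff over all $(m_i',q_i'')\in M_i\times\mathbb R_+$), interim expected equilibrium payoffs are $\ge0$ for every type, and $z_i(\bm\sigma(\bm\theta))\ge0$, $z_1+z_2=1$ at $\bm\sigma(\bm\theta)$. Relaxed problem (P2): maximize $\mathbb E\sum_{i=1}^2\big((q_i(\theta_i)-\alpha J(\theta_i))z_i(\bm\theta)-g(q_i(\theta_i))\big)$ over $q_i(\theta_i)\ge0$ and $z_i(\bm\theta)\ge0$ with $z_1+z_2=1$. $\overline U_{asy}$ is its value (no symmetry restriction), an upper bound on the buyer's utility in (P). Score ceiling auction with threshold $\theta_0$. The message $m_i\in\mathbb R_+$ is the price offered by firm $i$; its score is $S_i=q_i-m_i$. With score ceiling $\bar S$ and kickback $K$: $z_1=\mathbb I(\bar S\ge S_1\ge S_2)$, $t_1=m_1z_1-K\,\mathbb I(\bar S=S_1\ge S_2)$, $z_2=\mathbb I(\bar S\ge S_2>S_1)$, $t_2=m_2z_2$. For $\theta_0\in[0,1)$, $\bar S=S^*_{sym}(\theta_0)$ and $$K=\max_q[q-g(q)]-\max_q\Big[q-\frac{g(q)}{1-F(\theta_0)}\Big]+\alpha\frac{F(\theta_0)}{1-F(\theta_0)}\int_{\theta_0}^1(1-F(u))\,du,$$ where $q^*_{sym}(\theta)=(g')^{-1}(1-F(\theta))$,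 $IR(\theta,1)=\alpha\int_\theta^{1}(1-F(u))\,du$, and $S^*_{sym}(\theta)=q^*_{sym}(\theta)-\alpha\theta-\dfrac{g(q^*_{sym}(\theta))+IR(\theta,1)}{1-F(\theta)}$. The threshold $\theta_0=1$ stands for sole sourcing: firm 1 always gets the contract and produces quality $q^*_{sym}(0)$. *)

(* Defs.v *)
From HB Require Import structures.
From mathcomp Require Import all_boot all_order all_algebra.
From mathcomp Require Import all_classical all_reals all_analysis.
Set Implicit Arguments.
Unset Strict Implicit.
Unset Printing Implicit Defensive.
Import Order.TTheory GRing.Theory Num.Theory.
Import numFieldNormedType.Exports.

Local Open Scope classical_set_scope.
Local Open Scope ring_scope.

Definition firm1 : 'I_2 := ord0.
Definition firm2 : 'I_2 := ord_max.

(** Primitives of the separable procurement environment.  [cost] is the all-pay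
    investment cost [C^I(q, theta) = g(q)]; it is a function on all of [R], but
    only its values at [q >= 0] matter.  The production cost is
    [alpha * theta] and the buyer's value of quality [q] is [q] itself. *)
Record environment (R : realType) := Environment {
  law : probability (measurableTypeR R) R;
  density : R -> R;
  alpha : R;
  cost : R -> R }.

Section Environment.
Context {R : realType}.
Implicit Types E : environment R.

Definition types : set (measurableTypeR R) := `[0, 1].

Definition cdfF E (theta : R) : R := fine (law E `]-oo, theta]%classic).

Definition quantile E : R -> R := 'pinv_(fun=> 0) `[0, 1] (cdfF E).

Definition virtual_type E (theta : R) : R :=
  theta + cdfF E theta / density E theta.

Definition marginal_cost E : R -> R := derive1 (cost E).

(** [cost_derivable] asks for a two-sided derivative at [0]: since
    [g 0 = g' 0 = 0], a cost function given on [R_+] only, with right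
    derivative [0] at [0], satisfies it once extended by [0] to the left. *)
Record standing_assumptions E : Prop := StandingAssumptions {
  density_measurable :
    measurable_fun (types : set (measurableTypeR R)) (density E);
  density_pos : forall theta, types theta -> 0 < density E theta;
  law_density : forall A : set (measurableTypeR R), measurable A ->
    law E A = (\int[lebesgue_measure]_(x in A `&` types) (density E x)%:E)%E;
  virtual_type_increasing : forall s t, types s -> types t ->
    s < t -> virtual_type E s < virtual_type E t;
  alpha_pos : 0 < alpha E;
  cost_derivable : forall q, 0 <= q -> derivable (cost E) q 1;
  marginal_cost_derivable : forall q, 0 < q -> derivable (marginal_cost E) q 1;
  cost0 : cost E 0 = 0;
  marginal_cost0 : marginal_cost E 0 = 0;
  marginal_cost_pos : forall q, 0 < q -> 0 < marginal_cost E q;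
  marginal_cost'_pos : forall q, 0 < q -> 0 < derive1 (marginal_cost E) q;
  marginal_cost_infty : \forall q \near +oo, 1 < marginal_cost E q }.

Definition strictly_quasi_concave_on (D : set R) (h : R -> R) : Prop :=
  forall x y t, D x -> D y -> x != y -> 0 < t < 1 ->
    Num.min (h x) (h y) < h (t * x + (1 - t) * y).

Definition xi E (z : R) : R := 1 - virtual_type E (quantile E (1 - z)).

(** [xi] is defined on [[0, 1]], hence [xi \o g'] where [g'] lies in [[0, 1]]. *)
Definition sufficiently_concave E : Prop :=
  strictly_quasi_concave_on
    [set q | 0 <= q /\ 0 <= marginal_cost E q <= 1]
    (fun q => alpha E * xi E (marginal_cost E q) - q).

(** Type profiles: independent draws, i.e. pairs under [law E \x law E]. *)
Definition type_of (w : R * R) (i : 'I_2) : R :=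
  if i == firm1 then w.1 else w.2.

Definition profiles : set (measurableTypeR R * measurableTypeR R) :=
  types `*` types.

End Environment.

Record mechanism (R : realType) := Mechanism {
  message : 'I_2 -> Type;
  share : (forall i, message i) -> ('I_2 -> R) -> 'I_2 -> R;
  transfer : (forall i, message i) -> ('I_2 -> R) -> 'I_2 -> R }.

Definition strategy (R : realType) (M : mechanism R) : Type :=
  forall i, R -> message M i * R.

Section ProblemP.
Context {R : realType}.
Variables (E : environment R) (M : mechanism R) (sigma : strategy M).

Let P := law E.

Definition eq_message (w : R * R) : forall i, message M i :=
  fun i => (sigma i (type_of w i)).1.

Definition eq_quality (w : R * R) (i : 'I_2) : R :=
  (sigma i (type_of w i)).2.

(** Firm [i] plays [(m, q)] while the other firm, of type [s], follows [sigma]: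
    with two firms, overriding component [i] leaves exactly the opponent's. *)
Definition dev_message (i : 'I_2) (m : message M i) (s : R) :
    forall j, message M j :=
  dfwith (fun j => (sigma j s).1) i m.

Definition dev_quality (i : 'I_2) (q : R) (s : R) : 'I_2 -> R :=
  @dfwith _ (fun=> R) (fun j => (sigma j s).2) i q.

Definition dev_share (i : 'I_2) (m : message M i) (q : R) (s : R) : R :=
  share (dev_message m s) (dev_quality i q s) i.

Definition dev_transfer (i : 'I_2) (m : message M i) (q : R) (s : R) : R :=
  transfer (dev_message m s) (dev_quality i q s) i.

Definition interim_payoff (i : 'I_2) (theta : R) (m : message M i) (q : R) :
    \bar R :=
  (\int[P]_(s in types)
     (dev_transfer m q s - alpha E * theta * dev_share m q s
      - cost E q)%:E)%E.

Definition buyer_payoff (w : R * R) : R :=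
  \sum_(i < 2) (eq_quality w i * share (eq_message w) (eq_quality w) i
                - transfer (eq_message w) (eq_quality w) i).

Definition buyer_utility : \bar R :=
  (\int[P \x P]_(w in profiles) (buyer_payoff w)%:E)%E.

(** All expectations are finite: since message sets and outcome functions are
    arbitrary, this is not automatic and is part of admissibility. *)
Record well_defined : Prop := WellDefined {
  dev_share_integrable : forall i (m : message M i) (q : R), 0 <= q ->
    P.-integrable types (EFin \o dev_share m q);
  dev_transfer_integrable : forall i (m : message M i) (q : R), 0 <= q ->
    P.-integrable types (EFin \o dev_transfer m q);
  eq_quality_measurable : forall i,
    measurable_fun (types : set (measurableTypeR R)) (fun s => (sigma i s).2);
  eq_share_measurable : forall i,
    measurable_fun (profiles (R := R))
      (fun w => share (eq_message w) (eq_quality w) i);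
  eq_transfer_integrable : forall i,
    (P \x P)%E.-integrable profiles
      (fun w => (transfer (eq_message w) (eq_quality w) i)%:E) }.

Definition bayes_nash : Prop :=
  forall (i : 'I_2) (theta : R), types theta ->
    0 <= (sigma i theta).2 /\
    forall (m : message M i) (q : R), 0 <= q ->
      (interim_payoff theta m q
         <= interim_payoff theta (sigma i theta).1 (sigma i theta).2)%E.

Definition individually_rational : Prop :=
  forall (i : 'I_2) (theta : R), types theta ->
    (0 <= interim_payoff theta (sigma i theta).1 (sigma i theta).2)%E.

Definition allocates_contract : Prop :=
  forall w, profiles w ->
    (forall i, 0 <= share (eq_message w) (eq_quality w) i) /\
    \sum_(i < 2) share (eq_message w) (eq_quality w) i = 1.

Definition feasible : Prop :=
  [/\ well_defined, bayes_nash, individually_rational & allocates_contract].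

End ProblemP.

Definition solves_P (R : realType) (E : environment R) (M : mechanism R)
    (sigma : strategy M) : Prop :=
  feasible E sigma /\
  forall (M' : mechanism R) (sigma' : strategy M'), feasible E sigma' ->
    (buyer_utility E sigma' <= buyer_utility E sigma)%E.

Section RelaxedProblem.
Context {R : realType}.
Variable E : environment R.

Definition feasible_P2 (q : 'I_2 -> R -> R) (z : 'I_2 -> R * R -> R) : Prop :=
  [/\ forall i, measurable_fun (types : set (measurableTypeR R)) (q i),
      forall i, measurable_fun (profiles (R := R)) (z i),
      forall i theta, types theta -> 0 <= q i theta
    & forall w, profiles w ->
        (forall i, 0 <= z i w) /\ \sum_(i < 2) z i w = 1].

Definition virtual_surplus (q : 'I_2 -> R -> R) (z : 'I_2 -> R * R -> R)
    (w : R * R) : R :=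
  \sum_(i < 2)
    ((q i (type_of w i) - alpha E * virtual_type E (type_of w i)) * z i w
     - cost E (q i (type_of w i))).

Definition objective_P2 (q : 'I_2 -> R -> R) (z : 'I_2 -> R * R -> R) :
    \bar R :=
  (\int[law E \x law E]_(w in profiles) (virtual_surplus q z w)%:E)%E.

Definition U_asy : \bar R :=
  ereal_sup [set u | exists q z, feasible_P2 q z /\ u = objective_P2 q z].

End RelaxedProblem.

Section ScoreCeilingAuction.
Context {R : realType}.
Variable E : environment R.

Definition q_sym (theta : R) : R :=
  'pinv_(fun=> 0) `[0, +oo[ (marginal_cost E) (1 - cdfF E theta).

Definition IR1 (theta : R) : R :=
  alpha E * (\int[lebesgue_measure]_(u in `[theta, 1]) (1 - cdfF E u))%R.

Definition S_sym (theta : R) : R :=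
  q_sym theta - alpha E * theta
  - (cost E (q_sym theta) + IR1 theta) / (1 - cdfF E theta).

Definition kickback (theta0 : R) : R :=
  sup [set q - cost E q | q in `[0, +oo[]
  - sup [set q - cost E q / (1 - cdfF E theta0) | q in `[0, +oo[]
  + alpha E * (cdfF E theta0 / (1 - cdfF E theta0))
    * (\int[lebesgue_measure]_(u in `[theta0, 1]) (1 - cdfF E u))%R.

(** A message is a nonnegative price [m i]; the score of firm [i] is
    [q i - m i].  Ties are broken in favor of firm 1. *)
Definition score (m : 'I_2 -> {nonneg R}) (q : 'I_2 -> R) (i : 'I_2) : R :=
  q i - (m i)%:num.

Definition ceiling_share (Sbar : R) (m : 'I_2 -> {nonneg R}) (q : 'I_2 -> R)
    (i : 'I_2) : R :=
  let S1 := score m q firm1 in let S2 := score m q firm2 in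
  if i == firm1 then ((S2 <= S1) && (S1 <= Sbar))%:R
  else ((S1 < S2) && (S2 <= Sbar))%:R.

Definition ceiling_transfer (Sbar K : R) (m : 'I_2 -> {nonneg R})
    (q : 'I_2 -> R) (i : 'I_2) : R :=
  let S1 := score m q firm1 in let S2 := score m q firm2 in
  (m i)%:num * ceiling_share Sbar m q i
  - (if i == firm1 then K * ((S2 <= S1) && (S1 == Sbar))%:R else 0).

Definition score_ceiling_auction (theta0 : R) : mechanism R :=
  @Mechanism R (fun=> {nonneg R})
    (ceiling_share (S_sym theta0))
    (ceiling_transfer (S_sym theta0) (kickback theta0)).

(** Described by its allocation, for all messages and qualities, and by the
    quality it induces; payments are left to the requirement of optimality. *)
Definition sole_sourcing (M : mechanism R) (sigma : strategy M) : Prop :=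
  (forall m q, share (m : forall i, message M i) q firm1 = 1 /\
               share m q firm2 = 0) /\
  (forall theta, types theta -> (sigma firm1 theta).2 = q_sym 0).

(** [M], with equilibrium [sigma], is the score ceiling auction with threshold
    [theta0]; the threshold [1] stands for sole sourcing from firm 1. *)
Definition threshold_mechanism (theta0 : R) (M : mechanism R)
    (sigma : strategy M) : Prop :=
  (theta0 < 1 /\ M = score_ceiling_auction theta0) \/
  (theta0 = 1 /\ sole_sourcing sigma).

End ScoreCeilingAuction.

(* Main.v *)
(** Idea.  Write [p = q_sym], [c = alpha * J] and [kappa = p + c]; sufficient
    concavity says that [kappa] is strictly quasi-convex in the type.

    Relaxed problem: let [theta0] be the last type whose [kappa] does not exceed
    the average of [kappa] over the types below it, and [kap] the average of
    [kappa] over [[0, theta0)].  Put [d = kap - c] on [[0, theta0)] and [d = p]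
    above.  Then [d] is nonincreasing and [E (q - d)^+ <= g q] for every quality
    [q], so replacing [q_1] by [d(theta_2)] and [q_2] by [d(theta_1)] and dropping
    the investment costs can only raise the objective.  What is left is linear
    in the shares and is maximized pointwise by giving the contract to the firm
    with the smaller [d + c].  The allocation of the score ceiling auction makes
    all these inequalities equalities.

    Full problem: the envelope theorem writes the buyer's utility in any feasible
    mechanism as the relaxed objective minus the payoffs of the types [1].  In
    the auction, bidding the score [S_sym (max theta0 theta)] is an equilibrium:
    any score wins with probability [1 - F t] for some [t >= theta0] at a price
    no better than that of type [t]. *)
Require Import Defs.
From HB Require Import structures.
From mathcomp Require Import all_boot all_order all_algebra.
From mathcomp Require Import all_classical all_reals all_analysis measurable_realfun.
From mathcomp Require Import ring lra.
Set Implicit Arguments.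
Unset Strict Implicit.
Unset Printing Implicit Defensive.
Import Order.TTheory GRing.Theory Num.Theory.
Import numFieldNormedType.Exports.
Local Open Scope classical_set_scope.
Local Open Scope ring_scope.

(** A firm chooses its quality knowing its own type only, whereas shares depend on both types, so
    the products [q z] of the relaxed objective cannot be maximized pointwise. The multiplier [d]
    decouples them: writing [d1], [d2] for its values at the two types, [z1 + z2 = 1] gives [q1 z1 +
    q2 z2 = (q1 - d2) z1 + (q2 - d1) z2 + d1 + d2 - d1 z1 - d2 z2]. With [d = p] the positive parts
    would cost exactly [g], because [g' (p t) = 1 - F t], but the contract would then follow
    [kappa], which may decrease at low types. Making [d + c] constant on [[0, theta0)] creates ties
    there, so favoring firm 1 loses nothing. The constant has to be the mean of [kappa]: then [d]
    and [p] have the same mean, which is what a firm that always wins with quality [p 0] needs in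
    order to recover [g (p 0)]. The density is only measurable, so [kappa] may jump. Limits at the
    threshold therefore go through the continuity of [F], and functions are identified by
    sandwiching their increments instead of differentiating them. *)

Section Increments.
Context {R : realType}.
Implicit Types (A B m : R -> R) (lo hi a b : R).

(** Says that [A] is convex with subgradient [m]; it plays the part of [A' = m] for a monotone
    [m]. *)
Definition squeezed_by m lo hi A := forall a b, lo <= a -> a <= b -> b <= hi ->
  m a * (b - a) <= A b - A a <= m b * (b - a).

(* On [n] equal pieces the increments of [A] and [B] differ by at most
   [(hi - lo) (m hi - m lo) / n] in total; [m] need not be continuous. *)
Lemma squeezed_increments m lo hi A B : lo <= hi ->
  squeezed_by m lo hi A -> squeezed_by m lo hi B -> A hi - A lo = B hi - B lo.
Proof.
move=> lohi sA sB; apply/eqP; rewrite -subr_eq0 -normr_eq0 eq_le normr_ge0 andbT.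
set C := (hi - lo) * (m hi - m lo).
have bnd n : `|A hi - A lo - (B hi - B lo)| * n.+1%:R <= C.
  pose h := (hi - lo) / n.+1%:R; pose x k := lo + k%:R * h.
  have h0 : 0 <= h by rewrite divr_ge0 ?subr_ge0.
  have xn : x n.+1 = hi by rewrite /x /h mulrC divfK ?pnatr_eq0// addrC subrK.
  have xS k : x k.+1 = x k + h by rewrite /x -natr1 mulrDl mul1r addrA.
  have xlo k : lo <= x k by rewrite /x lerDl mulr_ge0.
  have xhi k : (k <= n.+1)%N -> x k <= hi.
    by move=> kn; rewrite -xn /x lerD2l ler_wpM2r// ler_nat.
  have step k : (k <= n.+1)%N ->
      `|A (x k) - A lo - (B (x k) - B lo)| <= h * (m (x k) - m lo).
    elim: k => [_|k IH kn].
      by rewrite /x mul0r addr0 !subrr normr0 mulr0.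
    have /andP[a1 a2] := sA _ _ (xlo k) (ler_wpDr h0 (lexx (x k)))
      (eq_ind _ (fun z => z <= hi) (xhi _ kn) _ (xS k)).
    have /andP[b1 b2] := sB _ _ (xlo k) (ler_wpDr h0 (lexx (x k)))
      (eq_ind _ (fun z => z <= hi) (xhi _ kn) _ (xS k)).
    have := IH (ltnW kn); rewrite !xS; rewrite (_ : x k + h - x k = h) in a1 a2 b1 b2; last by ring.
    rewrite !ler_norml => /andP[i1 i2]; apply/andP; split; lra.
  have := step n.+1 (leqnn _); rewrite xn => st.
  apply: (le_trans (ler_wpM2r (ler0n _ _) st)).
  by rewrite /h /C mulrAC divfK ?pnatr_eq0.
rewrite leNgt; apply/negP => d0.
set D := `|_| in bnd d0.
have := archi_boundP (normr_ge0 (C / D)); set N := Num.bound _ => HN.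
have := bnd N; apply/negP; rewrite -ltNge.
have : C / D < N.+1%:R.
  by apply: le_lt_trans (ler_norm _) (lt_trans HN _); rewrite ltr_nat.
by rewrite ltr_pdivrMr// mulrC.
Qed.

End Increments.

(** * Investment costs *)

Section Cost.
Context {R : realType} (E : environment R) (sE : standing_assumptions E).
Implicit Types a b q w : R.
Local Notation g := (cost E).
Local Notation g' := (marginal_cost E).

Lemma cost_increment a b : 0 <= a -> a <= b ->
  exists2 c, a <= c <= b & g b - g a = g' c * (b - a).
Proof.
move=> a0 ab.
have [| |c cab ->] := @MVT_segment R g g' a b ab _ _; last by exists c; rewrite ?(itvP cab).
  move=> x /[!in_itv]/= /andP[ax _]; rewrite /marginal_cost derive1E.
  by apply/derivableP/(cost_derivable sE)/(le_trans a0)/ltW.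
apply: derivable_within_continuous => x /[!in_itv]/= /andP[ax _].
exact/(cost_derivable sE)/(le_trans a0).
Qed.

(** The second derivative is given at positive qualities only, so the endpoint [0] is settled by the
    sign of [g'] and not by monotonicity on a closed interval. *)
Lemma marginal_cost_lt a b : 0 <= a -> a < b -> g' a < g' b.
Proof.
rewrite le_eqVlt => /predU1P[<- b0|a0 ab].
  by rewrite (marginal_cost0 sE) (marginal_cost_pos sE).
apply: (@gtr0_derive1_lt_cc R g' a b); rewrite ?in_itv/= ?lexx ?ltW//.
- by move=> x /[!in_itv]/= /andP[ax _]; exact/(marginal_cost_derivable sE)/(lt_trans a0).
- by move=> x /[!in_itv]/= /andP[ax _]; exact/(marginal_cost'_pos sE)/(lt_trans a0).
- apply: derivable_within_continuous => x /[!in_itv]/= /andP[ax _].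
  exact/(marginal_cost_derivable sE)/(lt_le_trans a0).
Qed.

Lemma marginal_cost_le a b : 0 <= a -> a <= b -> g' a <= g' b.
Proof.
by move=> a0; rewrite le_eqVlt => /predU1P[<-//|ab]; exact/ltW/marginal_cost_lt.
Qed.

Lemma marginal_cost_ge0 q : 0 <= q -> 0 <= g' q.
Proof. by move=> q0; rewrite -(marginal_cost0 sE) marginal_cost_le. Qed.

Lemma marginal_cost_inj a b : 0 <= a -> 0 <= b -> g' a = g' b -> a = b.
Proof.
move=> a0 b0 gab; case: (ltgtP a b) => // ab.
  by have := marginal_cost_lt a0 ab; rewrite gab ltxx.
by have := marginal_cost_lt b0 ab; rewrite gab ltxx.
Qed.

Lemma cost_squeezed hi : squeezed_by g' 0 hi g.
Proof.
move=> a b a0 ab _; have [c /andP[ac cb] ->] := cost_increment a0 ab.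
rewrite !ler_wpM2r ?subr_ge0// marginal_cost_le//.
exact: le_trans ac.
Qed.

Lemma cost_convex a b : 0 <= a -> 0 <= b -> g' a * (b - a) <= g b - g a.
Proof.
move=> a0 b0; have [ab|/ltW ba] := leP a b.
  by have /andP[] := cost_squeezed a0 ab (lexx _).
by have /andP[_] := cost_squeezed b0 ba (lexx _); lra.
Qed.

Lemma cost_ge0 q : 0 <= q -> 0 <= g q.
Proof.
by move=> q0; have := cost_convex (lexx 0) q0; rewrite (marginal_cost0 sE) (cost0 sE) mul0r subr0.
Qed.

Lemma cost_le a b : 0 <= a -> a <= b -> g a <= g b.
Proof.
move=> a0 ab; have /andP[+ _] := cost_squeezed a0 ab (lexx _).
have := mulr_ge0 (marginal_cost_ge0 a0) (eq_ind_r is_true ab (subr_ge0 a b)); lra.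
Qed.

(* By convexity [g' (h / 2) <= 2 g h / h], which tends to [2 g' 0 = 0]. *)
Lemma marginal_cost_small w : 0 < w -> exists2 q, 0 < q & g' q < w.
Proof.
move=> w0; have d0 := cost_derivable sE (lexx 0).
have d0' : h^-1 *: (g (h *: 1 + 0) - g 0) @[h --> (0 : R)^'] --> 'D_1 g 0 := d0.
have e : 'D_1 g 0 = 0 by rewrite -derive1E; exact: (marginal_cost0 sE).
rewrite {d0}e in d0'.
have /(cvgr_lt _)/(_ (w / 2)) := d0'.
rewrite divr_gt0// => /(_ isT)[e /= e0 He].
pose h := e / 2; have h0 : 0 < h by rewrite divr_gt0.
have := He h; rewrite /ball_/= sub0r normrN gtr0_norm// gt_eqF//.
rewrite [h *: _]mulr1 addr0 (cost0 sE) subr0 => /(_ _ isT).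
rewrite {1}/h gtr_pMr// invf_lt1 ?ltr1n// => /(_ isT); rewrite [_ *: _]mulrC.
rewrite ltr_pdivrMr// => Hh; exists (h / 2); first exact: divr_gt0.
have h20 : 0 <= h / 2 by rewrite divr_ge0 ?ltW.
have := cost_convex h20 (ltW h0); have := cost_ge0 h20.
rewrite -subr_ge0 => g0 gc; rewrite -(ltr_pM2r h0); lra.
Qed.

(** Continuity of [g'] is available away from [0] only; the intermediate value theorem starts at the
    positive point given by [marginal_cost_small]. *)
Lemma marginal_cost_surj w : 0 <= w <= 1 -> exists2 q, 0 <= q & g' q = w.
Proof.
rewrite le_eqVlt => /andP[/predU1P[<- _|w0 w1]].
  by exists 0 => //; rewrite (marginal_cost0 sE).
have [a a0 aw] := marginal_cost_small w0.
have [M [_ HM]] := marginal_cost_infty sE.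
pose b := Num.max a (Num.max M 0 + 1).
have ab : a <= b by rewrite le_max lexx.
have bw : 1 < g' b.
  by apply: HM; rewrite lt_max; apply/orP; right; rewrite ltr_pwDr// le_max lexx.
have [||c cab <-] := @IVT _ g' a b w ab.
- apply: derivable_within_continuous => x /[!in_itv]/= /andP[ax _].
  exact/(marginal_cost_derivable sE)/(lt_le_trans a0).
- rewrite ge_min le_max (ltW aw)/=; apply/orP; right.
  by rewrite (le_trans w1)// ltW.
by exists c => //; rewrite (le_trans (ltW a0))// (itvP cab).
Qed.

(** [q_sym theta] unfolds to [ginv] at the survival probability [1 - F theta]. *)
Definition ginv w := 'pinv_(fun=> 0) `[0, +oo[ g' w.

Lemma ginvP w : 0 <= w <= 1 -> 0 <= ginv w /\ g' (ginv w) = w.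
Proof.
move=> w01; have [q q0 gq] := marginal_cost_surj w01.
have -> : ginv w = q.
  rewrite /ginv -gq pinvKV ?inE//= ?in_itv/= ?q0//.
  by move=> x y; rewrite !inE/= !in_itv/= !andbT => *; exact: marginal_cost_inj.
by [].
Qed.

Lemma ginv_ge0 w : 0 <= w <= 1 -> 0 <= ginv w. Proof. by move=> /ginvP[]. Qed.

Lemma ginvK w : 0 <= w <= 1 -> g' (ginv w) = w. Proof. by move=> /ginvP[]. Qed.

Lemma marginal_costK q : 0 <= q -> g' q <= 1 -> ginv (g' q) = q.
Proof.
move=> q0 q1; have w01 : 0 <= g' q <= 1 by rewrite marginal_cost_ge0.
by apply: marginal_cost_inj; rewrite ?ginv_ge0 ?ginvK.
Qed.

Lemma ginv_lt v w : 0 <= v -> v < w -> w <= 1 -> ginv v < ginv w.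
Proof.
move=> v0 vw w1; rewrite ltNge; apply/negP => wv.
have w01 : 0 <= w <= 1 by rewrite w1 andbT ltW// (le_lt_trans v0).
have v01 : 0 <= v <= 1 by rewrite v0 ltW// (lt_le_trans vw).
by have := marginal_cost_le (ginv_ge0 w01) wv; rewrite !ginvK// leNgt vw.
Qed.

Lemma ginv0 : ginv 0 = 0.
Proof. by rewrite -[in LHS](marginal_cost0 sE) marginal_costK// (marginal_cost0 sE). Qed.

(** By convexity the first-order condition [g' q = w] is sufficient: [ginv w] is the best investment
    of a firm that wins with probability [w]. *)
Lemma ginv_max w q : 0 <= w <= 1 -> 0 <= q ->
  q * w - g q <= ginv w * w - g (ginv w).
Proof.
move=> w01 q0; have := cost_convex (ginv_ge0 w01) q0; rewrite ginvK//; lra.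
Qed.

(** The cost is arbitrary at negative arguments; composed with truncation at [0] it is monotone on
    the whole line, hence measurable. *)
Lemma measurable_cost (D : set (measurableTypeR R)) (q : R -> R) :
  measurable D -> measurable_fun D q -> (forall x, D x -> 0 <= q x) ->
  measurable_fun D (fun x => g (q x)).
Proof.
move=> mD mq q0.
apply: (eq_measurable_fun (fun x => g (Num.max (q x) 0))).
  by move=> x /[!inE] Dx; rewrite max_l// q0.
have mG : measurable_fun [set: R] (fun z => g (Num.max z 0)).
  apply: nondecreasing_measurable => // x y xy.
  by apply: cost_le; rewrite ?ge_max !le_max ?xy lexx ?orbT.
exact: (measurableT_comp mG mq).
Qed.

End Cost.

(** * Bounded measurable functions and expectations *)

Section BoundedMeasurable.
Context {R : realType} d (T : measurableType d) (D : set T).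
Implicit Types f g : T -> R.

Definition bmeas f :=
  measurable_fun D f /\ exists M, forall x, D x -> `|f x| <= M.

Lemma bmeas_cst (c : R) : bmeas (fun=> c).
Proof. by split; [exact: measurable_cst|exists `|c|]. Qed.

Lemma bmeasD f g : bmeas f -> bmeas g -> bmeas (fun x => f x + g x).
Proof.
move=> [mf [M Mf]] [mg [N Ng]]; split; first exact: measurable_funD.
by exists (M + N) => x Dx; rewrite (le_trans (ler_normD _ _))// lerD ?Mf ?Ng.
Qed.

Lemma bmeasN f : bmeas f -> bmeas (fun x => - f x).
Proof.
move=> [mf [M Mf]]; split; first exact/measurable_funN.
by exists M => x Dx; rewrite normrN Mf.
Qed.

Lemma bmeasB f g : bmeas f -> bmeas g -> bmeas (fun x => f x - g x).
Proof. by move=> bf bg; apply: bmeasD => //; exact: bmeasN. Qed.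

Lemma bmeasM f g : bmeas f -> bmeas g -> bmeas (fun x => f x * g x).
Proof.
move=> [mf [M Mf]] [mg [N Ng]]; split; first exact: measurable_funM.
by exists (M * N) => x Dx; rewrite normrM ler_pM ?Mf ?Ng.
Qed.

Lemma bmeas_max f g : bmeas f -> bmeas g -> bmeas (fun x => Num.max (f x) (g x)).
Proof.
move=> [mf [M Mf]] [mg [N Ng]]; split; first exact: measurable_maxr.
exists (Num.max M N) => x Dx; rewrite le_max.
by rewrite /Num.max; case: ifP => _; rewrite ?Mf ?Ng ?orbT.
Qed.

Lemma bmeas_min f g : bmeas f -> bmeas g -> bmeas (fun x => Num.min (f x) (g x)).
Proof.
move=> [mf [M Mf]] [mg [N Ng]]; split; first exact: measurable_minr.
exists (Num.max M N) => x Dx; rewrite le_max.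
by rewrite /Num.min; case: ifP => _; rewrite ?Mf ?Ng ?orbT.
Qed.

Lemma bmeas_bool (b : T -> bool) : measurable_fun D b ->
  bmeas (fun x => (b x)%:R).
Proof.
move=> mb; split; last by exists 1 => x _; case: (b x); rewrite ?normr1 ?normr0.
have mn : measurable_fun [set: bool] (fun c : bool => c%:R : R) by [].
exact: (measurableT_comp mn mb).
Qed.

Lemma bmeas_eq f g : {in D, f =1 g} -> bmeas f -> bmeas g.
Proof.
move=> fg [mf [M Mf]]; split; first exact: (eq_measurable_fun f).
by exists M => x Dx; rewrite -fg ?inE// Mf.
Qed.

Lemma bmeas_integrable (mu : {measure set T -> \bar R}) f : measurable D ->
  (mu D < +oo)%E -> bmeas f -> mu.-integrable D (EFin \o f).
Proof.
move=> mD muD [mf [M Mf]]; apply: measurable_bounded_integrable => //.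
exists M; split; first exact: num_real.
by move=> N MN x Dx; apply: (le_trans (Mf _ Dx)); exact: ltW.
Qed.

End BoundedMeasurable.

(** * Measurability on the space of types and of type profiles *)

Section Types.
Context {R : realType}.
Implicit Types (f : R -> R) (g : R * R -> R).
Local Notation T := (types : set (measurableTypeR R)).
Local Notation TT := (profiles (R := R)).

Lemma typesE (x : R) : types x = (0 <= x <= 1).
Proof. by rewrite /types/= in_itv. Qed.

Lemma measurable_types : measurable T.
Proof. exact: measurable_itv. Qed.

Lemma measurable_profiles : measurable TT.
Proof. by apply: measurableX; exact: measurable_types. Qed.

Lemma bmeas_nincr f : (forall x y, types x -> types y -> x <= y -> f y <= f x) ->
  bmeas T f.
Proof.
move=> nf; split; last first.
  exists (`|f 0| + `|f 1|) => x; rewrite typesE => /andP[x0 x1].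
  have t0 : types (0 : R) by rewrite typesE lexx ler01.
  have t1 : types (1 : R) by rewrite typesE lexx ler01.
  have tx : types x by rewrite typesE x0.
  rewrite ler_norml.
  have n1 := nf _ _ tx t1 x1; have n0 := nf _ _ t0 tx x0.
  have a0 := ler_norm (f 0); have := ler_norm (- f 1); rewrite normrN => a1.
  have b0 := normr_ge0 (f 0); have b1 := normr_ge0 (f 1).
  move: (f 0) (f 1) (f x) n1 n0 a0 a1 b0 b1 => u v w *.
  by apply/andP; split; lra.
(* Clamping to [[0, 1]] extends [f] from the types to a monotone function on the line. *)
pose cl (x : R) := Num.min (Num.max x 0) 1.
apply: (@eq_measurable_fun _ _ _ _ T (fun x => f (cl x))).
  by move=> x; rewrite inE typesE /cl => /andP[x0 x1]; rewrite max_l// min_l.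
apply: nonincreasing_measurable; first exact: measurable_types.
have tcl x : types (cl x).
  by rewrite typesE /cl le_min le_max lexx orbT ler01 ge_min lexx orbT.
move=> x y xy; apply: nf => //; rewrite /cl.
by rewrite le_min !ge_min !ge_max !le_max xy !lexx !orbT.
Qed.

Lemma bmeas_ndecr f : (forall x y, types x -> types y -> x <= y -> f x <= f y) ->
  bmeas T f.
Proof.
move=> nf; apply: (bmeas_eq (f := fun x => - - f x)).
  by move=> x _; rewrite opprK.
by apply: bmeasN; apply: bmeas_nincr => x y tx ty xy; rewrite lerN2 nf.
Qed.

Lemma bmeas_upset (b : R -> bool) :
  (forall x y, types x -> types y -> x <= y -> b x -> b y) ->
  bmeas T (fun x => (b x)%:R : R).
Proof.
move=> ub; apply: bmeas_ndecr => x y tx ty xy; rewrite ler_nat.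
by case: (boolP (b x)) => // bx; rewrite (ub _ _ tx ty xy bx).
Qed.

Lemma bmeas_downset (b : R -> bool) :
  (forall x y, types x -> types y -> x <= y -> b y -> b x) ->
  bmeas T (fun x => (b x)%:R : R).
Proof.
move=> db; apply: bmeas_nincr => x y tx ty xy; rewrite ler_nat.
by case: (boolP (b y)) => // bY; rewrite (db _ _ tx ty xy bY).
Qed.

Lemma bmeas_le (t : R) : bmeas T (fun x : R => (x <= t)%R%:R : R).
Proof. by apply: bmeas_downset => x y _ _; exact: le_trans. Qed.

Lemma bmeas_ltl (t : R) : bmeas T (fun x : R => (x < t)%R%:R : R).
Proof. by apply: bmeas_downset => x y _ _; exact: le_lt_trans. Qed.

Lemma bmeas_ge (t : R) : bmeas T (fun x : R => (t <= x)%R%:R : R).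
Proof. by apply: bmeas_upset => x y _ _ xy tx; exact: le_trans xy. Qed.

Lemma measurable_own (i : 'I_2) f : measurable_fun T f ->
  measurable_fun TT (fun w => f (type_of w i)).
Proof.
move=> mf; apply: (measurable_comp measurable_types _ mf).
  by move=> _ [w [w1 w2] <-]; rewrite /type_of; case: ifP.
rewrite /type_of; case: (i == firm1); apply: measurable_funTS.
  exact: measurable_fst.
exact: measurable_snd.
Qed.

Lemma bmeas_own (i : 'I_2) f : bmeas T f -> bmeas TT (fun w => f (type_of w i)).
Proof.
move=> [mf [M Mf]]; split; first exact: measurable_own.
by exists M => w [w1 w2]; apply: Mf; rewrite /type_of; case: ifP.
Qed.

Lemma measurable_section1 d' (Y : measurableType d') (g : R * R -> Y) (x : R) :
  types x -> measurable_fun TT g -> measurable_fun T (fun y => g (x, y)).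
Proof.
move=> tx mg; apply: (measurable_comp measurable_profiles _ mg).
  by move=> _ [y ty <-]; split.
by apply: measurable_funTS; exact: pair1_measurable.
Qed.

Lemma measurable_section2 d' (Y : measurableType d') (g : R * R -> Y) (y : R) :
  types y -> measurable_fun TT g -> measurable_fun T (fun x => g (x, y)).
Proof.
move=> tx mg; apply: (measurable_comp measurable_profiles _ mg).
  by move=> _ [x ty <-]; split.
by apply: measurable_funTS; exact: pair2_measurable.
Qed.

Lemma bmeas_section1 g (x : R) : types x -> bmeas TT g -> bmeas T (fun y => g (x, y)).
Proof.
move=> tx [mg [M Mg]]; split; first exact: measurable_section1.
by exists M => y ty; apply: Mg.
Qed.

Lemma bmeas_section2 g (y : R) : types y -> bmeas TT g -> bmeas T (fun x => g (x, y)).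
Proof.
move=> tx [mg [M Mg]]; split; first exact: measurable_section2.
by exists M => x ty; apply: Mg.
Qed.

End Types.

(** * Expectations over one type and over a profile, and Fubini's theorem *)

Section Expectation.
Context {R : realType} (E : environment R) (sE : standing_assumptions E).
Implicit Types (f h : R -> R) (g k : R * R -> R) (a b c t x y : R).
Local Notation P := (law E).
Local Notation F := (cdfF E).
Local Notation lam := (@lebesgue_measure R).
Local Notation T := (types : set (measurableTypeR R)).
Local Notation TT := (profiles (R := R)).

Definition Ex f : R := \int[P]_(x in T) f x.
Definition Exy g : R := \int[(P \x P)%E]_(w in TT) g w.
Definition integ f := P.-integrable T (EFin \o f).
Definition integ2 g := (P \x P)%E.-integrable TT (EFin \o g).

(** The density formula has the same right-hand side for both sets, so the law is carried by the
    types. *)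
Lemma lawI (A : set (measurableTypeR R)) : measurable A -> P A = P (A `&` T).
Proof.
move=> mA; rewrite (law_density sE mA).
by rewrite (law_density sE (measurableI _ _ mA measurable_types)) -setIA setIid.
Qed.

Lemma law_types : P T = 1%E.
Proof. by rewrite -[T]setTI -lawI// probability_setT. Qed.

Lemma law_profiles : (P \x P)%E TT = 1%E.
Proof.
rewrite /profiles (product_measure1E _ _ measurable_types measurable_types).
by rewrite -[RHS]mule1; congr (_ * _)%E; exact: law_types.
Qed.

Lemma bmeas_integ f : bmeas T f -> integ f.
Proof.
apply: bmeas_integrable; first exact: measurable_types.
by rewrite [X in (X < _)%E]law_types ltry.
Qed.

Lemma bmeas_integ2 g : bmeas TT g -> integ2 g.
Proof.
apply: bmeas_integrable; first exact: measurable_profiles.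
by rewrite [X in (X < _)%E]law_profiles ltry.
Qed.

Lemma integD f h : integ f -> integ h -> integ (fun x => f x + h x).
Proof.
move=> If Ih; have := integrableD measurable_types If Ih.
by apply: eq_integrable => [|x _] //; exact: measurable_types.
Qed.

Lemma integB f h : integ f -> integ h -> integ (fun x => f x - h x).
Proof.
move=> If Ih; have := integrableB measurable_types If Ih.
by apply: eq_integrable => [|x _] //; exact: measurable_types.
Qed.

Lemma integZ c f : integ f -> integ (fun x => c * f x).
Proof.
move=> If; have := integrableZl measurable_types c If.
by apply: eq_integrable => [|x _] //; exact: measurable_types.
Qed.

Lemma integ2D g k : integ2 g -> integ2 k -> integ2 (fun w => g w + k w).
Proof.
move=> If Ih; have := integrableD measurable_profiles If Ih.
by apply: eq_integrable => [|x _] //; exact: measurable_profiles.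
Qed.

Lemma integ2B g k : integ2 g -> integ2 k -> integ2 (fun w => g w - k w).
Proof.
move=> If Ih; have := integrableB measurable_profiles If Ih.
by apply: eq_integrable => [|x _] //; exact: measurable_profiles.
Qed.

Lemma eq_Ex f h : (forall x, types x -> f x = h x) -> Ex f = Ex h.
Proof. by move=> fh; apply: eq_Rintegral => x /[!inE] /fh. Qed.

Lemma Ex_cst c : Ex (fun=> c) = c.
Proof.
by rewrite /Ex Rintegral_cst ?[X in fine X]law_types ?mulr1//; exact: measurable_types.
Qed.

Lemma ExD f h : integ f -> integ h -> Ex (fun x => f x + h x) = Ex f + Ex h.
Proof. by move=> *; apply: RintegralD => //; exact: measurable_types. Qed.

Lemma ExB f h : integ f -> integ h -> Ex (fun x => f x - h x) = Ex f - Ex h.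
Proof. by move=> *; apply: RintegralB => //; exact: measurable_types. Qed.

Lemma ExZ c f : integ f -> Ex (fun x => c * f x) = c * Ex f.
Proof. by move=> *; apply: RintegralZl => //; exact: measurable_types. Qed.

Lemma ExyD g k : integ2 g -> integ2 k -> Exy (fun w => g w + k w) = Exy g + Exy k.
Proof. by move=> *; apply: RintegralD => //; exact: measurable_profiles. Qed.

Lemma ExyB g k : integ2 g -> integ2 k -> Exy (fun w => g w - k w) = Exy g - Exy k.
Proof. by move=> *; apply: RintegralB => //; exact: measurable_profiles. Qed.

Lemma le_Ex f h : integ f -> integ h -> (forall x, types x -> f x <= h x) ->
  Ex f <= Ex h.
Proof. by move=> *; apply: le_Rintegral => //; exact: measurable_types. Qed.

Lemma le_Exy g k : integ2 g -> integ2 k -> (forall w, TT w -> g w <= k w) ->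
  Exy g <= Exy k.
Proof. by move=> *; apply: le_Rintegral => //; exact: measurable_profiles. Qed.

Lemma Ex_ge0 f : (forall x, types x -> 0 <= f x) -> 0 <= Ex f.
Proof. by move=> f0; apply: Rintegral_ge0. Qed.

Lemma Ex_EFin f : integ f -> (\int[P]_(x in T) (f x)%:E)%E = (Ex f)%:E.
Proof. by move=> If; rewrite fineK//; exact: (integrable_fin_num measurable_types). Qed.

Lemma Exy_EFin g : integ2 g ->
  (\int[(P \x P)%E]_(w in TT) (g w)%:E)%E = (Exy g)%:E.
Proof. by move=> Ig; rewrite fineK//; exact: (integrable_fin_num measurable_profiles). Qed.

Lemma integ_eq f h : (forall x, types x -> f x = h x) -> integ f -> integ h.
Proof.
by move=> fh; apply: eq_integrable => [|x /[!inE] tx]; [exact: measurable_types|rewrite /= fh].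
Qed.

Lemma integ2_eq g k : (forall w, TT w -> g w = k w) -> integ2 g -> integ2 k.
Proof.
by move=> fh; apply: eq_integrable => [|x /[!inE] tx]; [exact: measurable_profiles|rewrite /= fh].
Qed.

Lemma patch_profiles g x y :
  ((EFin \o g) \_ TT) (x, y) =
  if x \in T then ((fun y => (g (x, y))%:E) \_ T) y else 0%E.
Proof.
rewrite !patchE.
have -> : ((x, y) \in TT) = (x \in T) && (y \in T) by exact: in_setX.
by case: (x \in T); case: (y \in T).
Qed.

Lemma patch_profiles_swap g x y :
  ((EFin \o g) \_ TT) (x, y) =
  if y \in T then ((fun x => (g (x, y))%:E) \_ T) x else 0%E.
Proof. by rewrite patch_profiles !patchE; case: (x \in T); case: (y \in T). Qed.

(** Every section is assumed integrable, and not just almost every one, so that the real-valued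
    inner expectation agrees with the extended integral at each type. *)
Lemma Exy_fubini1 g : integ2 g -> (forall x, types x -> integ (fun y => g (x, y))) ->
  integ (fun x => Ex (fun y => g (x, y))) /\
  Exy g = Ex (fun x => Ex (fun y => g (x, y))).
Proof.
move=> Ig Igs.
have Ip : (P \x P)%E.-integrable setT ((EFin \o g) \_ TT).
  by rewrite -integrable_mkcond//; exact: measurable_profiles.
have key : fubini_F P ((EFin \o g) \_ TT) =
    (EFin \o (fun x => Ex (fun y => g (x, y)))) \_ T.
  apply/funext => x; rewrite /fubini_F patchE.
  under eq_integral do rewrite patch_profiles.
  case: (boolP (x \in T)) => xT; last by rewrite integral0.
  by rewrite -integral_mkcond Ex_EFin//; apply: Igs; rewrite inE in xT.
split.
  apply/(integrable_mkcond _ measurable_types).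
  by rewrite -key; exact: integrable_fubini_F.
apply: EFin_inj; rewrite -Exy_EFin// integral_mkcond -integral12_prod_meas1//.
rewrite key -integral_mkcond Ex_EFin//.
apply/(integrable_mkcond _ measurable_types).
by rewrite -key; exact: integrable_fubini_F.
Qed.

Lemma Exy_fubini2 g : integ2 g -> (forall y, types y -> integ (fun x => g (x, y))) ->
  integ (fun y => Ex (fun x => g (x, y))) /\
  Exy g = Ex (fun y => Ex (fun x => g (x, y))).
Proof.
move=> Ig Igs.
have Ip : (P \x P)%E.-integrable setT ((EFin \o g) \_ TT).
  by rewrite -integrable_mkcond//; exact: measurable_profiles.
have key : fubini_G P ((EFin \o g) \_ TT) =
    (EFin \o (fun y => Ex (fun x => g (x, y)))) \_ T.
  apply/funext => y; rewrite /fubini_G patchE.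
  under eq_integral do rewrite patch_profiles_swap.
  case: (boolP (y \in T)) => yT; last by rewrite integral0.
  by rewrite -integral_mkcond Ex_EFin//; apply: Igs; rewrite inE in yT.
(* The inner integral is bounded in absolute value by the integral of the absolute value, whose
   iterated integral in this order is finite by Tonelli. *)
have IG : P.-integrable setT ((EFin \o (fun y => Ex (fun x => g (x, y)))) \_ T).
  have mG := measurable_fubini_G Ip.
  have mp := measurable_int _ Ip.
  rewrite -key; apply/integrableP; split; first exact: mG.
  apply: le_lt_trans ((integrable21ltyP _ _ mp).1 Ip).
  apply: ge0_le_integral => //.
  - by apply: measurableT_comp => //; exact: mG.
  - apply: (measurable_fun_fubini_tonelli_G (abse \o ((EFin \o g) \_ TT))) => //=.
    exact: measurableT_comp.
  - by move=> y _; apply: le_abse_integral => //; exact: measurableT_comp.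
split; first exact/(integrable_mkcond _ measurable_types).
apply: EFin_inj; rewrite -Exy_EFin// integral_mkcond -integral21_prod_meas1//.
rewrite key -integral_mkcond Ex_EFin//.
exact/(integrable_mkcond _ measurable_types).
Qed.

End Expectation.

(** * The distribution of types *)

Section Cdf.
Context {R : realType} (E : environment R) (sE : standing_assumptions E).
Implicit Types (a b c e t u x y : R).
Local Notation P := (law E).
Local Notation F := (cdfF E).
Local Notation lam := (@lebesgue_measure R).
Local Notation T := (types : set (measurableTypeR R)).

Lemma types0 : types (0 : R). Proof. by rewrite typesE lexx ler01. Qed.

Lemma types1 : types (1 : R). Proof. by rewrite typesE lexx ler01. Qed.

Lemma types_itv a b c : types a -> types b -> a <= c -> c <= b -> types c.
Proof.
rewrite !typesE => /andP[a0 _] /andP[_ b1] ac cb.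
by rewrite (le_trans a0)//= (le_trans cb).
Qed.

Lemma density_integrable :
  lam.-integrable T (EFin \o density E).
Proof.
apply/integrableP; split; first by apply/measurable_EFinP; exact: (density_measurable sE).
have := law_density sE measurable_types; rewrite (setIid T) (law_types sE) => int1.
rewrite (_ : (\int[_]_(x in _) _)%E = 1%E) ?ltry// int1.
apply: eq_integral => x /[!inE] /(density_pos sE)/ltW f0.
by rewrite /= ger0_norm.
Qed.

Lemma law_null (A : set (measurableTypeR R)) : measurable A -> lam A = 0%E -> P A = 0%E.
Proof.
move=> mA A0; rewrite (law_density sE mA).
have mAT : measurable (A `&` T) by apply: measurableI => //; exact: measurable_types.
apply: null_set_integral => //.
  apply/measurable_EFinP; apply: measurable_funS (density_measurable sE).
    exact: measurable_types.
  by move=> x [].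
by apply: (subset_measure0 mAT mA _ A0) => x [].
Qed.

Lemma law_set1 x : P [set x] = 0%E.
Proof. by apply: law_null => //; rewrite lebesgue_measure_set1. Qed.

Lemma fine_lawD (A B : set (measurableTypeR R)) : measurable A -> measurable B ->
  A `&` B = set0 -> fine (P (A `|` B)) = fine (P A) + fine (P B).
Proof.
move=> mA mB AB; rewrite measureU// fineD//; exact: fin_num_measure.
Qed.

Lemma Ex_bool (b : R -> bool) : measurable ([set x | b x] : set (measurableTypeR R)) ->
  Ex E (fun x => (b x)%:R) = fine (P [set x | b x]).
Proof.
move=> mb; rewrite (lawI sE mb) -(integral_indic P measurable_types mb).
congr fine; apply: eq_integral => x _; rewrite indicE.
by case: (boolP (b x)) => [bx|nbx]; [rewrite mem_set|rewrite memNset//; exact/negP].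
Qed.

Lemma Ex_le t : Ex E (fun x => (x <= t)%R%:R) = F t.
Proof.
rewrite Ex_bool/cdfF; last first.
  by rewrite (_ : [set x | _] = `]-oo, t]%classic)//; apply/seteqP; split=> x; rewrite /= in_itv.
by congr (fine (P _)); apply/seteqP; split=> x; rewrite /= in_itv.
Qed.

Lemma Ex_gt t : Ex E (fun x => (t < x)%R%:R) = 1 - F t.
Proof.
have i1 := bmeas_integ sE (bmeas_le t).
have i2 := bmeas_integ sE (bmeas_cst T (1 : R)).
rewrite -Ex_le -[X in X - _](Ex_cst sE 1) -ExB//.
by apply: eq_Ex => x _; case: (ltP t x) => _; rewrite /= ?subr0 ?subrr.
Qed.

Lemma Ex_eq t : Ex E (fun x => (x == t)%R%:R) = 0.
Proof.
by rewrite Ex_bool (_ : [set x | _] = [set t]) ?law_set1//;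
  apply/seteqP; split=> x/= /eqP.
Qed.

Lemma Ex_lt t : Ex E (fun x => (x < t)%R%:R) = F t.
Proof.
have mlt := bmeas_ltl t.
have meq : bmeas T (fun x : R => (x == t)%R%:R : R).
  apply: (bmeas_eq (f := fun x => (x <= t)%R%:R - (x < t)%R%:R)).
    by move=> x _; case: (ltgtP x t); rewrite /= ?subrr ?subr0.
  by apply: bmeasB => //; exact: bmeas_le.
rewrite -Ex_le -[LHS]addr0 -(Ex_eq t) -ExD; [|exact: (bmeas_integ sE)..].
by apply: eq_Ex => x _; case: (ltgtP x t); rewrite /= ?addr0 ?add0r.
Qed.

Lemma Ex_ge t : Ex E (fun x => (t <= x)%R%:R) = 1 - F t.
Proof.
have i1 := bmeas_integ sE (bmeas_ltl t).
have i2 := bmeas_integ sE (bmeas_cst T (1 : R)).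
rewrite -Ex_lt -[X in X - _](Ex_cst sE 1) -ExB//.
by apply: eq_Ex => x _; case: (leP t x) => _; rewrite /= ?subr0 ?subrr.
Qed.

Lemma cdf0 : F 0 = 0.
Proof.
rewrite -Ex_lt -[RHS](Ex_cst sE 0); apply: eq_Ex => x.
by rewrite typesE => /andP[x0 _]; rewrite ltNge x0.
Qed.

Lemma cdf1 : F 1 = 1.
Proof.
rewrite -Ex_le -[RHS](Ex_cst sE 1); apply: eq_Ex => x.
by rewrite typesE => /andP[_ ->].
Qed.

Lemma cdf_le x y : x <= y -> F x <= F y.
Proof.
move=> xy; rewrite -!Ex_le; apply: le_Ex; [exact: (bmeas_integ sE (bmeas_le _))..|].
by move=> z _; rewrite ler_nat; case: (leP z x) => // zx; rewrite (le_trans zx xy).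
Qed.

Lemma cdf_bounds x : types x -> 0 <= F x <= 1.
Proof. by rewrite typesE => /andP[x0 x1]; rewrite -{1}cdf0 -cdf1 !cdf_le. Qed.

Lemma cdfC_bounds x : types x -> 0 <= 1 - F x <= 1.
Proof. by move=> /cdf_bounds; lra. Qed.

(** If [F x = F y], the density integrates to [0] on []x, y]]; being positive there, it forces that
    interval to be Lebesgue-null, against its length [y - x]. *)
Lemma cdf_lt x y : types x -> types y -> x < y -> F x < F y.
Proof.
move=> tx ty xy; rewrite lt_neqAle cdf_le ?ltW// andbT; apply/eqP => Fxy.
pose I : set (measurableTypeR R) := `]x, y]%classic.
have mI : measurable I by exact: measurable_itv.
have IT : I `<=` T.
  move=> z; rewrite /I/= in_itv/= => /andP[xz zy].
  exact: (types_itv tx ty (ltW xz) zy).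
have PI : P I = 0%E.
  have eU : `]-oo, y]%classic = (`]-oo, x]%classic : set (measurableTypeR R)) `|` I.
    apply/seteqP; split=> z; rewrite /I/= !in_itv/=.
      by move=> zy; case: (leP z x) => zx; [left|right; rewrite zy].
    by case=> [zx|/andP[]//]; rewrite (le_trans zx)// ltW.
  have mx : measurable (`]-oo, x]%classic : set (measurableTypeR R)).
    exact: measurable_itv.
  have dI : (`]-oo, x]%classic : set (measurableTypeR R)) `&` I = set0.
    apply/seteqP; split=> z//; rewrite /I/= !in_itv/= => -[zx /andP[+ _]].
    by rewrite ltNge zx.
  have := Fxy; rewrite /cdfF eU (fine_lawD mx mI dI).
  rewrite -{1}[fine (P _)]addr0 => /addrI/esym PI0.
  by rewrite -[LHS]fineK ?PI0// fin_num_measure.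
have : lam I = 0%E.
  have := law_density sE mI; rewrite PI (setIidl IT) => /esym int0.
  have mf : measurable_fun I (EFin \o density E).
    apply/measurable_EFinP; apply: measurable_funS (density_measurable sE) => //.
    exact: measurable_types.
  have : (\int[lam]_(z in I) `|(density E z)%:E| = 0)%E.
    rewrite -[RHS]int0; apply: eq_integral => z /[!inE] /IT/(density_pos sE)/ltW z0.
    by rewrite gee0_abs ?lee_fin.
  move=> /(ae_eq_integral_abs lam mI mf).1 [N [mN N0 sub]].
  apply: (subset_measure0 mI mN _ N0); apply: subset_trans sub => z Iz /= /(_ Iz).
  by move=> [] f0; have := density_pos sE (IT _ Iz); rewrite f0 ltxx.
rewrite /I lebesgue_measure_itv/= lte_fin xy -EFinB => -[] /eqP.
by rewrite subr_eq0 gt_eqF.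
Qed.

Lemma cdf_inj x y : types x -> types y -> F x = F y -> x = y.
Proof.
move=> tx ty Fxy; case: (ltgtP x y) => // xy.
  by have := cdf_lt tx ty xy; rewrite Fxy ltxx.
by have := cdf_lt ty tx xy; rewrite Fxy ltxx.
Qed.

(** On the types [F] is the indefinite integral of an integrable density, hence continuous. *)
Lemma cdf_surj u : 0 <= u <= 1 -> exists2 t, types t & F t = u.
Proof.
move=> u01.
have cF : {within `[0, 1], continuous F}.
  have := parameterized_integral_continuous ler01 density_integrable.
  apply: subspace_eq_continuous => x /[!inE] tx.
  rewrite /from_subspace/= /parameterized_integral /Rintegral /cdfF.
  rewrite (law_density sE); last exact: measurable_itv.
  congr fine; congr (integral _ _ _).
  apply/seteqP; split=> z; rewrite /types/= !in_itv/=.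
    move=> /andP[z0 zx]; split => //; rewrite z0/= (le_trans zx)//.
    by have := tx; rewrite /= in_itv/= => /andP[].
  by move=> [-> /andP[->]].
have [|t t01 <-] := IVT ler01 cF (v := u).
  by rewrite cdf0 cdf1 min_l// max_r.
by exists t.
Qed.

(** The form in which continuity of [F] is used for limits from the right: [s] is a preimage of a
    value slightly above [F t], and monotonicity of [F] places it. *)
Lemma cdf_close_right t e : types t -> t < 1 -> 0 < e ->
  exists s, [/\ t < s, s < 1, types s & F s < F t + e].
Proof.
move=> tt t1 e0; have Ft1 : F t < 1 by rewrite -cdf1 cdf_lt//; exact: types1.
have /andP[F0 _] := cdf_bounds tt.
pose u := F t + Num.min e (1 - F t) / 2.
have m0 : 0 < Num.min e (1 - F t) by rewrite lt_min e0 subr_gt0.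
have me : Num.min e (1 - F t) <= e by rewrite ge_min lexx.
have m1 : Num.min e (1 - F t) <= 1 - F t by rewrite ge_min lexx orbT.
have [|s ts Fs] := @cdf_surj u; first by rewrite /u; apply/andP; split; lra.
have lt x y : types x -> types y -> F x < F y -> x < y.
  by move=> tx ty; rewrite !ltNge; apply: contra => /cdf_le.
exists s; split => //; rewrite ?Fs /u; [apply: lt => //|apply: lt => //|]; rewrite ?Fs ?cdf1 /u; try lra.
exact: types1.
Qed.

Lemma cdf_close_left t e : types t -> 0 < t -> 0 < e ->
  exists s, [/\ 0 < s, s < t, types s & F t - e < F s].
Proof.
move=> tt t1 e0; have Ft1 : 0 < F t by rewrite -cdf0 cdf_lt//; exact: types0.
have /andP[_ F1] := cdf_bounds tt.
pose u := F t - Num.min e (F t) / 2.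
have m0 : 0 < Num.min e (F t) by rewrite lt_min e0.
have me : Num.min e (F t) <= e by rewrite ge_min lexx.
have m1 : Num.min e (F t) <= F t by rewrite ge_min lexx orbT.
have [|s ts Fs] := @cdf_surj u; first by rewrite /u; apply/andP; split; lra.
have lt x y : types x -> types y -> F x < F y -> x < y.
  by move=> tx ty; rewrite !ltNge; apply: contra => /cdf_le.
exists s; split => //; rewrite ?Fs /u; [apply: lt => //|apply: lt => //|]; rewrite ?Fs ?cdf0 /u; try lra.
exact: types0.
Qed.

Lemma quantileK x : types x -> quantile E (F x) = x.
Proof.
move=> tx; rewrite /quantile pinvKV ?inE//.
by move=> a b; rewrite !inE => ta tb; exact: cdf_inj.
Qed.

End Cdf.

(** * The symmetric quality schedule, its expected excess, and [kappa] *)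

Section Threshold.
Context {R : realType} (E : environment R) (sE : standing_assumptions E).
Implicit Types (a b c e q t u x y : R).
Local Notation F := (cdfF E).
Local Notation g := (cost E).
Local Notation g' := (marginal_cost E).
Local Notation p := (q_sym E).
Local Notation T := (types : set (measurableTypeR R)).

Lemma q_symP x : types x -> 0 <= p x /\ g' (p x) = 1 - F x.
Proof. by move=> /(cdfC_bounds sE)/(ginvP sE). Qed.

Lemma q_sym_ge0 x : types x -> 0 <= p x. Proof. by move=> /q_symP[]. Qed.

Lemma q_sym_lt x y : types x -> types y -> x < y -> p y < p x.
Proof.
move=> tx ty xy; have := cdf_lt sE tx ty xy.
have := cdfC_bounds sE tx; have := cdfC_bounds sE ty.
by move=> /andP[? ?] /andP[? ?] ?; apply: (ginv_lt sE) => //; lra.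
Qed.

Lemma q_sym_le x y : types x -> types y -> x <= y -> p y <= p x.
Proof.
by move=> tx ty; rewrite le_eqVlt => /predU1P[->//|xy]; exact/ltW/q_sym_lt.
Qed.

Lemma profit_max q : 0 <= q -> q - g q <= p 0 - g (p 0).
Proof.
move=> q0; have : q * (1 - F 0) - g q <= p 0 * (1 - F 0) - g (p 0).
  exact: (ginv_max sE (cdfC_bounds sE (@types0 R)) q0).
by rewrite (cdf0 sE) subr0 !mulr1.
Qed.

Lemma q_sym1 : p 1 = 0.
Proof. by rewrite /q_sym (cdf1 sE) subrr; exact: (ginv0 sE). Qed.

Lemma bmeas_q_sym : bmeas T p.
Proof. by apply: bmeas_nincr => x y tx ty; exact: q_sym_le. Qed.

Lemma q_sym_surj q : 0 <= q -> q <= p 0 -> exists2 t, types t & p t = q.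
Proof.
move=> q0 qb; have gq1 : g' q <= 1.
  apply: le_trans (marginal_cost_le sE q0 qb) _.
  by rewrite (q_symP (@types0 R)).2 (cdf0 sE) subr0.
have gq0 := marginal_cost_ge0 sE q0.
have [|t tt Ft] := @cdf_surj _ _ sE (1 - g' q); first by apply/andP; split; lra.
by exists t => //; rewrite /q_sym Ft opprB addrC subrK; exact: (marginal_costK sE).
Qed.

(* Fubini would give [E (q - p)^+ = \int_0^q P(p < s) ds = \int_0^q g'], i.e. [g q]. *)
Definition excess q : R := Ex E (fun y => Num.max (q - p y) 0).

Lemma bmeas_excess q : bmeas T (fun y => Num.max (q - p y) 0).
Proof.
by apply: bmeas_max; [apply: bmeasB; [exact: bmeas_cst|exact: bmeas_q_sym]|exact: bmeas_cst].
Qed.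

(** In [q], the slope of [Num.max (q - p y) 0] is the indicator of [p y < q]. At [q = p t] this
    event is [t < y], of probability [1 - F t = g' q]. *)
Lemma excess_squeezed q : q <= p 0 -> squeezed_by g' 0 q excess.
Proof.
move=> qb a b a0 ab bq.
have [ta tta pa] := q_sym_surj a0 (le_trans ab (le_trans bq qb)).
have [tb ttb pb] := q_sym_surj (le_trans a0 ab) (le_trans bq qb).
have g'E t : types t -> g' (p t) = Ex E (fun y => (t <= y)%R%:R).
  by move=> tt; rewrite (q_symP tt).2 (Ex_ge sE).
have ige t : integ E (fun y => (t <= y)%R%:R) by exact/(bmeas_integ sE)/bmeas_ge.
have iex z : integ E (fun y => Num.max (z - p y) 0).
  exact/(bmeas_integ sE)/bmeas_excess.
have ga : g' a = Ex E (fun y => (ta <= y)%R%:R) by rewrite -g'E// pa.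
have gb : g' b = Ex E (fun y => (tb <= y)%R%:R) by rewrite -g'E// pb.
rewrite /excess -ExB// ga gb ![_ * (b - a)]mulrC -!ExZ//.
apply/andP; split; apply: le_Ex; rewrite ?integB//; try exact: integZ;
  try exact: integB.
- move=> y ty; rewrite /Num.max; case: (leP ta y) => [/(q_sym_le tta ty)|_].
    by rewrite pa mulr1 => pya; case: ifP; case: ifP; lra.
  by rewrite mulr0; case: ifP; case: ifP; lra.
- move=> y ty; rewrite /Num.max; case: (leP tb y) => [_|/(q_sym_lt ty ttb)].
    by rewrite mulr1; case: ifP; case: ifP; lra.
  by rewrite pb mulr0 => pya; case: ifP; case: ifP; lra.
Qed.

Lemma excessE q : 0 <= q -> q <= p 0 -> excess q = g q.
Proof.
move=> q0 qb; have := squeezed_increments q0 (excess_squeezed qb) (@cost_squeezed _ _ sE q).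
rewrite (cost0 sE) (_ : excess 0 = 0) ?subr0//.
rewrite /excess -[RHS](Ex_cst sE 0); apply: eq_Ex => y ty.
by rewrite max_r// sub0r oppr_le0 q_sym_ge0.
Qed.

(** Beyond [p 0] the excess has slope [1], while the slope of [g] is at least [g' (p 0) = 1]. *)
Lemma excess_le q : 0 <= q -> excess q <= g q.
Proof.
move=> q0; have [qb|/ltW qb] := leP q (p 0); first by rewrite excessE.
have t0 := @types0 R; have p0 := q_sym_ge0 t0.
have := cost_convex sE p0 q0; rewrite (q_symP t0).2 (cdf0 sE) subr0 mul1r.
rewrite -(excessE p0 (lexx _)) => H.
suff : excess q <= Ex E (fun y => Num.max (p 0 - p y) 0 + (q - p 0)).
  rewrite ExD ?(Ex_cst sE); first by rewrite -/(excess (p 0)); lra.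
    exact/(bmeas_integ sE)/bmeas_excess.
  exact/(bmeas_integ sE)/bmeas_cst.
apply: le_Ex.
- exact/(bmeas_integ sE)/bmeas_excess.
- by apply: integD; apply: (bmeas_integ sE); [exact: bmeas_excess|exact: bmeas_cst].
- by move=> y ty; rewrite /Num.max; case: ifP; case: ifP; lra.
Qed.

Definition vcost x : R := alpha E * virtual_type E x.
Definition kappa x : R := p x + vcost x.

Lemma vcost_lt x y : types x -> types y -> x < y -> vcost x < vcost y.
Proof.
by move=> tx ty xy; rewrite ltr_pM2l ?(alpha_pos sE)// (virtual_type_increasing sE).
Qed.

Lemma vcost_le x y : types x -> types y -> x <= y -> vcost x <= vcost y.
Proof.
by move=> tx ty; rewrite le_eqVlt => /predU1P[->//|xy]; exact/ltW/vcost_lt.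
Qed.

Lemma virtual_type_ge0 x : types x -> 0 <= virtual_type E x.
Proof.
move=> tx; have /andP[F0 _] := cdf_bounds sE tx.
have := tx; rewrite typesE => /andP[x0 _].
by rewrite addr_ge0// divr_ge0// ltW// (density_pos sE).
Qed.

Lemma vcost_ge0 x : types x -> 0 <= vcost x.
Proof. by move=> tx; rewrite mulr_ge0 ?virtual_type_ge0// ltW// (alpha_pos sE). Qed.

Lemma kappa_ge0 x : types x -> 0 <= kappa x.
Proof. by move=> tx; rewrite addr_ge0 ?q_sym_ge0 ?vcost_ge0. Qed.

Lemma bmeas_vcost : bmeas T vcost.
Proof. by apply: bmeas_ndecr => x y tx ty; exact: vcost_le. Qed.

Lemma bmeas_kappa : bmeas T kappa.
Proof. by apply: bmeasD; [exact: bmeas_q_sym|exact: bmeas_vcost]. Qed.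

(* In the type coordinate [alpha * xi (g' q) - q] is [alpha - kappa]. *)
Lemma kappa_quasi_convex : sufficiently_concave E ->
  forall x y z, types x -> types y -> types z -> x < y -> y < z ->
  kappa y < Num.max (kappa x) (kappa z).
Proof.
move=> sc x y z tx ty tz xy yz.
have dom t : types t -> 0 <= p t /\ 0 <= g' (p t) <= 1.
  by move=> tt; rewrite q_sym_ge0// (q_symP tt).2 (cdfC_bounds sE tt).
have hE t : types t -> alpha E * xi E (g' (p t)) - p t = alpha E - kappa t.
  move=> tt; rewrite (q_symP tt).2 /xi (_ : 1 - (1 - F t) = F t) ?quantileK//; last by ring.
  by rewrite /kappa /vcost; ring.
have pxy := q_sym_lt tx ty xy; have pyz := q_sym_lt ty tz yz.
have pxz : 0 < p x - p z by lra.
pose s := (p y - p z) / (p x - p z).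
have s01 : 0 < s < 1.
  rewrite /s ltr_pdivrMr// ltr_pdivlMr// mul0r mul1r.
  by apply/andP; split; lra.
have ey : s * p x + (1 - s) * p z = p y.
  by rewrite /s; field; rewrite gt_eqF.
have xz : p x != p z by rewrite gt_eqF// (lt_trans pyz).
have := sc _ _ s (dom x tx) (dom z tz) xz s01.
by rewrite ey !hE// gt_min lt_max !ltrD2l !ltrN2.
Qed.

End Threshold.

(** * The threshold and the dual certificate *)

Section ThresholdExists.
Context {R : realType} (E : environment R) (sE : standing_assumptions E).
Hypothesis sc : sufficiently_concave E.
Implicit Types (a b c e q t u v x y : R).
Local Notation F := (cdfF E).
Local Notation p := (q_sym E).
Local Notation k := (kappa E).
Local Notation T := (types : set (measurableTypeR R)).

(** The mean of [kappa] below [y] is [S y / F y]; comparisons with it are written as [F y * k y]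
    against [S y], which makes sense at [F 0 = 0] too. *)
Definition Skappa y : R := Ex E (fun x => (x < y)%R%:R * k x).
Local Notation S := Skappa.

Definition below_threshold : set R :=
  [set y | types y /\ (y = 0 \/ (y < 1 /\ F y * k y <= S y))].

Let bm y : bmeas T (fun x => (x < y)%R%:R * k x).
Proof. by apply: bmeasM; [exact: bmeas_ltl|exact: bmeas_kappa]. Qed.

Let im y : integ E (fun x => (x < y)%R%:R * k x).
Proof. exact: (bmeas_integ sE). Qed.

Let il y : integ E (fun x : R => (x < y)%R%:R).
Proof. exact/(bmeas_integ sE)/bmeas_ltl. Qed.

Let S_le x y : x <= y -> S x <= S y.
Proof.
move=> xy; apply: le_Ex => // z tz; have kz := kappa_ge0 sE tz.
apply: ler_wpM2r => //; rewrite ler_nat.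
by case: (ltP z x) => // zx; rewrite (lt_le_trans zx xy).
Qed.

Let S_ge0 x : 0 <= S x.
Proof. by apply: Ex_ge0 => y ty; rewrite mulr_ge0// kappa_ge0. Qed.

Let S0 : S 0 = 0.
Proof.
rewrite /S -[RHS](Ex_cst sE 0); apply: eq_Ex => x; rewrite typesE => /andP[x0 _].
by rewrite ltNge x0 mul0r.
Qed.

Let above x : types x -> x < 1 -> ~ below_threshold x -> 0 < x /\ S x < F x * k x.
Proof.
move=> tx x1 nb; split.
  have := tx; rewrite typesE => /andP[+ _]; rewrite le_eqVlt => /predU1P[x0|//].
  by exfalso; apply: nb; split => //; left.
by rewrite ltNge; apply/negP => SF; apply: nb; split => //; right.
Qed.

(** A value above the mean of the earlier ones exceeds some earlier value, and a strictly
    quasi-convex function that has once risen keeps rising. *)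
Let above_lt x y : types x -> types y -> x < y -> S x < F x * k x -> k x < k y.
Proof.
move=> tx ty xy Sx.
have [z [tz zx kzx]] : exists z, [/\ types z, z < x & k z < k x].
  apply: contrapT => no.
  have : F x * k x <= S x.
    rewrite -(Ex_lt sE x) mulrC -ExZ//; apply: le_Ex => //; first exact: integZ.
    move=> z tz; case: (ltP z x) => zx; rewrite ?mulr1 ?mul1r ?mulr0 ?mul0r//.
    by rewrite leNgt; apply/negP => kzx; apply: no; exists z.
  by rewrite leNgt Sx.
have := kappa_quasi_convex sE sc tz tx ty zx xy; rewrite lt_max => /orP[xz|//].
by move: xz; rewrite ltNge (ltW kzx).
Qed.

(** Being above the mean is inherited by later types: the mass below [x] contributes
    [S x < F x * k x <= F x * k y], and on [[x, y)] quasi-convexity keeps [kappa] at most [k y].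
    Hence the supremum [threshold] separates the two regimes. *)
Let above_up x y : types x -> types y -> x < y -> S x < F x * k x ->
  S y < F y * k y.
Proof.
move=> tx ty xy Sx; have kxy := above_lt tx ty xy Sx.
have Fxy := cdf_lt sE tx ty xy.
apply: (@le_lt_trans _ _ (S x + (F y - F x) * k y)).
  rewrite -!(Ex_lt sE) -ExB// [_ * k y]mulrC -ExZ; last exact: integB.
  rewrite -ExD//; last exact/integZ/integB.
  apply: le_Ex => //; first by apply: integD => //; exact/integZ/integB.
  move=> z tz; case: (ltP z x) => zx; first by rewrite (lt_trans zx xy)/=; lra.
  rewrite mul0r add0r subr0; case: (ltP z y) => zy; rewrite ?mul0r ?mulr0// mul1r mulr1.
  move: zx; rewrite le_eqVlt => /predU1P[<-|xz]; first exact: ltW.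
  have := kappa_quasi_convex sE sc tx tz ty xz zy.
  by rewrite lt_max => /orP[zx|/ltW//]; rewrite ltW// (lt_trans zx).
have := cdf_bounds sE tx => /andP[F0 _].
have : F x * k x <= F x * k y by rewrite ler_wpM2l// ltW.
lra.
Qed.

Definition threshold : R := sup below_threshold.
Local Notation t0 := threshold.

Let below0 : below_threshold 0.
Proof. by split; [exact: types0|left]. Qed.

Let ubound1 : ubound below_threshold 1.
Proof. by move=> x [+ _]; rewrite typesE => /andP[]. Qed.

Lemma types_threshold : types t0.
Proof.
rewrite typesE; apply/andP; split; first exact: (ub_le_sup (ex_intro _ _ ubound1) below0).
by apply: ge_sup => //; exists 0.
Qed.

Let gt_threshold x : types x -> t0 < x -> x < 1 -> S x < F x * k x.
Proof.
move=> tx t0x x1; apply: (above tx x1 _).2 => bx.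
by have := ub_le_sup (ex_intro _ _ ubound1) bx; rewrite leNgt t0x.
Qed.

Let lt_threshold x : types x -> 0 < x -> x < t0 -> F x * k x <= S x.
Proof.
move=> tx x0 xt0; rewrite leNgt; apply/negP => Sx.
have [y [ty by_] xy] := sup_gt (ex_intro _ _ below0 : below_threshold !=set0) xt0.
have := above_up tx ty xy Sx; case: by_ => [y0|[y1]]; last by move=> + /lt_geF => ->.
by move: xy; rewrite y0 ltNge (ltW x0).
Qed.

(* Division by zero makes the level [0] when the threshold is [0]; since
   [kappa >= 0] this is still a lower bound of [kappa]. *)
Definition threshold_level : R := S t0 / F t0.
Local Notation kap := threshold_level.

Lemma threshold_levelE : S t0 = kap * F t0.
Proof.
rewrite /kap; have [F0|F0] := eqVneq (F t0) 0; last by rewrite divfK.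
suff -> : t0 = 0 by rewrite S0 !mul0r.
by apply: (cdf_inj sE types_threshold (@types0 R)); rewrite F0 (cdf0 sE).
Qed.

Let kap_ge0 : 0 <= kap.
Proof. by rewrite divr_ge0//; have /andP[] := cdf_bounds sE types_threshold. Qed.

(** For [z] strictly between the threshold and [x], [S t0 <= S z < F z * k z <= F z * k x]; then [z]
    tends to the threshold. Only [F] passes to the limit, since [kappa] may jump. *)
Lemma threshold_level_le x : types x -> t0 < x -> kap <= k x.
Proof.
move=> tx t0x.
have tt := types_threshold; have /andP[F0 _] := cdf_bounds sE tt.
move: F0; rewrite le_eqVlt => /predU1P[F0|F0].
  by rewrite /kap -F0 invr0 mulr0 kappa_ge0.
have x1 : x <= 1 by have := tx; rewrite typesE => /andP[].
rewrite -(ler_pM2r F0) -threshold_levelE.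
apply/ler_addgt0Pr => e e0.
(* The tolerance on [F] is [e / (k x + 1)]: the divisor is positive even if [k x = 0], and [k x]
   times the tolerance is at most [e]. *)
have kx1 : 0 < k x + 1 by rewrite ltr_wpDl// kappa_ge0.
have [|s [ts s1 tys Fs]] := cdf_close_right sE tt (lt_le_trans t0x x1) (e := e / (k x + 1)).
  exact: divr_gt0.
pose z := Num.min s ((t0 + x) / 2).
have zx : z < x by rewrite /z gt_min; apply/orP; right; lra.
have tz : t0 < z by rewrite /z lt_min ts; lra.
have tyz : types z by exact: (types_itv tt tx (ltW tz) (ltW zx)).
have Fz : F z < F t0 + e / (k x + 1).
  by apply: le_lt_trans Fs; apply: (cdf_le sE); rewrite /z ge_min lexx.
have Sz := gt_threshold tyz tz (lt_le_trans zx x1).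
have kzx := above_lt tyz tx zx Sz.
have F0z : 0 <= F z by have /andP[] := cdf_bounds sE tyz.
have kF : k z * F z <= k x * F z by rewrite ler_wpM2r// ltW.
have kF2 : k x * F z <= k x * (F t0 + e / (k x + 1)).
  by rewrite ler_wpM2l ?kappa_ge0// ltW.
have : k x * (e / (k x + 1)) <= e.
  by rewrite mulrCA mulrA ler_pdivrMr// ler_wpM2l ?(ltW e0)// lerDl.
have := S_le (ltW tz); lra.
Qed.

Lemma kappa_le_threshold x y : types x -> types y -> t0 < x -> x <= y -> k x <= k y.
Proof.
move=> tx ty t0x; rewrite le_eqVlt => /predU1P[->//|xy].
have y1 : y <= 1 by have := ty; rewrite typesE => /andP[].
exact/ltW/(above_lt tx ty xy)/(gt_threshold tx t0x)/(lt_le_trans xy).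
Qed.

(** Just below the threshold [v * F z <= k z * F z <= S z <= S t0], and [F z] tends to [F t0]. A
    negative [v] is harmless because [kap >= 0]. *)
Let le_level v x : types x -> x < t0 ->
  (forall y, types y -> x < y -> y < t0 -> v <= k y) -> v <= kap.
Proof.
move=> tx xt0 H; have [v0|/ltW v0] := leP v 0; first exact: le_trans v0 kap_ge0.
have tt := types_threshold.
have x0 : 0 <= x by have := tx; rewrite typesE => /andP[].
have F0 : 0 < F t0 by rewrite -(cdf0 sE) (cdf_lt sE)//; [exact: types0|exact: le_lt_trans xt0].
rewrite -(ler_pM2r F0); apply/ler_addgt0Pr => e e0.
have v1 : 0 < v + 1 by lra.
have [|s [s0 st tys Fs]] := cdf_close_left sE tt (le_lt_trans x0 xt0) (e := e / (v + 1)).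
  exact: divr_gt0.
pose z := Num.max s ((t0 + x) / 2).
have zt : z < t0 by rewrite /z gt_max st/=; lra.
have xz : x < z by rewrite /z lt_max; apply/orP; right; lra.
have tyz : types z by exact: (types_itv tx tt (ltW xz) (ltW zt)).
have Fz : F t0 - e / (v + 1) < F z.
  by apply: lt_le_trans Fs _; apply: (cdf_le sE); rewrite /z le_max lexx.
have Sz := lt_threshold tyz (le_lt_trans x0 xz) zt.
have F0z : 0 <= F z by have /andP[] := cdf_bounds sE tyz.
have : v * F z <= k z * F z by rewrite ler_wpM2r// H.
have : v * (F t0 - e / (v + 1)) <= v * F z by rewrite ler_wpM2l// ltW.
have : v * (e / (v + 1)) <= e.
  by rewrite mulrCA mulrA ler_pdivrMr// ler_wpM2l ?(ltW e0)// lerDl.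
have := S_le (ltW zt); rewrite threshold_levelE; lra.
Qed.

(** This keeps [dual] nonincreasing across the threshold. For [x < z < t0 <= y] the monotonicity of
    both summands gives [vcost x + p y <= kappa z]. *)
Lemma vcost_le_level x y : types x -> types y -> x < t0 -> t0 <= y ->
  vcost E x + p y <= kap.
Proof.
move=> tx ty xt0 t0y; apply: (le_level tx xt0) => z tz xz zt0.
by rewrite /kappa addrC lerD ?(q_sym_le sE) ?(vcost_le sE) ?ltW// (lt_le_trans zt0).
Qed.

(** The ironing condition. If the mean below [a] were less than [kap], then [k a < kap] as well, and
    [kappa] would have to exceed [kap] at some [b] in [(a, t0)] to restore the mean. By
    quasi-convexity it would stay above [k b] up to the threshold, and [le_level] would give
    [k b <= kap]. *)
Lemma level_le_Skappa a : types a -> a <= t0 -> kap * F a <= S a.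
Proof.
move=> ta; rewrite le_eqVlt => /predU1P[->|at0]; first by rewrite threshold_levelE.
rewrite leNgt; apply/negP => Sa.
have tt := types_threshold.
have a0 : 0 < a.
  have := ta; rewrite typesE => /andP[+ _]; rewrite le_eqVlt => /predU1P[a0|//].
  by move: Sa; rewrite -a0 S0 (cdf0 sE) mulr0 ltxx.
have Fa0 : 0 < F a by rewrite -(cdf0 sE) (cdf_lt sE)//; exact: types0.
have kaa : k a < kap.
  rewrite -(ltr_pM2r Fa0); apply: le_lt_trans Sa; rewrite mulrC.
  exact: lt_threshold.
have [b [tb ab bt0 kb]] : exists b, [/\ types b, a < b, b < t0 & kap < k b].
  apply: contrapT => no.
  have : S t0 <= S a + kap * (F t0 - F a).
    rewrite -!(Ex_lt sE) -ExB// -ExZ; last exact: integB.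
    rewrite -ExD//; last exact/integZ/integB.
    apply: le_Ex => //; first by apply: integD => //; exact/integZ/integB.
    move=> z tz; case: (ltP z a) => za; first by rewrite (lt_trans za at0)/=; lra.
    rewrite mul0r add0r subr0; case: (ltP z t0) => zt; rewrite ?mul0r ?mulr0// mul1r mulr1.
    move: za; rewrite le_eqVlt => /predU1P[<-|az]; first exact: ltW.
    by rewrite leNgt; apply/negP => kz; apply: no; exists z.
  rewrite threshold_levelE; lra.
suff : k b <= kap by rewrite leNgt kb.
apply: (le_level tb bt0) => y ty by_ yt0.
have := kappa_quasi_convex sE sc ta tb ty ab by_.
rewrite lt_max => /orP[ba|/ltW//].
by have := lt_trans kb ba; rewrite ltNge (ltW kaa).
Qed.

End ThresholdExists.

(** * Up-sets of types and changes on null sets *)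

Section NullSets.
Context {R : realType} (E : environment R) (sE : standing_assumptions E).
Implicit Types (f h : R -> R) (g k : R * R -> R) (a x y : R).
Local Notation T := (types : set (measurableTypeR R)).
Local Notation TT := (profiles (R := R)).

(** Membership of the endpoint itself is undetermined, hence [y != a]. Adding [1] to the set keeps
    the infimum a type when [b] holds nowhere. *)
Lemma upset_threshold (b : R -> bool) :
  (forall x y, types x -> types y -> x <= y -> b x -> b y) ->
  exists2 a, types a & forall y, types y -> y != a -> b y = (a <= y).
Proof.
move=> ub; pose U : set R := [set y | types y /\ (b y \/ y = 1)].
have U1 : U 1 by split; [exact: types1|right].
have lb0 : lbound U 0 by move=> x [+ _]; rewrite typesE => /andP[].
have a0 : 0 <= inf U by apply: lb_le_inf => //; exists 1.
have a1 : inf U <= 1 by apply: ge_inf => //; exists 0.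
exists (inf U); first by rewrite typesE a0.
move=> y ty ya; case: (leP (inf U) y) => [|yU]; last first.
  apply/negbTE/negP => by_; move: yU; rewrite ltNge => /negP; apply.
  by apply: ge_inf; [exists 0|split; [|left]].
rewrite le_eqVlt eq_sym (negbTE ya)/= => Uy.
have [z [tz bz] zy] := inf_lt (ex_intro _ _ U1 : U !=set0) Uy.
case: bz => [bz|z1]; first exact: (ub _ _ tz ty (ltW zy)).
by move: zy; rewrite z1 ltNge; have := ty; rewrite typesE => /andP[_ ->].
Qed.

Lemma bmeas_eqr a : bmeas T (fun x : R => (x == a)%R%:R : R).
Proof.
apply: (bmeas_eq (f := fun x => (x <= a)%R%:R - (x < a)%R%:R)).
  by move=> x _; case: (ltgtP x a); rewrite ?subrr ?subr0.
by apply: bmeasB; [exact: bmeas_le|exact: bmeas_ltl].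
Qed.

(** The law has no atoms: on the types the difference is a constant times the indicator of [a]. *)
Lemma eq_Ex_off a f h : bmeas T f -> bmeas T h ->
  (forall y, types y -> y != a -> f y = h y) -> Ex E f = Ex E h.
Proof.
move=> bf bh fh; apply/eqP; rewrite -subr_eq0 -ExB; [|exact: (bmeas_integ sE)..].
rewrite (eq_Ex _ (h := fun y => (f a - h a) * (y == a)%R%:R)); last first.
  move=> y ty; have [->|ya] := eqVneq y a; rewrite ?mulr1// mulr0.
  by rewrite (fh _ ty ya) subrr.
by rewrite ExZ ?(Ex_eq sE) ?mulr0//; exact/(bmeas_integ sE)/bmeas_eqr.
Qed.

Lemma le_Ex_cst f M : bmeas T f -> (forall y, types y -> f y <= M) -> Ex E f <= M.
Proof.
move=> bf fM; rewrite -(Ex_cst sE M); apply: le_Ex => //.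
  exact: (bmeas_integ sE).
exact/(bmeas_integ sE)/bmeas_cst.
Qed.

Lemma normr_Ex_le f M : bmeas T f -> (forall y, types y -> `|f y| <= M) -> `|Ex E f| <= M.
Proof.
move=> bf fM; rewrite ler_norml; apply/andP; split.
  rewrite lerNl -[- _]mulN1r -ExZ; last exact: (bmeas_integ sE).
  apply: le_Ex_cst; first by apply: bmeasM => //; exact: bmeas_cst.
  by move=> y /fM; rewrite mulN1r ler_norml => /andP[+ _]; rewrite lerNl.
by apply: le_Ex_cst => // y /fM; rewrite ler_norml => /andP[].
Qed.

Lemma Exy_Ex1 g : bmeas TT g -> Exy E g = Ex E (fun x => Ex E (fun y => g (x, y))).
Proof.
move=> bg; have [//|_ ->//] := Exy_fubini1 (bmeas_integ2 sE bg).
by move=> x tx; apply: (bmeas_integ sE); exact: bmeas_section1.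
Qed.

Lemma Exy_Ex2 g : bmeas TT g -> Exy E g = Ex E (fun y => Ex E (fun x => g (x, y))).
Proof.
move=> bg; have [//|_ ->//] := Exy_fubini2 (bmeas_integ2 sE bg).
by move=> x tx; apply: (bmeas_integ sE); exact: bmeas_section2.
Qed.

Lemma integ_measurable f : integ E f -> measurable_fun T f.
Proof. by move=> /(measurable_int _)/measurable_EFinP. Qed.

Lemma bmeas_Ex1 g : bmeas TT g -> bmeas T (fun x => Ex E (fun y => g (x, y))).
Proof.
move=> bg; split.
  apply: integ_measurable.
  have [|//] := Exy_fubini1 (bmeas_integ2 sE bg).
  by move=> x tx; apply: (bmeas_integ sE); exact: bmeas_section1.
have [_ [M Mg]] := bg; exists M => x tx.
by apply: normr_Ex_le; [exact: bmeas_section1|move=> y ty; apply: Mg].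
Qed.

Lemma bmeas_Ex2 g : bmeas TT g -> bmeas T (fun y => Ex E (fun x => g (x, y))).
Proof.
move=> bg; split.
  apply: integ_measurable.
  have [|//] := Exy_fubini2 (bmeas_integ2 sE bg).
  by move=> x tx; apply: (bmeas_integ sE); exact: bmeas_section2.
have [_ [M Mg]] := bg; exists M => x tx.
by apply: normr_Ex_le; [exact: bmeas_section2|move=> y ty; apply: Mg].
Qed.

Lemma eq_Exy_off a g k : bmeas TT g -> bmeas TT k ->
  (forall w, TT w -> w.1 != a -> w.2 != a -> g w = k w) -> Exy E g = Exy E k.
Proof.
move=> bg bk gk; rewrite (Exy_Ex1 bg) (Exy_Ex1 bk).
apply: (@eq_Ex_off a); try exact: bmeas_Ex1.
move=> x tx xa; apply: (@eq_Ex_off a); try exact: bmeas_section1.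
by move=> y ty ya; apply: gk.
Qed.

End NullSets.

(** * The multiplier and its feasibility *)

Section Certificate.
Context {R : realType} (E : environment R) (sE : standing_assumptions E).
Hypothesis sc : sufficiently_concave E.
Implicit Types (a b c q x y : R).
Local Notation F := (cdfF E).
Local Notation p := (q_sym E).
Local Notation k := (kappa E).
Local Notation t0 := (threshold E).
Local Notation kap := (threshold_level E).
Local Notation T := (types : set (measurableTypeR R)).

Definition dual x : R := if x < t0 then kap - vcost E x else p x.

Lemma dual_le x y : types x -> types y -> x <= y -> dual y <= dual x.
Proof.
move=> tx ty xy; rewrite /dual; case: (ltP y t0) => yt.
  by rewrite (le_lt_trans xy yt) lerD2l lerN2 (vcost_le sE).
case: (ltP x t0) => xt; last exact: (q_sym_le sE).
by rewrite lerBrDl (vcost_le_level sE sc).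
Qed.

Lemma bmeas_dual : bmeas T dual.
Proof. by apply: bmeas_nincr => x y; exact: dual_le. Qed.

Lemma q_sym_dualE x : p x - dual x = (x < t0)%R%:R * (k x - kap).
Proof. by rewrite /dual /kappa; case: ifP => _; rewrite ?mul1r ?mul0r; ring. Qed.

Let bgap : bmeas T (fun x => (x < t0)%R%:R * (k x - kap)).
Proof.
apply: bmeasM; first exact: bmeas_ltl.
by apply: bmeasB; [exact: bmeas_kappa|exact: bmeas_cst].
Qed.

Let Ex_gap a : types a -> Ex E (fun x => (x < a)%R%:R * (k x - kap)) = Skappa E a - kap * F a.
Proof.
move=> ta; rewrite -(Ex_lt sE) -ExZ; last exact/(bmeas_integ sE)/bmeas_ltl.
rewrite -ExB; first by apply: eq_Ex => x _; ring.
  by apply/(bmeas_integ sE)/bmeasM; [exact: bmeas_ltl|exact: bmeas_kappa].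
exact/(integZ)/(bmeas_integ sE)/bmeas_ltl.
Qed.

(** The two functions differ only below the threshold, by [k - kap], which has mean [0] there. Used
    for the favored types of firm 1, who win against every rival. *)
Lemma Ex_dual : Ex E dual = Ex E p.
Proof.
rewrite -[RHS]subr0 -[X in _ - X](_ : Ex E (fun x => (x < t0)%R%:R * (k x - kap)) = 0); last first.
  by rewrite Ex_gap ?(threshold_levelE sE) ?subrr//; exact: types_threshold.
rewrite -ExB; first by apply: eq_Ex => x _; rewrite -q_sym_dualE; ring.
  exact/(bmeas_integ sE)/bmeas_q_sym.
exact: (bmeas_integ sE).
Qed.

(* Ironing: the virtual value is replaced on [[0, t0)] by its mean, which can
   only lower the weight of an up-set of types. *)
Lemma Ex_upset_gap_le0 (b : R -> bool) :
  (forall x y, types x -> types y -> x <= y -> b x -> b y) ->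
  Ex E (fun x => (b x)%:R * ((x < t0)%R%:R * (k x - kap))) <= 0.
Proof.
move=> ub; have [a ta ba] := upset_threshold ub.
have bb := bmeas_upset ub; have bge := bmeas_ge a.
rewrite (@eq_Ex_off _ _ sE a _ (fun x => (a <= x)%R%:R * ((x < t0)%R%:R * (k x - kap))));
  [|exact: bmeasM..|]; last by move=> y ty ya; rewrite ba.
have tt := types_threshold E.
have [t0a|at0] := leP t0 a.
  rewrite (eq_Ex _ (h := fun=> 0)) ?(Ex_cst sE)// => x _.
  by case: (leP a x) => ax; rewrite ?mul0r// ltNge (le_trans t0a ax) mul0r mulr0.
have -> : Ex E (fun x => (a <= x)%R%:R * ((x < t0)%R%:R * (k x - kap))) =
    Ex E (fun x => (x < t0)%R%:R * (k x - kap)) - Ex E (fun x => (x < a)%R%:R * (k x - kap)).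
  rewrite -ExB; first apply: eq_Ex => x _.
  - case: (leP a x) => ax; first by rewrite mul0r subr0 mul1r.
    by rewrite (lt_trans ax at0) mul0r mul1r subrr.
  - exact: (bmeas_integ sE).
  - apply/(bmeas_integ sE)/bmeasM; first exact: bmeas_ltl.
    by apply: bmeasB; [exact: bmeas_kappa|exact: bmeas_cst].
rewrite !Ex_gap//  (threshold_levelE sE) subrr sub0r oppr_le0 subr_ge0.
exact: (level_le_Skappa sE sc ta (ltW at0)).
Qed.

Lemma bmeas_dual_excess q : bmeas T (fun y => Num.max (q - dual y) 0).
Proof.
by apply: bmeas_max; [apply: bmeasB; [exact: bmeas_cst|exact: bmeas_dual]|exact: bmeas_cst].
Qed.

(** Where [dual y < q], the excess over [dual] is [(q - p y) + (p y - dual y)]. That region is an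
    up-set, over which the second term has nonpositive mean. *)
Lemma dual_excess_le q : 0 <= q ->
  Ex E (fun y => Num.max (q - dual y) 0) <= cost E q.
Proof.
move=> q0; apply: le_trans (excess_le sE q0).
have up x y : types x -> types y -> x <= y -> dual x < q -> dual y < q.
  by move=> tx ty xy; apply: le_lt_trans; exact: dual_le.
have bb := bmeas_upset up.
have := Ex_upset_gap_le0 up.
suff : Ex E (fun y => Num.max (q - dual y) 0) <= Ex E (fun y => Num.max (q - p y) 0 +
    (dual y < q)%R%:R * ((y < t0)%R%:R * (k y - kap))).
  rewrite ExD; first by rewrite -/(excess E q); lra.
    exact/(bmeas_integ sE)/bmeas_excess.
  exact/(bmeas_integ sE)/bmeasM.
apply: le_Ex; first exact/(bmeas_integ sE)/bmeas_dual_excess.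
  by apply/(bmeas_integ sE)/bmeasD; [exact: bmeas_excess|exact: bmeasM].
move=> y ty; rewrite -q_sym_dualE /Num.max.
by case: (ltP (dual y) q) => dq; rewrite ?mul1r ?mul0r; case: ifP; case: ifP; lra.
Qed.

End Certificate.

(** * The relaxed problem *)

Section Relaxed.
Context {R : realType} (E : environment R) (sE : standing_assumptions E).
Hypothesis sc : sufficiently_concave E.
Implicit Types (a b c x y : R) (w : R * R).
Local Notation F := (cdfF E).
Local Notation p := (q_sym E).
Local Notation k := (kappa E).
Local Notation t0 := (threshold E).
Local Notation kap := (threshold_level E).
Local Notation d := (dual E).
Local Notation c := (vcost E).
Local Notation g := (cost E).
Local Notation T := (types : set (measurableTypeR R)).
Local Notation TT := (profiles (R := R)).

Lemma firm_cases (i : 'I_2) : i = firm1 \/ i = firm2.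
Proof. by case: i => [[|[|//]] j]; [left|right]; exact: val_inj. Qed.

Lemma sum_firms (V : nmodType) (f : 'I_2 -> V) : \sum_(i < 2) f i = f firm1 + f firm2.
Proof.
by rewrite big_ord_recl big_ord1; congr (_ + f _); apply: val_inj.
Qed.

Lemma bmeas_fst (f : R -> R) : bmeas T f -> bmeas TT (fun w => f w.1).
Proof. exact: (@bmeas_own _ firm1). Qed.

Lemma bmeas_snd (f : R -> R) : bmeas T f -> bmeas TT (fun w => f w.2).
Proof. exact: (@bmeas_own _ firm2). Qed.

Lemma bmeas_cost (q : R -> R) : (forall x, types x -> 0 <= q x) -> bmeas T q ->
  bmeas T (fun x => g (q x)).
Proof.
move=> q0 [mq [M Mq]]; split.
  by apply: (measurable_cost sE) => //; exact: measurable_types.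
exists (g M) => x tx; rewrite ger0_norm ?(cost_ge0 sE) ?q0//.
by apply: (cost_le sE); rewrite ?q0// (le_trans (ler_norm _))// Mq.
Qed.

Definition surplus (q1 q2 : R -> R) (z1 z2 : R * R -> R) w : R :=
  (q1 w.1 - c w.1) * z1 w - g (q1 w.1) + ((q2 w.2 - c w.2) * z2 w - g (q2 w.2)).

Lemma virtual_surplusE q z w : virtual_surplus E q z w =
  surplus (q firm1) (q firm2) (z firm1) (z firm2) w.
Proof. by rewrite /virtual_surplus sum_firms. Qed.

Definition ironed x : R := d x + c x.

(** Pointwise maximum over the shares of what remains once each quality has been charged the
    multiplier at the rival's type: [d1 + d2] minus the ironed cost of the winner. *)
Definition dual_value : R :=
  Exy E (fun w => d w.1 + d w.2 - Num.min (ironed w.1) (ironed w.2)).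

Lemma bmeas_ironed : bmeas T ironed.
Proof. by apply: bmeasD; [exact: bmeas_dual|exact: bmeas_vcost]. Qed.

Lemma bmeas_dual_value :
  bmeas TT (fun w => d w.1 + d w.2 - Num.min (ironed w.1) (ironed w.2)).
Proof.
have bd := bmeas_dual sE sc; have bi := bmeas_ironed.
apply: bmeasB; last by apply: bmeas_min; [exact: bmeas_fst|exact: bmeas_snd].
by apply: bmeasD; [exact: bmeas_fst|exact: bmeas_snd].
Qed.

Lemma bmeas_surplus q1 q2 z1 z2 :
  bmeas T q1 -> bmeas T q2 -> bmeas TT z1 -> bmeas TT z2 ->
  (forall x, types x -> 0 <= q1 x) -> (forall x, types x -> 0 <= q2 x) ->
  bmeas TT (surplus q1 q2 z1 z2).
Proof.
move=> b1 b2 bz1 bz2 q10 q20; have bc := bmeas_vcost sE.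
have bg1 := bmeas_cost q10 b1; have bg2 := bmeas_cost q20 b2.
apply: bmeasD; apply: bmeasB.
- by apply: bmeasM => //; apply: bmeasB; exact: bmeas_fst.
- exact: (bmeas_fst bg1).
- by apply: bmeasM => //; apply: bmeasB; exact: bmeas_snd.
- exact: (bmeas_snd bg2).
Qed.

Let bexcess1 q : bmeas T q -> bmeas TT (fun w => Num.max (q w.1 - d w.2) 0).
Proof.
have bd := bmeas_dual sE sc => bq.
apply: bmeas_max; last exact: bmeas_cst.
by apply: bmeasB; [exact: bmeas_fst|exact: bmeas_snd].
Qed.

Let bexcess2 q : bmeas T q -> bmeas TT (fun w => Num.max (q w.2 - d w.1) 0).
Proof.
have bd := bmeas_dual sE sc => bq.
apply: bmeas_max; last exact: bmeas_cst.
by apply: bmeasB; [exact: bmeas_snd|exact: bmeas_fst].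
Qed.

Lemma surplus_bound q1 q2 z1 z2 :
  bmeas T q1 -> bmeas T q2 -> bmeas TT z1 -> bmeas TT z2 ->
  (forall x, types x -> 0 <= q1 x) -> (forall x, types x -> 0 <= q2 x) ->
  (forall w, TT w -> [/\ 0 <= z1 w, 0 <= z2 w & z1 w + z2 w = 1]) ->
  Exy E (surplus q1 q2 z1 z2) <= dual_value.
Proof.
move=> b1 b2 bz1 bz2 q10 q20 z12.
have bs := bmeas_surplus b1 b2 bz1 bz2 q10 q20.
have bg1 := bmeas_cost q10 b1; have bg2 := bmeas_cost q20 b2.
(* Since [0 <= z1 <= 1], [(q1 - d2) z1] is at most its positive part without the share; averaged
   over the rival's type, that part is at most the investment cost. *)
pose A1 w := Num.max (q1 w.1 - d w.2) 0 - g (q1 w.1).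
pose A2 w := Num.max (q2 w.2 - d w.1) 0 - g (q2 w.2).
have bA1 : bmeas TT A1 by apply: bmeasB; [exact: bexcess1|exact: (bmeas_fst bg1)].
have bA2 : bmeas TT A2 by apply: bmeasB; [exact: bexcess2|exact: (bmeas_snd bg2)].
have bD := bmeas_dual_value.
have A1_le0 : Exy E A1 <= 0.
  rewrite (Exy_Ex1 sE)//; apply: (le_Ex_cst sE); first exact: (bmeas_Ex1 sE).
  move=> x tx; rewrite /A1/= ExB; first last.
  - exact/(bmeas_integ sE)/bmeas_cst.
  - exact/(bmeas_integ sE)/(bmeas_dual_excess sE sc).
  by rewrite (Ex_cst sE) subr_le0 (dual_excess_le sE sc)// q10.
have A2_le0 : Exy E A2 <= 0.
  rewrite (Exy_Ex2 sE)//; apply: (le_Ex_cst sE); first exact: (bmeas_Ex2 sE).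
  move=> x tx; rewrite /A2/= ExB; first last.
  - exact/(bmeas_integ sE)/bmeas_cst.
  - exact/(bmeas_integ sE)/(bmeas_dual_excess sE sc).
  by rewrite (Ex_cst sE) subr_le0 (dual_excess_le sE sc)// q20.
have iA1 := bmeas_integ2 sE bA1; have iA2 := bmeas_integ2 sE bA2.
have iD := bmeas_integ2 sE bD.
suff : Exy E (surplus q1 q2 z1 z2) <= Exy E (fun w => A1 w + A2 w +
    (d w.1 + d w.2 - Num.min (ironed w.1) (ironed w.2))).
  by rewrite (ExyD (integ2D iA1 iA2) iD) (ExyD iA1 iA2) -/dual_value; lra.
apply: le_Exy; first exact: (bmeas_integ2 sE).
  by apply: integ2D => //; exact: integ2D.
move=> w Tw; have [z10 z20 zs] := z12 _ Tw; rewrite /surplus /A1 /A2.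
have H1 : (q1 w.1 - d w.2) * z1 w <= Num.max (q1 w.1 - d w.2) 0.
  have z11 : z1 w <= 1 by lra.
  rewrite le_max; case: (leP (q1 w.1 - d w.2) 0) => s.
    by apply/orP; right; rewrite mulr_le0_ge0.
  by apply/orP; left; rewrite ler_piMr// ltW.
have H2 : (q2 w.2 - d w.1) * z2 w <= Num.max (q2 w.2 - d w.1) 0.
  have z11 : z2 w <= 1 by lra.
  rewrite le_max; case: (leP (q2 w.2 - d w.1) 0) => s.
    by apply/orP; right; rewrite mulr_le0_ge0.
  by apply/orP; left; rewrite ler_piMr// ltW.
have H3 : Num.min (ironed w.1) (ironed w.2) <= ironed w.1 * z1 w + ironed w.2 * z2 w.
  have z2E : z2 w = 1 - z1 w by lra.
  rewrite z2E; case: (leP (ironed w.1) (ironed w.2)) => s.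
    have : 0 <= (ironed w.2 - ironed w.1) * z2 w by rewrite mulr_ge0// subr_ge0.
    rewrite z2E; lra.
  have : 0 <= (ironed w.1 - ironed w.2) * z1 w by rewrite mulr_ge0// subr_ge0 ltW.
  lra.
move: H1 H2 H3; rewrite /ironed; have -> : z2 w = 1 - z1 w by lra.
move: (Num.max _ _) (Num.max _ _) (Num.min _ _) => m1 m2 m3; lra.
Qed.

End Relaxed.

(** Only the upper function is integrable: in the relaxed problem the expected cost of an admissible
    quality may be infinite, and the objective [-oo]. *)
Lemma le_integral_of_le_integrable d (T : measurableType d) (R : realType)
    (mu : {measure set T -> \bar R}) (D : set T) (f h : T -> R) :
  measurable D -> measurable_fun D f -> mu.-integrable D (EFin \o h) ->
  (forall x, D x -> f x <= h x) ->
  (\int[mu]_(x in D) (f x)%:E <= \int[mu]_(x in D) (h x)%:E)%E.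
Proof.
move=> mD mf ih fh.
have mEf : measurable_fun D (EFin \o f) by exact/measurable_EFinP.
have mEh := measurable_int _ ih.
rewrite [leLHS]integralE [leRHS]integralE; apply: leeB.
  apply: ge0_le_integral => //; try exact: measurable_funepos.
  move=> x Dx; rewrite !funeposE ge_max !le_max lexx orbT andbT lee_fin.
  by rewrite fh.
apply: ge0_le_integral => //; try exact: measurable_funeneg.
move=> x Dx; rewrite !funenegE ge_max !le_max lexx orbT andbT leeN2 lee_fin.
by rewrite fh.
Qed.

(** * The value of the relaxed problem and an allocation attaining it *)

Section RelaxedValue.
Context {R : realType} (E : environment R) (sE : standing_assumptions E).
Hypothesis sc : sufficiently_concave E.
Implicit Types (a b c x y : R) (w : R * R).
Local Notation F := (cdfF E).
Local Notation p := (q_sym E).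
Local Notation k := (kappa E).
Local Notation t0 := (threshold E).
Local Notation kap := (threshold_level E).
Local Notation d := (dual E).
Local Notation c := (vcost E).
Local Notation g := (cost E).
Local Notation T := (types : set (measurableTypeR R)).
Local Notation TT := (profiles (R := R)).

Lemma bmeas_share (z : 'I_2 -> R * R -> R) i :
  measurable_fun TT (z i) ->
  (forall w, TT w -> (forall i, 0 <= z i w) /\ \sum_(i < 2) z i w = 1) ->
  bmeas TT (z i).
Proof.
move=> mz zs; split => //; exists 1 => w /zs[z0]; rewrite sum_firms => s.
have zi1 : z i w <= 1.
  by have := z0 firm1; have := z0 firm2; case: (firm_cases i) => ->; lra.
by rewrite ger0_norm.
Qed.

Lemma objective_le_dual_value q z : feasible_P2 q z ->
  (objective_P2 E q z <= (dual_value E)%:E)%E.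
Proof.
move=> [mq mz q0 zs].
have t00 := @types0 R; have p00 := q_sym_ge0 sE t00.
(* Above [p 0] the marginal cost is at least [1] while the share is at most [1], so truncating there
   only raises the objective and makes it integrable. *)
pose q' i x := Num.min (q i x) (p 0).
have q'0 i x : types x -> 0 <= q' i x by move=> tx; rewrite le_min q0.
have bq' i : bmeas T (q' i).
  split; first by apply: measurable_minr => //; exact: measurable_cst.
  by exists (p 0) => x tx; rewrite ger0_norm ?q'0// ge_min lexx orbT.
have bz i : bmeas TT (z i) by apply: bmeas_share.
have bs := bmeas_surplus sE (bq' firm1) (bq' firm2) (bz firm1) (bz firm2) (q'0 firm1) (q'0 firm2).
have zle i w : TT w -> 0 <= z i w <= 1.
  move=> Tw; have [z0 s] := zs _ Tw; rewrite z0/=; move: s; rewrite sum_firms.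
  by have := z0 firm1; have := z0 firm2; case: (firm_cases i) => ->; lra.
have key i x zz : types x -> 0 <= zz <= 1 ->
    (q i x - c x) * zz - g (q i x) <= (q' i x - c x) * zz - g (q' i x).
  move=> tx /andP[zz0 zz1]; rewrite /q' /Num.min; case: ltP => // pq.
  have := cost_convex sE p00 (q0 i x tx); rewrite (q_symP sE t00).2 (cdf0 sE).
  have : 0 <= (q i x - p 0) * (1 - zz) by rewrite mulr_ge0 ?subr_ge0.
  lra.
apply: (@le_trans _ _ (Exy E (surplus E (q' firm1) (q' firm2) (z firm1) (z firm2)))%:E).
  rewrite -(Exy_EFin (bmeas_integ2 sE bs)) /objective_P2.
  apply: le_integral_of_le_integrable.
  - exact: measurable_profiles.
  - rewrite (_ : virtual_surplus E q z = surplus E (q firm1) (q firm2) (z firm1) (z firm2)); last first.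
      by apply/funext => w; exact: virtual_surplusE.
    have mc := (bmeas_vcost sE).1.
    have mg i : measurable_fun T (fun x => g (q i x)).
      by apply: (measurable_cost sE) => //; [exact: measurable_types|exact: q0].
    apply: measurable_funD; apply: measurable_funB.
    + apply: measurable_funM; last exact: mz.
      apply: measurable_funB; [exact: (@measurable_own _ firm1 _ (mq firm1))|].
      exact: (@measurable_own _ firm1 _ mc).
    + exact: (@measurable_own _ firm1 _ (mg firm1)).
    + apply: measurable_funM; last exact: mz.
      apply: measurable_funB; [exact: (@measurable_own _ firm2 _ (mq firm2))|].
      exact: (@measurable_own _ firm2 _ mc).
    + exact: (@measurable_own _ firm2 _ (mg firm2)).
  - exact: (bmeas_integ2 sE bs).
  - move=> w Tw; rewrite virtual_surplusE /surplus; case: (Tw) => t1 t2.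
    by rewrite lerD// key// zle.
rewrite lee_fin; apply: (surplus_bound sE sc (bq' firm1) (bq' firm2) (bz firm1) (bz firm2) (q'0 firm1) (q'0 firm2)) => w Tw.
by have [z0 s] := zs _ Tw; split; rewrite ?z0 -?s ?sum_firms.
Qed.

(** Each quality is [ginv] of the winning probability under [z_opt]: [1] for firm 1 up to the
    threshold, [1 - F x] for firm 1 beyond it, and [1 - F (Num.max t0 x)] for firm 2. *)
Definition q_opt (i : 'I_2) x : R :=
  if i == firm1 then if x <= t0 then p 0 else p x else p (Num.max t0 x).

Definition z_opt (i : 'I_2) w : R :=
  if i == firm1 then ((w.1 <= t0) || (w.1 <= w.2))%:R
  else (~~ ((w.1 <= t0) || (w.1 <= w.2)))%:R.

Lemma types_max x : types x -> types (Num.max t0 x).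
Proof. by move=> tx; rewrite /Num.max; case: ifP => // _; exact: types_threshold. Qed.

Lemma q_opt_ge0 i x : types x -> 0 <= q_opt i x.
Proof.
move=> tx; rewrite /q_opt; case: ifP => _; last exact/(q_sym_ge0 sE)/types_max.
by case: ifP => _; apply: (q_sym_ge0 sE) => //; exact: types0.
Qed.

Lemma bmeas_q_opt i : bmeas T (q_opt i).
Proof.
apply: bmeas_nincr => x y tx ty xy; rewrite /q_opt; case: ifP => _.
  case: (leP y t0) => yt; first by rewrite (le_trans xy yt).
  case: ifP => _; last exact: (q_sym_le sE).
  by apply: (q_sym_le sE) => //; [exact: types0|have := ty; rewrite typesE => /andP[]].
apply: (q_sym_le sE); [exact: types_max..|].
by rewrite ge_max !le_max lexx xy orbT.
Qed.

Lemma bmeas_z_opt i : bmeas TT (z_opt i).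
Proof.
have m1 : measurable_fun TT (fun w : R * R => w.1).
  by apply: measurable_funTS; exact: measurable_fst.
have m2 : measurable_fun TT (fun w : R * R => w.2).
  by apply: measurable_funTS; exact: measurable_snd.
have b1 : bmeas TT (fun w => ((w.1 <= t0) || (w.1 <= w.2))%:R : R).
  apply: bmeas_bool; apply: measurable_or; apply: measurable_fun_ler => //.
rewrite /z_opt; case: (i == firm1) => //.
apply: (bmeas_eq (f := fun w => 1 - ((w.1 <= t0) || (w.1 <= w.2))%:R)).
  by move=> w _; case: (_ || _); rewrite ?subrr ?subr0.
by apply: bmeasB => //; exact: bmeas_cst.
Qed.

(** Complementary slackness for firm 1. Up to the threshold it always wins, and [Ex_dual] turns the
    mean into [excess (p 0) = g (p 0)]. Beyond, it wins exactly when [x <= y], where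
    [dual y = p y <= p x], so the mean is [excess (p x)]. *)
Lemma slack1 x : types x ->
  Ex E (fun y => (q_opt firm1 x - d y) * z_opt firm1 (x, y) - g (q_opt firm1 x)) = 0.
Proof.
move=> tx; have t00 := @types0 R.
have bz := bmeas_section1 tx (bmeas_z_opt firm1).
have bd := bmeas_dual sE sc.
rewrite ExB; first last.
- exact/(bmeas_integ sE)/bmeas_cst.
- by apply/(bmeas_integ sE)/bmeasM => //; apply: bmeasB => //; exact: bmeas_cst.
rewrite (Ex_cst sE); apply/eqP; rewrite subr_eq0; apply/eqP.
rewrite /q_opt /z_opt/=; case: (leP x t0) => xt /=.
  rewrite (eq_Ex _ (h := fun y => p 0 - d y)); last by move=> y _; rewrite mulr1.
  rewrite ExB; [|exact/(bmeas_integ sE)/bmeas_cst|exact: (bmeas_integ sE)].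
  rewrite (Ex_dual sE) (Ex_cst sE) -(excessE sE) ?(q_sym_ge0 sE)// /excess.
  rewrite -[X in X - _](Ex_cst sE) -ExB; first last.
  - exact/(bmeas_integ sE)/(bmeas_q_sym sE).
  - exact/(bmeas_integ sE)/bmeas_cst.
  apply: eq_Ex => y ty; rewrite max_l// subr_ge0 (q_sym_le sE)//.
  by have := ty; rewrite typesE => /andP[].
rewrite -(excessE sE) ?(q_sym_ge0 sE)//; last first.
  by apply: (q_sym_le sE) => //; have := tx; rewrite typesE => /andP[].
apply: eq_Ex => y ty; case: (leP x y) => xy.
  rewrite mulr1 /dual ltNge (ltW (lt_le_trans xt xy))/= max_l//.
  by rewrite subr_ge0 (q_sym_le sE).
by rewrite mulr0 max_r// subr_le0 ltW// (q_sym_lt sE).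
Qed.

Lemma slack2 y : types y ->
  Ex E (fun x => (q_opt firm2 y - d x) * z_opt firm2 (x, y) - g (q_opt firm2 y)) = 0.
Proof.
move=> ty; have t00 := @types0 R; have tm := types_max ty.
have bz := bmeas_section2 ty (bmeas_z_opt firm2).
have bd := bmeas_dual sE sc.
rewrite ExB; first last.
- exact/(bmeas_integ sE)/bmeas_cst.
- by apply/(bmeas_integ sE)/bmeasM => //; apply: bmeasB => //; exact: bmeas_cst.
rewrite (Ex_cst sE); apply/eqP; rewrite subr_eq0; apply/eqP.
rewrite /q_opt /z_opt/= -(excessE sE) ?(q_sym_ge0 sE)//; last first.
  by apply: (q_sym_le sE) => //; have := tm; rewrite typesE => /andP[].
apply: eq_Ex => x tx; rewrite -le_max; case: (leP x (Num.max t0 y)) => xm /=.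
  by rewrite mulr0 [Num.max (_ - _) _]max_r// subr_le0 (q_sym_le sE).
have := xm; rewrite gt_max => /andP[xt _].
rewrite mulr1 /dual ltNge (ltW xt)/= [Num.max (_ - _) _]max_l//.
by rewrite subr_ge0 (q_sym_le sE)// ltW.
Qed.

Lemma surplus_opt :
  Exy E (surplus E (q_opt firm1) (q_opt firm2) (z_opt firm1) (z_opt firm2)) = dual_value E.
Proof.
have bd := bmeas_dual sE sc; have bc := bmeas_vcost sE.
have bq := bmeas_q_opt; have bz := bmeas_z_opt.
have bs := bmeas_surplus sE (bq firm1) (bq firm2) (bz firm1) (bz firm2)
  (@q_opt_ge0 firm1) (@q_opt_ge0 firm2).
have bg i := bmeas_cost sE (@q_opt_ge0 i) (bq i).
pose A1 w := (q_opt firm1 w.1 - d w.2) * z_opt firm1 w - g (q_opt firm1 w.1).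
pose A2 w := (q_opt firm2 w.2 - d w.1) * z_opt firm2 w - g (q_opt firm2 w.2).
have bA1 : bmeas TT A1.
  apply: bmeasB; last exact: (bmeas_fst (bg firm1)).
  by apply: bmeasM => //; apply: bmeasB; [exact: (bmeas_fst (bq firm1))|exact: bmeas_snd].
have bA2 : bmeas TT A2.
  apply: bmeasB; last exact: (bmeas_snd (bg firm2)).
  by apply: bmeasM => //; apply: bmeasB; [exact: (bmeas_snd (bq firm2))|exact: bmeas_fst].
have bD := bmeas_dual_value sE sc.
have A10 : Exy E A1 = 0.
  rewrite (Exy_Ex1 sE)// -[RHS](Ex_cst sE 0); apply: eq_Ex => x tx.
  by rewrite /A1/= slack1.
have A20 : Exy E A2 = 0.
  rewrite (Exy_Ex2 sE)// -[RHS](Ex_cst sE 0); apply: eq_Ex => x tx.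
  by rewrite /A2/= slack2.
transitivity (Exy E (fun w => A1 w + A2 w +
    (d w.1 + d w.2 - Num.min (ironed E w.1) (ironed E w.2)))); last first.
  have iA1 := bmeas_integ2 sE bA1; have iA2 := bmeas_integ2 sE bA2.
  have iD := bmeas_integ2 sE bD.
  by rewrite (ExyD (integ2D iA1 iA2) iD) (ExyD iA1 iA2) A10 A20 -/(dual_value E); ring.
(* At the threshold itself the ironed cost is [kappa t0], for which no comparison with [kap] is
   available; this null type is discarded. *)
apply: (@eq_Exy_off _ _ sE t0) => //.
  by apply: bmeasD => //; exact: bmeasD.
move=> [x y] [/= tx ty] xt yt.
suff : Num.min (ironed E x) (ironed E y) =
    ironed E x * z_opt firm1 (x, y) + ironed E y * z_opt firm2 (x, y).
  rewrite /surplus /A1 /A2/= => ->; rewrite /ironed /z_opt/=.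
  by case: (_ || _) => /=; ring.
have kapE u : u < t0 -> ironed E u = kap.
  by move=> ut; rewrite /ironed /dual ut subrK.
have kE u : t0 < u -> ironed E u = k u.
  by move=> ut; rewrite /ironed /dual ltNge (ltW ut).
have kap_le u : types u -> u != t0 -> kap <= ironed E u.
  move=> tu; rewrite neq_lt => /orP[ut|ut]; first by rewrite kapE.
  by rewrite kE// (threshold_level_le sE sc).
rewrite /z_opt/=; case: (ltP x t0) (xt) => [xt0 _|].
  by rewrite (ltW xt0)/= mulr1 mulr0 addr0 min_l// kapE// kap_le.
rewrite le_eqVlt eq_sym (negbTE xt)/= => xt0 _.
rewrite leNgt xt0/=; case: (leP x y) => xy /=; rewrite mulr1 mulr0 ?addr0 ?add0r.
  by rewrite min_l// !kE ?(lt_le_trans xt0 xy)// (kappa_le_threshold sE sc).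
rewrite min_r//; move: yt; rewrite neq_lt => /orP[yt|yt]; first by rewrite (kapE y)// kap_le.
by rewrite !kE// (kappa_le_threshold sE sc)// ltW.
Qed.

Lemma objective_opt q z :
  (forall i x, types x -> q i x = q_opt i x) ->
  (forall i w, TT w -> z i w = z_opt i w) ->
  objective_P2 E q z = (dual_value E)%:E.
Proof.
move=> qE zE; rewrite -surplus_opt -Exy_EFin; last first.
  by apply: (bmeas_integ2 sE); apply: (bmeas_surplus sE); do ?[exact: bmeas_q_opt|exact: bmeas_z_opt|exact: q_opt_ge0].
apply: eq_integral => w /[!inE] Tw; have [t1 t2] := Tw.
by rewrite virtual_surplusE /surplus !qE// !zE.
Qed.

End RelaxedValue.

(** * Information rents and the envelope theorem *)

Section Density.
Context {R : realType} (E : environment R) (sE : standing_assumptions E).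
Implicit Types (a b t x y : R) (h Z : R -> R).
Local Notation P := (law E).
Local Notation F := (cdfF E).
Local Notation lam := (@lebesgue_measure R).
Local Notation T := (types : set (measurableTypeR R)).

(** Passes from probabilities of sets to expectations: the density and the Radon-Nikodym derivative
    of the law have equal integrals over all measurable sets of types, so they agree almost
    everywhere. *)
Lemma integral_density h : measurable_fun T h -> (forall x, types x -> 0 <= h x) ->
  (\int[P]_(x in T) (h x)%:E = \int[lam]_(x in T) (h x * density E x)%:E)%E.
Proof.
move=> mh h0; have mT : measurable T by exact: measurable_types.
pose h' x := (Num.max (h x) 0)%:E.
have h'E x : types x -> h' x = (h x)%:E by move=> tx; rewrite /h' max_l// h0.
have h'0 x : (0 <= h' x)%E by rewrite lee_fin le_max lexx orbT.
have mh' : measurable_fun T h'.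
  by apply/measurable_EFinP; apply: measurable_maxr => //; exact: measurable_cst.
have dom : P `<< lam.
  by apply/null_content_dominatesP => A mA; exact: (law_null sE).
pose rn := Radon_Nikodym_SigmaFinite.f P lam.
have cov := Radon_Nikodym_SigmaFinite.change_of_variables dom h'0 mT mh'.
have -> : (\int[P]_(x in T) (h x)%:E = \int[P]_(x in T) h' x)%E.
  by apply: eq_integral => x /[!inE] /h'E.
apply: etrans (esym cov) _.
have rnI : lam.-integrable T rn.
  apply: integrableS (Radon_Nikodym_SigmaFinite.f_integrable dom) => //.
have md : measurable_fun T (EFin \o density E).
  by apply/measurable_EFinP; exact: (density_measurable sE).
have ae : ae_eq lam T rn (EFin \o density E).
  apply: integral_ae_eq => // A AT mA.
  apply: etrans (esym (Radon_Nikodym_SigmaFinite.f_integral dom mA)) _.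
  by apply: etrans (law_density sE mA) _; rewrite (setIidl AT).
apply: ae_eq_integral => //.
- by apply: emeasurable_funM => //; exact: (measurable_int _ rnI).
- apply/measurable_EFinP; apply: measurable_funM => //; exact: (density_measurable sE).
- by apply: filterS ae => x /= H tx; rewrite h'E// EFinM; congr (_ * _)%E; exact: H.
Qed.

Definition Lx h : R := \int[lam]_(x in T) h x.

Lemma lebesgue_types : lam T = 1%E.
Proof. by rewrite /types lebesgue_measure_itv/= lte_fin ltr01 oppr0 adde0. Qed.

Lemma bmeas_Lint h : bmeas T h -> lam.-integrable T (EFin \o h).
Proof.
apply: bmeas_integrable; first exact: measurable_types.
by rewrite [X in (X < _)%E]lebesgue_types ltry.
Qed.

Lemma LxB h k : bmeas T h -> bmeas T k -> Lx (fun x => h x - k x) = Lx h - Lx k.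
Proof. by move=> bh bk; apply: RintegralB; [exact: measurable_types|exact: bmeas_Lint..]. Qed.

Lemma LxZ c h : bmeas T h -> Lx (fun x => c * h x) = c * Lx h.
Proof. by move=> bh; apply: RintegralZl; [exact: measurable_types|exact: bmeas_Lint..]. Qed.

Lemma le_Lx h k : bmeas T h -> bmeas T k -> (forall x, types x -> h x <= k x) ->
  Lx h <= Lx k.
Proof. by move=> bh bk hk; apply: le_Rintegral; [exact: measurable_types|exact: bmeas_Lint|exact: bmeas_Lint|]. Qed.

Lemma eq_Lx h k : (forall x, types x -> h x = k x) -> Lx h = Lx k.
Proof. by move=> fh; apply: eq_Rintegral => x /[!inE] /fh. Qed.

Lemma Lx_itv a b : types a -> types b -> a <= b ->
  Lx (fun x => ((a <= x) && (x < b))%:R) = b - a.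
Proof.
move=> ta tb ab.
have mI : measurable (`[a, b[%classic : set (measurableTypeR R)) by exact: measurable_itv.
have e : (`[a, b[%classic : set (measurableTypeR R)) `&` T = `[a, b[%classic.
  apply: setIidl => x /=; rewrite in_itv/= => /andP[ax xb].
  exact: (types_itv ta tb ax (ltW xb)).
have lI : lam (`[a, b[%classic `&` T) = (b - a)%:E.
  rewrite e lebesgue_measure_itv/= lte_fin; case: ifPn => //; rewrite -leNgt => ba.
  by congr (_%:E); apply/esym/eqP; rewrite subr_eq0 eq_le ba ab.
rewrite -[RHS]/(fine (b - a)%:E) -lI -(integral_indic lam measurable_types mI).
by congr fine; apply: eq_integral => x _; rewrite indicE mem_setE in_itv.
Qed.

(** This is [\int_t^1 Z], with [t] in the integrand and not in the domain, so that dependence on [t]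
    is compared pointwise. With [Z] a winning probability, [alpha] times it is the information
    rent. *)
Definition tail Z t : R := Lx (fun x => (t <= x)%R%:R * Z x).

Lemma bmeas_tail_integrand Z t : bmeas T Z -> bmeas T (fun x => (t <= x)%R%:R * Z x).
Proof. by move=> bZ; apply: bmeasM => //; exact: bmeas_ge. Qed.

Lemma bmeas_itv a b : bmeas T (fun x : R => ((a <= x) && (x < b))%:R : R).
Proof.
apply: (bmeas_eq (f := fun x => (a <= x)%R%:R * (x < b)%R%:R)).
  by move=> x _; case: (leP a x); case: (ltP x b); rewrite /= ?mulr1 ?mulr0.
by apply: bmeasM; [exact: bmeas_ge|exact: bmeas_ltl].
Qed.

Lemma tail_squeezed (lo hi : R) Z : types lo -> types hi -> bmeas T Z ->
  (forall x y, types x -> types y -> x <= y -> Z y <= Z x) ->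
  squeezed_by (fun x => - Z x) lo hi (tail Z).
Proof.
move=> tlo thi bZ Zd a b la ab bh.
have ta : types a by exact: (types_itv tlo thi la (le_trans ab bh)).
have tb : types b by exact: (types_itv tlo thi (le_trans la ab) bh).
have e : tail Z a - tail Z b = Lx (fun x => ((a <= x) && (x < b))%:R * Z x).
  rewrite /tail -LxB; [|exact: bmeas_tail_integrand..].
  apply: eq_Lx => x _; rewrite -mulrBl; congr (_ * _).
  by case: (leP a x) => ax; case: (leP b x) => bx; rewrite /= ?subr0 ?subrr//;
    move: (le_lt_trans (le_trans ab bx) ax); rewrite ltxx.
have bI := bmeas_itv a b.
have l1 : Z b * (b - a) <= tail Z a - tail Z b.
  rewrite e -(Lx_itv ta tb ab) -LxZ//; apply: le_Lx.
  - by apply: bmeasM => //; exact: bmeas_cst.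
  - exact: bmeasM.
  - move=> x tx; case: (leP a x) => ax; case: (ltP x b) => xb; rewrite /= ?mulr0 ?mul0r// mulr1 mul1r.
    exact: (Zd _ _ tx tb (ltW xb)).
have l2 : tail Z a - tail Z b <= Z a * (b - a).
  rewrite e -(Lx_itv ta tb ab) -LxZ//; apply: le_Lx.
  - exact: bmeasM.
  - by apply: bmeasM => //; exact: bmeas_cst.
  - move=> x tx; case: (leP a x) => ax; case: (ltP x b) => xb; rewrite /= ?mulr0 ?mul0r// mulr1 mul1r.
    exact: (Zd _ _ ta tx ax).
by rewrite !mulNr; apply/andP; split; lra.
Qed.

Lemma tail1 Z : bmeas T Z -> tail Z 1 = 0.
Proof.
move=> bZ; rewrite /tail /Lx.
transitivity (\int[lam]_(x in T) (Z \_ [set (1 : R)]) x).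
  apply: eq_Rintegral => x; rewrite inE typesE patchE => /andP[_ x1].
  have [->|xn1] := eqVneq x 1; first by rewrite lexx mul1r mem_set.
  by rewrite leNgt lt_neqAle xn1 x1 mul0r memNset//; exact/eqP.
rewrite -(Rintegral_mkcondr lam T [set (1 : R)] Z).
rewrite (_ : _ `&` _ = [set (1 : R)]) ?Rintegral_set1//.
by apply: setIidr => x ->; exact: types1.
Qed.

Lemma tail_le Z x y : bmeas T Z -> (forall z, types z -> 0 <= Z z) -> x <= y ->
  tail Z y <= tail Z x.
Proof.
move=> bZ Z0 xy; apply: le_Lx; [exact: bmeas_tail_integrand..|].
move=> z tz; apply: ler_wpM2r; first exact: Z0.
by rewrite ler_nat; case: (leP y z) => // yz; rewrite (le_trans xy yz).
Qed.

Lemma bmeas_tail Z : bmeas T Z -> (forall z, types z -> 0 <= Z z) -> bmeas T (tail Z).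
Proof. by move=> bZ Z0; apply: bmeas_nincr => x y _ _; exact: tail_le. Qed.

Lemma bmeas_rent Z : bmeas T Z -> bmeas T (fun x => Z x * (virtual_type E x - x)).
Proof.
move=> bZ; apply: bmeasM => //; apply: bmeasB.
  apply: bmeas_ndecr => x y tx ty; rewrite le_eqVlt => /predU1P[->//|xy].
  exact/ltW/(virtual_type_increasing sE).
by apply: bmeas_ndecr => x y.
Qed.

(* Integration by parts: both sides equal [\int_0^1 Z F]. *)
Lemma Ex_tail Z : bmeas T Z -> (forall x, types x -> 0 <= Z x) ->
  Ex E (tail Z) = Ex E (fun x => Z x * (virtual_type E x - x)).
Proof.
move=> bZ Z0; have mT : measurable T by exact: measurable_types.
(* Tonelli for the law times Lebesgue measure: integrating [h] over the second variable first gives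
   the tail, over the first variable first gives [Z F]. *)
pose h w : R := (w.1 <= w.2)%R%:R * Z w.2.
have bh : bmeas (profiles (R := R)) h.
  apply: bmeasM; last exact: bmeas_snd.
  apply: bmeas_bool; apply: measurable_fun_ler; apply: measurable_funTS.
    exact: measurable_fst.
  exact: measurable_snd.
have tonelli := @fubini_tonelli _ _ (measurableTypeR R) (measurableTypeR R) R P lam
  ((EFin \o h) \_ (profiles (R := R))).
have Fubini : (\int[P]_x \int[lam]_y ((EFin \o h) \_ (profiles (R := R))) (x, y) =
    \int[lam]_y \int[P]_x ((EFin \o h) \_ (profiles (R := R))) (x, y))%E.
  apply: tonelli.
  - apply/(measurable_restrictT _ measurable_profiles).
    by apply/measurable_EFinP; exact: bh.1.
  - move=> w; rewrite patchE; case: ifPn => // /[!inE] -[_ t2].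
    by rewrite /= lee_fin mulr_ge0// Z0.
have L : (\int[P]_x \int[lam]_y ((EFin \o h) \_ (profiles (R := R))) (x, y) =
    (Ex E (tail Z))%:E)%E.
  rewrite -(Ex_EFin (bmeas_integ sE (bmeas_tail bZ Z0))) [RHS]integral_mkcond.
  apply: eq_integral => x _; under eq_integral do rewrite patch_profiles.
  rewrite patchE; case: ifPn => xT; last by rewrite integral0.
  rewrite -integral_mkcond /tail /Lx /h/= fineK//.
  exact: (integrable_fin_num mT (bmeas_Lint (bmeas_tail_integrand x bZ))).
have Rr : (\int[lam]_y \int[P]_x ((EFin \o h) \_ (profiles (R := R))) (x, y) =
    (Ex E (fun x => Z x * (virtual_type E x - x)))%:E)%E.
  rewrite -(Ex_EFin (bmeas_integ sE (bmeas_rent bZ))) integral_density; first last.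
  - move=> x tx; rewrite mulr_ge0 ?Z0// /virtual_type addrC addKr.
    have /andP[F0 _] := cdf_bounds sE tx.
    by rewrite divr_ge0// ltW// (density_pos sE).
  - exact: (bmeas_rent bZ).1.
  rewrite [RHS]integral_mkcond.
  apply: eq_integral => y _; under eq_integral do rewrite patch_profiles_swap.
  rewrite patchE; case: ifPn => yT; last by rewrite integral0.
  rewrite -integral_mkcond /h/=.
  have ty : types y by rewrite inE in yT.
  rewrite (Ex_EFin (f := fun x => (x <= y)%R%:R * Z y)); last first.
    by apply: (bmeas_integ sE); apply: bmeasM; [exact: bmeas_le|exact: bmeas_cst].
  congr (_%:E); rewrite (eq_Ex _ (h := fun x => Z y * (x <= y)%R%:R)); last first.
    by move=> x _; rewrite mulrC.
  rewrite ExZ ?(Ex_le sE); last exact/(bmeas_integ sE)/bmeas_le.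
  by rewrite /virtual_type addrC addKr -mulrA divfK// gt_eqF// (density_pos sE).
by apply: EFin_inj; rewrite -L -Rr.
Qed.

End Density.

(** * Functions of one firm's type on the space of profiles *)

Section OwnIntegrable.
Context {R : realType} (E : environment R) (sE : standing_assumptions E).
Implicit Types (f h : R -> R) (x y : R).
Local Notation P := (law E).
Local Notation T := (types : set (measurableTypeR R)).
Local Notation TT := (profiles (R := R)).

Lemma integ_abs_lt f : integ E f -> (\int[P]_x `|((EFin \o f) \_ T) x| < +oo)%E.
Proof.
move=> If; have /integrableP[_] : P.-integrable setT ((EFin \o f) \_ T) by
  apply/(integrable_mkcond _ measurable_types).
by [].
Qed.

Lemma integ2_own i f : integ E f -> integ2 E (fun w => f (type_of w i)).
Proof.
move=> If; have mf := integ_measurable If.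
have mg := measurable_own i mf.
have mTT := @measurable_profiles R.
pose h := (EFin \o (fun w => f (type_of w i))) \_ TT.
have mh : measurable_fun setT h.
  by apply/(measurable_restrictT _ mTT); exact/measurable_EFinP.
apply/(integrable_mkcond _ mTT).
have PT : (\int[P]_x (\1_T x)%:E)%E = 1%E.
  by rewrite integral_indic ?setIT//; [exact: (law_types sE)|exact: measurable_types].
have key a : (\int[P]_y (`|((EFin \o f) \_ T) a| * (\1_T y)%:E) = `|((EFin \o f) \_ T) a|)%E.
  rewrite ge0_integralZl//; first by rewrite PT mule1.
  apply/measurable_EFinP; apply: measurable_indic; exact: measurable_types.
have hE (x y : R) : (`|h (x, y)| =
    (if i == firm1 then `|((EFin \o f) \_ T) x| * (\1_T y)%:E
     else `|((EFin \o f) \_ T) y| * (\1_T x)%:E))%E.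
  rewrite /h /type_of; case: (i == firm1);
    rewrite patch_profiles !patchE !indicE /=;
    by case: (x \in T); case: (y \in T); rewrite ?mule1 ?mule0 ?abse0 ?mul0e.
have := integ_abs_lt If; have [i1|i2] := boolP (i == firm1).
  move=> lt; apply/(integrable12ltyP _ _ mh); apply: le_lt_trans lt.
  rewrite le_eqVlt; apply/orP; left; apply/eqP; apply: eq_integral => x _.
  by rewrite -[RHS]key; apply: eq_integral => y _; rewrite hE i1.
move=> lt; apply/(integrable21ltyP _ _ mh); apply: le_lt_trans lt.
rewrite le_eqVlt; apply/orP; left; apply/eqP; apply: eq_integral => y _.
by rewrite -[RHS]key; apply: eq_integral => x _; rewrite hE (negbTE i2).
Qed.

Definition pair_of (i : 'I_2) x y : R * R := if i == firm1 then (x, y) else (y, x).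

Lemma pair_of_profiles i x y : types x -> types y -> TT (pair_of i x y).
Proof. by move=> tx ty; rewrite /pair_of; case: (i == firm1); split. Qed.

Lemma type_of_pair i x y : type_of (pair_of i x y) i = x.
Proof. by rewrite /pair_of /type_of; case: (i == firm1). Qed.

Lemma Exy_own i (g : R * R -> R) : integ2 E g ->
  (forall x, types x -> integ E (fun y => g (pair_of i x y))) ->
  integ E (fun x => Ex E (fun y => g (pair_of i x y))) /\
  Exy E g = Ex E (fun x => Ex E (fun y => g (pair_of i x y))).
Proof.
by rewrite /pair_of; case: (i == firm1) => *; [exact: Exy_fubini1|exact: Exy_fubini2].
Qed.

Lemma Exy_own_cst i f : integ E f -> Exy E (fun w => f (type_of w i)) = Ex E f.
Proof.
move=> If; have [|_ ->] := Exy_own (i := i) (integ2_own i If).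
  move=> x tx; apply: (bmeas_integ sE); apply: (bmeas_eq (f := fun=> f x)) (bmeas_cst _ _).
  by move=> y _; rewrite type_of_pair.
apply: eq_Ex => x _; rewrite -[RHS](Ex_cst sE); apply: eq_Ex => y _.
by rewrite type_of_pair.
Qed.

Lemma integ2M g z : integ2 E g -> bmeas TT z -> integ2 E (fun w => g w * z w).
Proof.
move=> Ig [mz [B Bz]]; have mTT := @measurable_profiles R.
have mg : measurable_fun TT g by have /measurable_EFinP := measurable_int _ Ig.
have IB := integrableZl mTT B Ig.
apply: le_integrable IB => //.
  by apply/measurable_EFinP; exact: measurable_funM.
move=> w Tw; rewrite /= normrM mulrC normrM lee_fin ler_wpM2r//.
by rewrite (le_trans (Bz _ Tw))// ler_norm.
Qed.

End OwnIntegrable.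

(** * Incentives, payoffs and expected transfers in a feasible mechanism *)

Section Accounting.
Context {R : realType} (E : environment R) (sE : standing_assumptions E).
Variables (M : mechanism R) (sigma : strategy M).
Implicit Types (t x y : R) (w : R * R).
Local Notation P := (law E).
Local Notation g := (cost E).
Local Notation T := (types : set (measurableTypeR R)).
Local Notation TT := (profiles (R := R)).

(** Following a strategy is itself one of the deviations, which ties the interim integrals of
    [well_defined] to sections of the equilibrium outcome. *)
Lemma dev_messageE i x y :
  dev_message sigma (sigma i x).1 y = eq_message sigma (pair_of i x y).
Proof.
apply: functional_extensionality_dep => j; rewrite /dev_message /eq_message.
have [<-|ji] := eqVneq i j; first by rewrite dfwithin type_of_pair.
rewrite dfwithout// (_ : type_of _ j = y)//.
rewrite /pair_of /type_of; move: ji.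
case: i => [[|[|//]] i2]; case: j => [[|[|//]] j2] //= _; case: ifP => //.
Qed.

Lemma dev_qualityE i x y :
  dev_quality sigma i (sigma i x).2 y = eq_quality sigma (pair_of i x y).
Proof.
apply/funext => j; rewrite /dev_quality /eq_quality.
have [<-|ji] := eqVneq i j; first by rewrite dfwithin type_of_pair.
rewrite dfwithout// (_ : type_of _ j = y)//.
rewrite /pair_of /type_of; move: ji.
case: i => [[|[|//]] i2]; case: j => [[|[|//]] j2] //= _; case: ifP => //.
Qed.

Definition zeq i w : R := share (eq_message sigma w) (eq_quality sigma w) i.
Definition teq i w : R := transfer (eq_message sigma w) (eq_quality sigma w) i.
Definition qeq i x : R := (sigma i x).2.
Definition Zint i x : R := Ex E (fun y => zeq i (pair_of i x y)).
Definition Tint i x : R := Ex E (fun y => teq i (pair_of i x y)).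
Definition payoff i x : R := Tint i x - alpha E * x * Zint i x - g (qeq i x).

Lemma interim_payoffE i x (m : message M i) q :
  well_defined E sigma -> 0 <= q ->
  interim_payoff E sigma x m q =
  (Ex E (dev_transfer sigma m q) - alpha E * x * Ex E (dev_share sigma m q) - g q)%:E.
Proof.
move=> wd q0.
have It := dev_transfer_integrable wd m q0.
have Is := dev_share_integrable wd m q0.
have Ic : integ E (fun=> g q) by exact/(bmeas_integ sE)/bmeas_cst.
have IZ := integZ (alpha E * x) Is.
rewrite /interim_payoff (Ex_EFin (integB (integB It IZ) Ic)) (ExB (integB It IZ) Ic).
by rewrite (ExB It IZ) (ExZ _ Is) (Ex_cst sE).
Qed.

Hypothesis fs : feasible E sigma.
Let wd : well_defined E sigma. Proof. by case: fs. Qed.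

Lemma qeq_ge0 i x : types x -> 0 <= qeq i x.
Proof. by move=> tx; case: fs => _ /(_ i x tx)[]. Qed.

Lemma dev_shareE i x y :
  dev_share sigma (sigma i x).1 (sigma i x).2 y = zeq i (pair_of i x y).
Proof. by rewrite /dev_share dev_messageE dev_qualityE. Qed.

Lemma dev_transferE i x y :
  dev_transfer sigma (sigma i x).1 (sigma i x).2 y = teq i (pair_of i x y).
Proof. by rewrite /dev_transfer dev_messageE dev_qualityE. Qed.

Lemma interim_payoff_eq i x t : types x -> interim_payoff E sigma t (sigma i x).1 (sigma i x).2 =
  (Tint i x - alpha E * t * Zint i x - g (qeq i x))%:E.
Proof.
move=> tx; rewrite (interim_payoffE _ _ wd (qeq_ge0 i tx)).
congr (_ - _ * _ - _)%:E; first by apply: eq_Ex => y _; rewrite dev_transferE.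
by apply: eq_Ex => y _; rewrite dev_shareE.
Qed.

(** Type [x] copies both the message and the quality of type [t]; only the production cost of the
    share differs. *)
Lemma incentive i x t : types x -> types t ->
  payoff i t + alpha E * (t - x) * Zint i t <= payoff i x.
Proof.
move=> tx tt; case: fs => _ /(_ i x tx)[_ bn] _ _.
have := bn (sigma i t).1 _ (qeq_ge0 i tt).
rewrite !interim_payoff_eq// lee_fin /payoff; lra.
Qed.

Lemma payoff_ge0 i x : types x -> 0 <= payoff i x.
Proof.
by move=> tx; case: fs => _ _ /(_ i x tx) + _; rewrite interim_payoff_eq.
Qed.

Lemma bmeas_zeq i : bmeas TT (zeq i).
Proof.
apply: (bmeas_share (z := zeq)); first exact: (eq_share_measurable wd).
by case: fs => _ _ _ al w Tw; exact: al.
Qed.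

Lemma zeq_ge0 i w : TT w -> 0 <= zeq i w.
Proof. by move=> Tw; case: fs => _ _ _ /(_ w Tw)[+ _]; exact. Qed.

Lemma integ_teq i x : types x -> integ E (fun y => teq i (pair_of i x y)).
Proof.
move=> tx; apply: integ_eq (dev_transfer_integrable wd (sigma i x).1 (qeq_ge0 i tx)).
by move=> y _; rewrite dev_transferE.
Qed.

Lemma integ_zeq i x : types x -> integ E (fun y => zeq i (pair_of i x y)).
Proof.
move=> tx; apply: integ_eq (dev_share_integrable wd (sigma i x).1 (qeq_ge0 i tx)).
by move=> y _; rewrite dev_shareE.
Qed.

Lemma Zint_ge0 i x : types x -> 0 <= Zint i x.
Proof. by move=> tx; apply: Ex_ge0 => y ty; apply: zeq_ge0; exact: pair_of_profiles. Qed.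

Lemma Zint_le i x y : types x -> types y -> x <= y -> Zint i y <= Zint i x.
Proof.
move=> tx ty; rewrite le_eqVlt => /predU1P[->//|xy].
have a0 := alpha_pos sE.
have := incentive i tx ty; have := incentive i ty tx => h1 h2.
have : 0 <= (alpha E * (y - x)) * (Zint i x - Zint i y) by lra.
by rewrite pmulr_rge0 ?subr_ge0// mulr_gt0// subr_gt0.
Qed.

Lemma bmeas_Zint i : bmeas T (Zint i).
Proof. by apply: bmeas_nincr => x y; exact: Zint_le. Qed.

(** The incentive constraints in both directions squeeze the increments of the payoff by
    [- alpha Z], exactly as monotonicity of [Z] does for [alpha * tail Z]. *)
Lemma payoff_envelope i x : types x -> payoff i x = payoff i 1 + alpha E * tail (Zint i) x.
Proof.
move=> tx; have x1 : x <= 1 by have := tx; rewrite typesE => /andP[].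
have t1 := @types1 R; have bZ := bmeas_Zint i; have a0 := alpha_pos sE.
have sA : squeezed_by (fun y => - (alpha E * Zint i y)) x 1 (payoff i).
  move=> a b xa ab b1.
  have ta := types_itv tx t1 xa (le_trans ab b1).
  have tb := types_itv tx t1 (le_trans xa ab) b1.
  have := incentive i ta tb; have := incentive i tb ta => h1 h2.
  by apply/andP; split; lra.
have sB : squeezed_by (fun y => - (alpha E * Zint i y)) x 1 (fun y => alpha E * tail (Zint i) y).
  move=> a b xa ab b1.
  have /andP[l u] := tail_squeezed tx t1 bZ (@Zint_le i) xa ab b1.
  have l' := ler_wpM2l (ltW a0) l; have u' := ler_wpM2l (ltW a0) u.
  by apply/andP; split; lra.
have := squeezed_increments x1 sA sB; rewrite (tail1 bZ) mulr0; lra.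
Qed.

Lemma bmeas_payoff i : bmeas T (payoff i).
Proof.
apply: (bmeas_eq (f := fun x => payoff i 1 + alpha E * tail (Zint i) x)).
  by move=> x /[!inE] tx; rewrite [RHS]payoff_envelope.
apply: bmeasD; first exact: bmeas_cst.
apply: bmeasM; first exact: bmeas_cst.
by apply: bmeas_tail; [exact: bmeas_Zint|move=> z; exact: Zint_ge0].
Qed.

Lemma teq_fubini i : integ E (Tint i) /\ Exy E (teq i) = Ex E (Tint i).
Proof.
apply: Exy_own; first exact: (eq_transfer_integrable wd).
by move=> x tx; exact: integ_teq.
Qed.

Let ival i : bmeas T (fun x => alpha E * x * Zint i x).
Proof.
apply: bmeasM; last exact: bmeas_Zint.
by apply: bmeasM; [exact: bmeas_cst|apply: bmeas_ndecr => x y].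
Qed.

(** Admissibility does not mention investment costs; they are the integrable interim transfer minus
    a bounded production cost and the payoff, bounded by the envelope formula. *)
Lemma integ_cost i : integ E (fun x => g (qeq i x)).
Proof.
have iv := bmeas_integ sE (ival i); have ip := bmeas_integ sE (bmeas_payoff i).
apply: (integ_eq _ (integB (integB (teq_fubini i).1 iv) ip)).
by move=> x tx; rewrite /payoff; ring.
Qed.

(** The expected rent is the mean of [alpha * Z * F / f], which added to the production cost
    [alpha * x * Z] gives the virtual cost. *)
Lemma Ex_Tint i : Ex E (Tint i) = payoff i 1 +
  Ex E (fun x => vcost E x * Zint i x) + Ex E (fun x => g (qeq i x)).
Proof.
have iv := bmeas_integ sE (ival i); have ip := bmeas_integ sE (bmeas_payoff i).
have ic := integ_cost i.
have bt : bmeas T (tail (Zint i)).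
  by apply: bmeas_tail; [exact: bmeas_Zint|move=> z; exact: Zint_ge0].
have br := bmeas_rent sE (bmeas_Zint i).
have -> : Ex E (Tint i) = Ex E (payoff i) + Ex E (fun x => alpha E * x * Zint i x) +
    Ex E (fun x => g (qeq i x)).
  rewrite -ExD// -ExD//; last exact: integD.
  by apply: eq_Ex => x _; rewrite /payoff; ring.
rewrite (eq_Ex _ (@payoff_envelope i)) ExD; first last.
- exact/(integZ)/(bmeas_integ sE).
- exact/(bmeas_integ sE)/bmeas_cst.
rewrite (Ex_cst sE) ExZ; last exact: (bmeas_integ sE).
rewrite (Ex_tail sE (bmeas_Zint i)); last by move=> z; exact: Zint_ge0.
rewrite -ExZ; last exact: (bmeas_integ sE).
have ir := integZ (alpha E) (bmeas_integ sE br).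
have -> : Ex E (fun x => vcost E x * Zint i x) =
    Ex E (fun x => alpha E * (Zint i x * (virtual_type E x - x))) +
    Ex E (fun x => alpha E * x * Zint i x).
  by rewrite -ExD//; apply: eq_Ex => x _; rewrite /vcost; ring.
by rewrite !addrA.
Qed.

(** Convexity at [p 0], where [g' = 1], yields [q <= g q + p 0]. *)
Lemma integ_qeq i : integ E (qeq i).
Proof.
have t00 := @types0 R; have p0 := q_sym_ge0 sE t00.
have Ib : integ E (fun x => g (qeq i x) + q_sym E 0).
  by apply: integD; [exact: integ_cost|exact/(bmeas_integ sE)/bmeas_cst].
apply: le_integrable Ib; first exact: measurable_types.
  by apply/measurable_EFinP; exact: (eq_quality_measurable wd).
move=> x tx /=; have q0 := qeq_ge0 i tx; rewrite lee_fin ger0_norm//.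
apply: le_trans (ler_norm _).
have := cost_convex sE p0 q0; rewrite (q_symP sE t00).2 (cdf0 sE).
have := cost_ge0 sE p0; lra.
Qed.

Lemma Exy_vcost i : Exy E (fun w => vcost E (type_of w i) * zeq i w) =
  Ex E (fun x => vcost E x * Zint i x).
Proof.
have b : bmeas TT (fun w => vcost E (type_of w i) * zeq i w).
  by apply: bmeasM; [exact/bmeas_own/bmeas_vcost|exact: bmeas_zeq].
have [|_ ->] := Exy_own (i := i) (bmeas_integ2 sE b).
  move=> x tx; apply: integ_eq (integZ (vcost E x) (integ_zeq i tx)).
  by move=> y _; rewrite type_of_pair.
apply: eq_Ex => x tx; rewrite -ExZ; last exact: integ_zeq.
by apply: eq_Ex => y _; rewrite type_of_pair.
Qed.

Lemma feasible_P2_eq : feasible_P2 qeq zeq.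
Proof.
split.
- exact: (eq_quality_measurable wd).
- exact: (eq_share_measurable wd).
- by move=> i x tx; exact: qeq_ge0.
- by case: fs.
Qed.

Lemma buyer_utilityE :
  (buyer_utility E sigma + (payoff firm1 1 + payoff firm2 1)%:E =
   objective_P2 E qeq zeq)%E.
Proof.
pose X i w := qeq i (type_of w i) * zeq i w.
pose V i w := vcost E (type_of w i) * zeq i w.
pose C i w := g (qeq i (type_of w i)).
have iX i : integ2 E (X i) by apply: integ2M; [exact/integ2_own/integ_qeq|exact: bmeas_zeq].
have iV i : integ2 E (V i).
  by apply: (bmeas_integ2 sE); apply: bmeasM; [exact/bmeas_own/bmeas_vcost|exact: bmeas_zeq].
have iC i : integ2 E (C i) by apply: (integ2_own sE i (integ_cost i)).
have it i : integ2 E (teq i) by exact: (eq_transfer_integrable wd).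
have iXt i : integ2 E (fun w => X i w - teq i w) by exact: integ2B.
have iXV i : integ2 E (fun w => X i w - V i w) by exact: integ2B.
have iXVC i : integ2 E (fun w => X i w - V i w - C i w) by exact: integ2B.
have -> : buyer_utility E sigma = (Exy E (fun w => (X firm1 w - teq firm1 w) + (X firm2 w - teq firm2 w)))%:E.
  rewrite -Exy_EFin; last exact: integ2D.
  by apply: eq_integral => w _; rewrite /buyer_payoff sum_firms.
have -> : objective_P2 E qeq zeq = (Exy E (fun w => (X firm1 w - V firm1 w - C firm1 w) + (X firm2 w - V firm2 w - C firm2 w)))%:E.
  rewrite -Exy_EFin; last exact: integ2D.
  apply: eq_integral => w _; rewrite virtual_surplusE /surplus; congr (_%:E).
  by rewrite /X /V /C /=; ring.
rewrite (ExyD (iXt firm1) (iXt firm2)) (ExyD (iXVC firm1) (iXVC firm2)).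
rewrite (ExyB (iX firm1) (it firm1)) (ExyB (iX firm2) (it firm2)).
rewrite (ExyB (iXV firm1) (iC firm1)) (ExyB (iXV firm2) (iC firm2)).
rewrite (ExyB (iX firm1) (iV firm1)) (ExyB (iX firm2) (iV firm2)) -EFinD; congr (_%:E).
rewrite !Exy_vcost !(teq_fubini _).2 !Ex_Tint.
rewrite (Exy_own_cst sE firm1 (integ_cost _)) (Exy_own_cst sE firm2 (integ_cost _)).
move: (Exy E _) (Exy E _) (Ex E _) (Ex E _) (Ex E _) (Ex E _) => a1 a2 a3 a4 a5 a6.
by move: (payoff _ _) (payoff _ _) => b1 b2; ring.
Qed.

End Accounting.

(** * Optimality of sole sourcing *)

Section Optimality.
Context {R : realType} (E : environment R) (sE : standing_assumptions E).
Hypothesis sc : sufficiently_concave E.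
Local Notation p := (q_sym E).
Local Notation g := (cost E).
Local Notation t0 := (threshold E).
Local Notation T := (types : set (measurableTypeR R)).
Local Notation TT := (profiles (R := R)).

(** The buyer's utility falls short of the relaxed objective by the payoffs of the types [1].
    Participation makes this gap nonnegative in every feasible mechanism; the last condition closes
    it here. *)
Lemma optimal_of (M : mechanism R) (sigma : strategy M) :
  feasible E sigma ->
  (forall i x, types x -> (sigma i x).2 = q_opt E i x) ->
  (forall i w, TT w -> zeq sigma i w = z_opt E i w) ->
  (forall i, interim_payoff E sigma 1 (sigma i 1).1 (sigma i 1).2 = 0%E) ->
  buyer_utility E sigma = U_asy E /\ solves_P E sigma.
Proof.
move=> fs qE zE u1; have t1 := @types1 R.
have p1 i : payoff E sigma i 1 = 0.
  by apply: EFin_inj; rewrite -[RHS](u1 i) interim_payoff_eq.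
have objE : objective_P2 E (qeq sigma) (zeq sigma) = (dual_value E)%:E.
  exact: (objective_opt sE sc).
have BU : buyer_utility E sigma = (dual_value E)%:E.
  by have := buyer_utilityE sE fs; rewrite !p1 addr0 adde0 objE.
have UE : U_asy E = (dual_value E)%:E.
  apply/eqP; rewrite eq_le; apply/andP; split.
    by apply: ge_ereal_sup => u [q [z [qz ->]]]; exact: (objective_le_dual_value sE sc).
  rewrite -objE; apply: ereal_sup_ubound.
  by exists (qeq sigma), (zeq sigma); split => //; exact: feasible_P2_eq fs.
rewrite BU UE; split => //; split => // M' sigma' fs'.
have := objective_le_dual_value sE sc (feasible_P2_eq fs').
rewrite -(buyer_utilityE sE fs') BU; apply: le_trans.
by rewrite leeDl// lee_fin addr_ge0// (payoff_ge0 sE fs').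
Qed.

Section Sole.
Hypothesis t01 : t0 = 1.

(* Firm 1 is paid the quality it delivers plus a constant, so that it internalizes
   the buyer's value; the constant leaves type [1] with zero. *)
Definition sole_mechanism : mechanism R := @Mechanism R (fun=> unit)
  (fun _ _ i => (i == firm1)%:R)
  (fun _ q i => if i == firm1 then q firm1 - p 0 + g (p 0) + alpha E else 0).

Definition sole_strategy : strategy sole_mechanism := fun i x => (tt, q_opt E i x).

Lemma sole_well_defined : well_defined E sole_strategy.
Proof.
split.
- by move=> i m q q0; exact/(bmeas_integ sE)/bmeas_cst.
- move=> i m q q0; apply: (bmeas_integ sE).
  rewrite /dev_transfer/=; case: (i == firm1); last exact: bmeas_cst.
  have [i1|i1] := eqVneq i firm1.
    by apply: (bmeas_eq (f := fun=> q - p 0 + g (p 0) + alpha E)) (bmeas_cst _ _) => s _; rewrite i1 in m *; rewrite /dev_quality dfwithin.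
  apply: (bmeas_eq (f := fun s => q_opt E firm1 s - p 0 + g (p 0) + alpha E)).
    by move=> s _; rewrite /dev_quality dfwithout.
  by do !(apply: bmeasD; last exact: bmeas_cst); exact: (bmeas_q_opt sE).
- by move=> i; exact: (bmeas_q_opt sE i).1.
- by move=> i; exact: measurable_cst.
- move=> i; apply: (bmeas_integ2 sE).
  rewrite /=; case: (i == firm1); last exact: bmeas_cst.
  by do !(apply: bmeasD; last exact: bmeas_cst); exact/(bmeas_own firm1)/(bmeas_q_opt sE).
Qed.

Lemma sole_payoff i x m q : types x -> 0 <= q ->
  interim_payoff E sole_strategy (i := i) x m q =
  (if i == firm1 then q - g q - (p 0 - g (p 0)) + alpha E * (1 - x) else - g q)%:E.
Proof.
move=> tx q0; rewrite (interim_payoffE sE _ _ sole_well_defined q0); congr (_%:E).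
have [i1|i1] := eqVneq i firm1.
  rewrite (eq_Ex _ (h := fun=> q - p 0 + g (p 0) + alpha E)); last first.
    by move=> s _; rewrite /dev_transfer/= i1 eqxx; rewrite i1 in m *; rewrite /dev_quality dfwithin.
  rewrite (Ex_cst sE) (eq_Ex _ (h := fun=> 1)); last by move=> s _; rewrite /dev_share/= i1.
  by rewrite (Ex_cst sE); ring.
rewrite (eq_Ex _ (h := fun=> 0)); last by move=> s _; rewrite /dev_transfer/= (negbTE i1).
rewrite (Ex_cst sE) (eq_Ex _ (h := fun=> 0)); last by move=> s _; rewrite /dev_share/= (negbTE i1).
by rewrite (Ex_cst sE); ring.
Qed.

Let q_opt1 x : types x -> q_opt E firm1 x = p 0.
Proof. by rewrite typesE /q_opt/= t01 => /andP[_ ->]. Qed.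

Let q_opt2 x : types x -> q_opt E firm2 x = 0.
Proof. by rewrite typesE /q_opt/= t01 => /andP[_ x1]; rewrite max_l// (q_sym1 sE). Qed.

Lemma sole_sourcing_optimal : sole_sourcing E sole_strategy /\
  (buyer_utility E sole_strategy = U_asy E /\ solves_P E sole_strategy).
Proof.
have a0 := alpha_pos sE.
have zE i w : TT w -> zeq sole_strategy i w = z_opt E i w.
  case: w => x y [/= tx _]; rewrite /zeq/= /z_opt/= t01.
  by have := tx; rewrite typesE => /andP[_ ->]; case: (i == firm1).
split; first by split=> [m q|x tx]; [split|rewrite /sole_strategy/= q_opt1].
apply: optimal_of => //.
- split.
  + exact: sole_well_defined.
  + move=> i x tx; have q0 := q_opt_ge0 sE i tx; split => // m q qq0.
    rewrite !sole_payoff// lee_fin; case: (firm_cases i) => ->.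
      by rewrite /= q_opt1//; have := profit_max sE qq0; lra.
    by rewrite /= q_opt2// (cost0 sE) oppr0 oppr_le0 (cost_ge0 sE).
  + move=> i x tx; have q0 := q_opt_ge0 sE i tx; rewrite sole_payoff// lee_fin.
    have := tx; rewrite typesE => /andP[_ x1].
    case: (firm_cases i) => ->.
      by rewrite /= q_opt1// subrr add0r mulr_ge0 ?subr_ge0// ltW.
    by rewrite /= q_opt2// (cost0 sE) oppr0.
  + by move=> w Tw; split=> [i|]; rewrite ?sum_firms/= ?addr0.
- have t1 := @types1 R; move=> i; have q0 := q_opt_ge0 sE i t1; rewrite sole_payoff//.
  case: (firm_cases i) => ->; first by rewrite /= q_opt1// !subrr mulr0 addr0.
  by rewrite /= q_opt2// (cost0 sE) oppr0.
Qed.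

End Sole.

End Optimality.

(** * The score ceiling auction *)

Section Scores.
Context {R : realType} (E : environment R) (sE : standing_assumptions E).
Implicit Types (a b q s t x y : R).
Local Notation F := (cdfF E).
Local Notation p := (q_sym E).
Local Notation g := (cost E).
Local Notation S := (S_sym E).
Local Notation al := (alpha E).
Local Notation T := (types : set (measurableTypeR R)).

Definition surv x : R := 1 - F x.
Local Notation w := surv.
Local Notation I := (tail surv).

Lemma surv_bounds x : types x -> 0 <= w x <= 1.
Proof. exact: (cdfC_bounds sE). Qed.

Lemma surv_le x y : types x -> types y -> x <= y -> w y <= w x.
Proof. by move=> tx ty xy; rewrite lerD2l lerN2 (cdf_le sE). Qed.

Lemma surv_lt x y : types x -> types y -> x < y -> w y < w x.
Proof. by move=> tx ty xy; rewrite ltrD2l ltrN2 (cdf_lt sE). Qed.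

Lemma surv1 : w 1 = 0. Proof. by rewrite /surv (cdf1 sE) subrr. Qed.

Lemma surv_gt0 x : types x -> x < 1 -> 0 < w x.
Proof. by move=> tx x1; rewrite -surv1 surv_lt//; exact: types1. Qed.

Lemma bmeas_surv : bmeas T w.
Proof. by apply: bmeas_nincr => x y; exact: surv_le. Qed.

Lemma surv_tail_bounds x y : types x -> types y -> x <= y ->
  (y - x) * w y <= I x - I y <= (y - x) * w x.
Proof.
move=> tx ty xy.
have /andP[] := tail_squeezed tx ty bmeas_surv surv_le (lexx x) xy (lexx y).
by move=> l u; apply/andP; split; lra.
Qed.

Lemma surv_tail1 : I 1 = 0. Proof. exact: tail1 bmeas_surv. Qed.

Lemma surv_tail_ge0 x : types x -> 0 <= I x.
Proof.
move=> tx; have x1 : x <= 1 by have := tx; rewrite typesE => /andP[].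
have /andP[+ _] := surv_tail_bounds tx (@types1 R) x1.
by rewrite surv1 surv_tail1 mulr0 subr0.
Qed.

Let mid_type x : types x -> x < 1 -> [/\ types ((x + 1) / 2), x < (x + 1) / 2 & (x + 1) / 2 < 1].
Proof.
rewrite typesE => /andP[x0 x1] lt1; rewrite typesE.
by split; [apply/andP; split| |]; lra.
Qed.

Lemma surv_tail_gt0 x : types x -> x < 1 -> 0 < I x.
Proof.
move=> tx x1; have [tm xm m1] := mid_type tx x1.
have /andP[+ _] := surv_tail_bounds tx tm (ltW xm).
have := surv_tail_ge0 tm.
have : 0 < ((x + 1) / 2 - x) * w ((x + 1) / 2) by apply: mulr_gt0; [rewrite subr_gt0|exact: surv_gt0].
lra.
Qed.

Lemma surv_tail_lt x : types x -> x < 1 -> I x < (1 - x) * w x.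
Proof.
move=> tx x1; have [tm xm m1] := mid_type tx x1.
have /andP[_ H1] := surv_tail_bounds tx tm (ltW xm).
have /andP[_] := surv_tail_bounds tm (@types1 R) (ltW m1).
rewrite surv_tail1 => H2.
have H3 : (1 - (x + 1) / 2) * w ((x + 1) / 2) < (1 - (x + 1) / 2) * w x.
  by rewrite ltr_pM2l ?subr_gt0// surv_lt.
lra.
Qed.

Lemma integral_surv x : types x ->
  \int[lebesgue_measure]_(u in `[x, 1]) (1 - F u) = I x.
Proof.
move=> tx; have -> : (`[x, 1]%classic : set (measurableTypeR R)) = T `&` [set u | x <= u].
  apply/seteqP; split=> u; rewrite /types/= !in_itv/=.
    move=> /andP[xu u1]; rewrite xu u1 andbT; split => //.
    by have := tx; rewrite typesE => /andP[x0 _]; rewrite (le_trans x0 xu).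
  by move=> [/andP[_ ->] ->].
rewrite Rintegral_mkcondr; apply: eq_Rintegral => u _; rewrite patchE.
case: (leP x u) => xu; first by rewrite mem_set// mul1r.
by rewrite memNset ?mul0r//= leNgt xu.
Qed.

(** Payoff of a type [x] that behaves as type [t] in the symmetric auction: the rent of [t] plus the
    cost advantage [al * (t - x)] whenever it wins. *)
Definition rent x t : R := al * (t - x) * w t + al * I t.

(* At [t = 1] the quotient in [S_sym] is [0 / 0 = 0], which is also its limit. *)
Lemma S_symE t : types t -> S t * w t = p t * w t - g (p t) - al * t * w t - al * I t.
Proof.
move=> tt; rewrite /S_sym /IR1 integral_surv// -/(w t).
have [w0|w0] := eqVneq (w t) 0; last by field.
have t1 : t = 1.
  have t1 : t <= 1 by have := tt; rewrite typesE => /andP[].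
  apply/eqP; rewrite eq_le t1/= leNgt; apply/negP => lt1.
  by have := surv_gt0 tt lt1; rewrite w0 ltxx.
by rewrite w0 t1 (q_sym1 sE) (cost0 sE) surv_tail1; ring.
Qed.

(** At a given score the winning probability is fixed, so the best quality maximizes [q * w t - g q]
    whatever the type [x]; it is [p t]. *)
Lemma rent_ge x t q : types t -> 0 <= q ->
  (q - S t - al * x) * w t - g q <= rent x t.
Proof.
move=> tt q0; have : q * w t - g q <= p t * w t - g (p t).
  exact: (ginv_max sE (surv_bounds tt) q0).
have := S_symE tt; rewrite /rent; lra.
Qed.

Lemma rent_eq x t : types t -> (p t - S t - al * x) * w t - g (p t) = rent x t.
Proof. by move=> tt; have := S_symE tt; rewrite /rent; lra. Qed.

Lemma rent_diag x : rent x x = al * I x.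
Proof. by rewrite /rent subrr mulr0 mul0r add0r. Qed.

Lemma rent_le_diag x t : types x -> types t -> rent x t <= al * I x.
Proof.
move=> tx tt; have a0 := alpha_pos sE; rewrite /rent -mulrA -mulrDr ler_pM2l//.
have [xt|/ltW tx'] := leP x t.
  by have /andP[+ _] := surv_tail_bounds tx tt xt; lra.
by have /andP[_] := surv_tail_bounds tt tx tx'; lra.
Qed.

(** For a type below the threshold, imitating a type above it is worst the further that type lies;
    hence pooling at the threshold. *)
Lemma rent_nincr x s t : types s -> types t -> x <= s -> s <= t -> rent x t <= rent x s.
Proof.
move=> ts tt xs st; have a0 := alpha_pos sE.
rewrite /rent -!mulrA -!mulrDr ler_pM2l//.
have /andP[+ _] := surv_tail_bounds ts tt st.
have : (s - x) * w t <= (s - x) * w s by rewrite ler_wpM2l ?subr_ge0// surv_le.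
lra.
Qed.

(** Messages are nonnegative prices; the price behind the score is the production cost plus the
    investment cost and rent per unit of winning probability. *)
Lemma price_ge0 t : types t -> 0 <= p t - S t.
Proof.
move=> tt; rewrite /S_sym; set X := _ / _.
have -> : p t - (p t - al * t - X) = al * t + X by ring.
rewrite {}/X; have /andP[w0 _] := surv_bounds tt; have a0 := ltW (alpha_pos sE).
have := tt; rewrite typesE => /andP[t0 _].
rewrite addr_ge0 ?(mulr_ge0 a0)// divr_ge0//.
rewrite /IR1 integral_surv// addr_ge0 ?(cost_ge0 sE) ?(q_sym_ge0 sE)//.
by rewrite mulr_ge0// surv_tail_ge0.
Qed.

(* Revealed preference: type [t] prefers its own score to that of [s < t]. *)
Lemma S_sym_lt s t : types s -> types t -> s < t -> S t < S s.
Proof.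
move=> ts tt st; have a0 := alpha_pos sE.
have s1 : s < 1 by apply: lt_le_trans st _; have := tt; rewrite typesE => /andP[].
have ws := surv_gt0 ts s1.
have [t1|t1] := ltP t 1; last first.
  have -> : t = 1.
    by apply/eqP; rewrite eq_le t1 andbT; have := tt; rewrite typesE => /andP[].
  (* The margin argument below needs [w t > 0]. At [t = 1] the quotient is [0] by convention, and
     the strict bound [I s < (1 - s) * w s] is used in its place. *)
  have -> : S 1 = - al.
    by rewrite /S_sym -/(w 1) surv1 invr0 mulr0 subr0 (q_sym1 sE) sub0r mulr1.
  rewrite -(ltr_pM2r ws) S_symE//.
  have : 0 * w s - g 0 <= p s * w s - g (p s).
    exact: (ginv_max sE (surv_bounds ts) (lexx 0)).
  rewrite (cost0 sE) mul0r subr0.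
  have : al * I s < al * ((1 - s) * w s) by rewrite ltr_pM2l ?surv_tail_lt.
  lra.
have wt := surv_gt0 tt t1; have wst := surv_lt ts tt st.
have H1 := rent_ge t ts (q_sym_ge0 sE tt).
have H2 := rent_le_diag tt ts.
have H3 := rent_eq t tt; rewrite rent_diag in H3.
have g0 := cost_ge0 sE (q_sym_ge0 sE tt).
have I0 : 0 < al * I t by rewrite mulr_gt0// surv_tail_gt0.
(* The margin must cover the investment and a positive rent, so it is positive, and a higher winning
   probability at the same score would be strictly better for [t]. *)
have Y0 : 0 < p t - S t - al * t by rewrite -(pmulr_lgt0 _ wt); lra.
have H4 : (p t - S t - al * t) * w t < (p t - S t - al * t) * w s by rewrite ltr_pM2l.
have : (p t - S s - al * t) * w s < (p t - S t - al * t) * w s by lra.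
rewrite ltr_pM2r//; lra.
Qed.

Lemma S_sym_le s t : types s -> types t -> s <= t -> S t <= S s.
Proof.
by move=> ts tt; rewrite le_eqVlt => /predU1P[->//|st]; exact/ltW/S_sym_lt.
Qed.

Lemma sup_profit (v : R) : 0 < v -> v <= 1 ->
  sup [set q - g q / v | q in `[0, +oo[] = ginv E v - g (ginv E v) / v.
Proof.
move=> v0 v1; have v01 : 0 <= v <= 1 by rewrite ltW.
have q0 := ginv_ge0 sE v01.
have ub : ubound [set q - g q / v | q in `[0, +oo[] (ginv E v - g (ginv E v) / v).
  move=> _ [q /= /[!in_itv]/= /andP[qq0 _] <-].
  have H := ginv_max sE v01 qq0.
  by rewrite -(ler_pM2r v0) !mulrBl !divfK ?gt_eqF.
have mem : [set q - g q / v | q in `[0, +oo[] (ginv E v - g (ginv E v) / v).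
  by exists (ginv E v) => //=; rewrite in_itv/= q0.
apply/eqP; rewrite eq_le; apply/andP; split.
  by apply: ge_sup => //; eexists; exact: mem.
by apply: ub_le_sup => //; eexists; exact: ub.
Qed.

(** Origin of the kickback: type [t], winning surely at the ceiling with quality [p 0] and paying
    the kickback, earns exactly [al * I t], its payoff from the same score when it wins with
    probability [w t] and pays no kickback. *)
Lemma ceiling_plus_kickback t : types t -> t < 1 ->
  S t + kickback E t = p 0 - g (p 0) - al * t - al * I t.
Proof.
move=> tt t1; have wt := surv_gt0 tt t1; have /andP[_ w1] := surv_bounds tt.
rewrite /kickback (sup_profit wt w1) integral_surv//.
rewrite (_ : sup _ = p 0 - g (p 0)); last first.
  rewrite (_ : [set _ | _ in _] = [set q - g q / 1 | q in `[0, +oo[]).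
    by rewrite sup_profit// divr1 /q_sym (cdf0 sE) subr0.
  by apply/seteqP; split=> _ [q q0 <-]; exists q => //; rewrite divr1.
rewrite /S_sym /IR1 integral_surv// -/(w t) -/(p t).
have -> : F t = 1 - w t by rewrite /surv; ring.
by rewrite -[ginv E (w t)]/(p t); field; rewrite gt_eqF.
Qed.

End Scores.

(** * Equilibrium of the score ceiling auction *)

Section Auction.
Context {R : realType} (E : environment R) (sE : standing_assumptions E).
Hypothesis sc : sufficiently_concave E.
Implicit Types (a b q s t x y : R).
Local Notation F := (cdfF E).
Local Notation p := (q_sym E).
Local Notation g := (cost E).
Local Notation S := (S_sym E).
Local Notation al := (alpha E).
Local Notation w := (surv E).
Local Notation I := (tail (surv E)).
Local Notation t0 := (threshold E).
Local Notation T := (types : set (measurableTypeR R)).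
Local Notation TT := (profiles (R := R)).
Hypothesis lt01 : t0 < 1.

Let tt0 : types t0. Proof. exact: types_threshold. Qed.

Let top x : R := Num.max t0 x.

Let types_top x : types x -> types (top x). Proof. exact: types_max. Qed.

Let top_le x y : x <= y -> top x <= top y.
Proof. by move=> xy; rewrite ge_max !le_max lexx xy orbT. Qed.

Definition eq_score x : R := S (top x).

Lemma eq_score_le x y : types x -> types y -> x <= y -> eq_score y <= eq_score x.
Proof. by move=> tx ty xy; apply: (S_sym_le sE); rewrite ?top_le//; exact: types_top. Qed.

Lemma eq_score_le_top x : types x -> eq_score x <= S t0.
Proof. by move=> tx; apply: (S_sym_le sE); [|exact: types_top|rewrite le_max lexx]. Qed.

(** With ties going to firm 1 this is the allocation [z_opt]: up to the threshold firm 1 sits at the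
    ceiling, which firm 2 can only match. *)
Lemma eq_score_cmp x y : types x -> types y ->
  (eq_score y <= eq_score x) = (x <= t0) || (x <= y).
Proof.
move=> tx ty; have -> : (x <= t0) || (x <= y) = (top x <= top y).
  by rewrite ge_max !le_max lexx.
case: (leP (top x) (top y)) => xy; first by rewrite (S_sym_le sE)//; exact: types_top.
by apply/negbTE; rewrite -ltNge (S_sym_lt sE)//; exact: types_top.
Qed.

Let rent_top_ge0 x : types x -> 0 <= rent E x (top x).
Proof.
move=> tx; have a0 := ltW (alpha_pos sE); have tm := types_top tx.
rewrite /rent addr_ge0// ?mulr_ge0//.
- by rewrite subr_ge0 le_max lexx orbT.
- by have /andP[] := surv_bounds sE tm.
- exact: surv_tail_ge0.
Qed.

(** The defeated rivals form an up-set with endpoint [a], so the deviation wins with probability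
    [w a]. Any [s > a] is defeated, which bounds the margin [X] by that of the score [S s] and the
    payoff at probability [w s] by [rent x s]. Then [s] decreases to [a], and only the continuity of
    [F] is called for. *)
Lemma rent_deviation (win : R -> bool) X q x : types x -> 0 <= q ->
  (forall s t, types s -> types t -> s <= t -> win s -> win t) ->
  (forall s, types s -> win s -> t0 < s /\ X <= q - S s - al * x) ->
  X * Ex E (fun s => (win s)%:R) - g q <= rent E x (top x).
Proof.
move=> tx q0 up H; have [a ta wa] := upset_threshold up.
have a0 := alpha_pos sE; have g0 := cost_ge0 sE q0.
have rent_ge0 := rent_top_ge0 tx.
have -> : Ex E (fun s => (win s)%:R) = w a.
  rewrite /surv -(Ex_ge sE); apply: (@eq_Ex_off _ _ sE a).
  - exact: bmeas_upset.
  - exact: bmeas_ge.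
  - by move=> y ty ya; rewrite wa.
have [a1|a1] := ltP a 1; last first.
  have -> : a = 1.
    by apply/eqP; rewrite eq_le a1 andbT; have := ta; rewrite typesE => /andP[].
  by rewrite surv1// mulr0 sub0r (le_trans _ rent_ge0)// oppr_le0.
have key s : types s -> a < s -> X * w s - g q <= rent E x (top x).
  move=> ts as_.
  have [|t0s XS] := H s ts; first by rewrite wa ?gt_eqF// ltW.
  have /andP[ws _] := surv_bounds sE ts.
  apply: (@le_trans _ _ ((q - S s - al * x) * w s - g q)).
    by rewrite lerD2r ler_wpM2r.
  apply: le_trans (rent_ge sE x ts q0) _.
  rewrite /top; case: (leP t0 x) => t0x; last exact: (rent_nincr sE tt0 ts (ltW t0x) (ltW t0s)).
  by rewrite rent_diag rent_le_diag.
have [X0|X0] := leP X 0.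
  apply: le_trans rent_ge0; have /andP[ws _] := surv_bounds sE ta.
  by have := mulr_le0_ge0 X0 ws; lra.
apply/ler_addgt0Pr => e e0.
have [|s [as_ s1 ts Fs]] := cdf_close_right sE ta a1 (e := e / X); first exact: divr_gt0.
have := key s ts as_.
have : X * (F s) < X * (F a + e / X) by rewrite ltr_pM2l.
have : X * (e / X) = e by rewrite mulrC divfK// gt_eqF.
rewrite /surv; lra.
Qed.

(** The truncation makes the price a legal message for every real [x]; on the types it is inactive,
    by [q_opt_ge_score]. *)
Let price i x : R := Num.max (q_opt E i x - eq_score x) 0.

Let price_nneg i x : 0 <= price i x.
Proof. by rewrite le_max lexx orbT. Qed.

Definition auction_strategy : strategy (score_ceiling_auction E t0) :=
  fun i x => (NngNum (price_nneg i x), q_opt E i x).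
Local Notation sigma := auction_strategy.

Lemma q_opt_ge_score i x : types x -> eq_score x <= q_opt E i x.
Proof.
move=> tx; have tm := types_top tx; have H := price_ge0 sE tm.
apply: (@le_trans _ _ (p (top x))); first by rewrite -subr_ge0.
rewrite /q_opt /top; case: ifP => _ //; case: (leP x t0) => xt.
  by apply: (q_sym_le sE) => //; [exact: types0|have := tt0; rewrite typesE => /andP[]].
exact: lexx.
Qed.

Lemma eq_price i x : types x -> ((sigma i x).1 : {nonneg R})%:num = q_opt E i x - eq_score x.
Proof. by move=> tx; rewrite /= /price max_l// subr_ge0 q_opt_ge_score. Qed.

Lemma score_own i (m : {nonneg R}) q s :
  score (dev_message sigma (i := i) m s) (dev_quality sigma i q s) i = q - m%:num.
Proof. by rewrite /score /dev_quality /dev_message !dfwithin. Qed.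

Lemma score_other i j (m : {nonneg R}) q s : i != j -> types s ->
  score (dev_message sigma (i := i) m s) (dev_quality sigma i q s) j = eq_score s.
Proof.
move=> ij ts; rewrite /score /dev_quality /dev_message !dfwithout//.
by have := eq_price j ts => /= ->; rewrite opprB addrC subrK.
Qed.

Let win1 Sc s : bool := (eq_score s <= Sc) && (Sc <= S t0).
Let win2 Sc s : bool := (Sc > eq_score s) && (Sc <= S t0).

Let dev_share1 (m : {nonneg R}) q s : types s ->
  dev_share sigma (i := firm1) m q s = (win1 (q - m%:num) s)%:R.
Proof.
by move=> ts; rewrite /dev_share/= /ceiling_share score_own (@score_other firm1 firm2).
Qed.

Let dev_share2 (m : {nonneg R}) q s : types s ->
  dev_share sigma (i := firm2) m q s = (win2 (q - m%:num) s)%:R.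
Proof.
by move=> ts; rewrite /dev_share/= /ceiling_share score_own (@score_other firm2 firm1).
Qed.

Let dev_transfer1 (m : {nonneg R}) q s : types s ->
  dev_transfer sigma (i := firm1) m q s = m%:num * (win1 (q - m%:num) s)%:R
    - kickback E t0 * ((eq_score s <= q - m%:num) && (q - m%:num == S t0))%:R.
Proof.
move=> ts; rewrite /dev_transfer/= /ceiling_transfer /ceiling_share score_own.
by rewrite (@score_other firm1 firm2)//= /dev_message dfwithin.
Qed.

Let dev_transfer2 (m : {nonneg R}) q s : types s ->
  dev_transfer sigma (i := firm2) m q s = m%:num * (win2 (q - m%:num) s)%:R.
Proof.
move=> ts; rewrite /dev_transfer/= /ceiling_transfer /ceiling_share score_own.
by rewrite (@score_other firm2 firm1)//= /dev_message dfwithin subr0.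
Qed.

Let win1_up Sc s t : types s -> types t -> s <= t -> win1 Sc s -> win1 Sc t.
Proof.
by move=> ts tt st /andP[h1 h2]; rewrite /win1 h2 andbT (le_trans _ h1)// eq_score_le.
Qed.

Let win2_up Sc s t : types s -> types t -> s <= t -> win2 Sc s -> win2 Sc t.
Proof.
by move=> ts tt st /andP[h1 h2]; rewrite /win2 h2 andbT (le_lt_trans _ h1)// eq_score_le.
Qed.

Let bwin1 Sc : bmeas T (fun s => (win1 Sc s)%:R : R).
Proof. by apply: bmeas_upset => s t; exact: win1_up. Qed.

Let bwin2 Sc : bmeas T (fun s => (win2 Sc s)%:R : R).
Proof. by apply: bmeas_upset => s t; exact: win2_up. Qed.

Let bceil Sc : bmeas T (fun s => ((eq_score s <= Sc) && (Sc == S t0))%:R : R).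
Proof.
apply: bmeas_upset => s t ts tt st /andP[h1 h2].
by rewrite h2 andbT (le_trans _ h1)// eq_score_le.
Qed.

Let eq_scoreE i (v : R * R) : TT v ->
  score (eq_message sigma v) (eq_quality sigma v) i = eq_score (type_of v i).
Proof.
move=> [t1 t2]; rewrite /score /eq_quality /eq_message/=.
have tv : types (type_of v i) by rewrite /type_of; case: ifP.
by have := eq_price i tv => /= ->; rewrite opprB addrC subrK.
Qed.

Lemma auction_share i (v : R * R) : TT v -> zeq sigma i v = z_opt E i v.
Proof.
move=> Tv; have [t1 t2] := Tv; rewrite /zeq/= /ceiling_share !eq_scoreE//.
rewrite /z_opt -(eq_score_cmp t1 t2) /type_of/=.
by rewrite !eq_score_le_top// !andbT ltNge; case: (i == firm1).
Qed.

Lemma auction_well_defined : well_defined E sigma.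
Proof.
split.
- move=> i; case: (firm_cases i) => -> m q q0.
    by apply: (integ_eq _ (bmeas_integ sE (bwin1 (q - (m : {nonneg R})%:num)))) => s ts; rewrite dev_share1.
  by apply: (integ_eq _ (bmeas_integ sE (bwin2 (q - (m : {nonneg R})%:num)))) => s ts; rewrite dev_share2.
- move=> i; case: (firm_cases i) => -> m q q0.
    have b := bmeasB (bmeasM (bmeas_cst T (m : {nonneg R})%:num) (bwin1 (q - (m : {nonneg R})%:num)))
      (bmeasM (bmeas_cst T (kickback E t0)) (bceil (q - (m : {nonneg R})%:num))).
    by apply: (integ_eq _ (bmeas_integ sE b)) => s ts; rewrite dev_transfer1.
  have b := bmeasM (bmeas_cst T (m : {nonneg R})%:num) (bwin2 (q - (m : {nonneg R})%:num)).
  by apply: (integ_eq _ (bmeas_integ sE b)) => s ts; rewrite dev_transfer2.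
- by move=> i; exact: (bmeas_q_opt sE i).1.
- move=> i; apply: (eq_measurable_fun (z_opt E i)); last exact: (bmeas_z_opt E i).1.
  by move=> v /[!inE] Tv; rewrite -(auction_share i Tv).
- move=> i; have bz := bmeas_z_opt E i; have bq := bmeas_own i (bmeas_q_opt sE i).
  have bs j : bmeas TT (fun v => eq_score (type_of v j)).
    by apply: bmeas_own; apply: bmeas_nincr => x y; exact: eq_score_le.
  have bk : bmeas TT (fun v : R * R => ((eq_score (type_of v firm2) <= eq_score (type_of v firm1))
       && (eq_score (type_of v firm1) == S t0))%:R : R).
    apply: bmeas_bool; apply: measurable_and.
      exact: measurable_fun_ler (bs firm2).1 (bs firm1).1.
    exact: measurable_fun_eqr (bs firm1).1 (measurable_cst _).
  have b := bmeasB (bmeasM (bmeasB bq (bs i)) bz)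
    (bmeasM (bmeas_cst TT (if i == firm1 then kickback E t0 else 0)) bk).
  apply: (integ2_eq _ (bmeas_integ2 sE b)) => v Tv.
  have tv : types (type_of v i) by case: Tv; rewrite /type_of; case: ifP.
  rewrite -(auction_share i Tv) -(eq_price i tv) /=.
  rewrite /ceiling_transfer/= !eq_scoreE//=; congr (_ - _).
  by case: (i == firm1) => //; rewrite mul0r.
Qed.

(** The rent of firm 1: [al] times the integral from [x] to [1] of its winning probability, which is
    [1] up to the threshold and [w] beyond. *)
Definition payoff1 x : R := if x <= t0 then al * (t0 - x) + al * I t0 else al * I x.

Let rent_le_payoff1 x : types x -> rent E x (top x) <= payoff1 x.
Proof.
move=> tx; have a0 := alpha_pos sE; rewrite /payoff1 /top; case: (leP x t0) => xt.
  rewrite /rent lerD2r; have /andP[_ w1] := surv_bounds sE tt0.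
  by rewrite ler_piMr// mulr_ge0 ?subr_ge0// ltW.
by rewrite rent_diag.
Qed.

Let payoff1_ge0 x : types x -> 0 <= payoff1 x.
Proof.
move=> tx; have a0 := ltW (alpha_pos sE); rewrite /payoff1; case: ifP => xt.
  by rewrite addr_ge0// mulr_ge0// ?subr_ge0// surv_tail_ge0.
by rewrite mulr_ge0// surv_tail_ge0.
Qed.

Let ceil_le_payoff1 x : types x -> al * (t0 - x) + al * I t0 <= payoff1 x.
Proof.
move=> tx; have a0 := alpha_pos sE; rewrite /payoff1; case: (leP x t0) => xt //.
have /andP[_ H] := surv_tail_bounds sE tt0 tx (ltW xt).
have /andP[_ w1] := surv_bounds sE tt0.
have : (x - t0) * w t0 <= x - t0 by rewrite ler_piMr// subr_ge0 ltW.
by rewrite -mulrDr ler_pM2l//; lra.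
Qed.

Lemma interim1 x (m : {nonneg R}) q : 0 <= q ->
  interim_payoff E sigma (i := firm1) x m q =
  ((m%:num - al * x) * Ex E (fun s => (win1 (q - m%:num) s)%:R)
   - kickback E t0 * Ex E (fun s => ((eq_score s <= q - m%:num) && (q - m%:num == S t0))%:R)
   - g q)%:E.
Proof.
move=> q0; rewrite (interim_payoffE sE _ _ auction_well_defined q0); congr (_%:E).
have i1 := bmeas_integ sE (bwin1 (q - m%:num)).
have i2 := bmeas_integ sE (bceil (q - m%:num)).
rewrite (eq_Ex _ (dev_transfer1 m q)) (eq_Ex _ (dev_share1 m q)).
by rewrite (ExB (integZ _ i1) (integZ _ i2)) (ExZ _ i1) (ExZ _ i2); ring.
Qed.

Lemma interim2 x (m : {nonneg R}) q : 0 <= q ->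
  interim_payoff E sigma (i := firm2) x m q =
  ((m%:num - al * x) * Ex E (fun s => (win2 (q - m%:num) s)%:R) - g q)%:E.
Proof.
move=> q0; rewrite (interim_payoffE sE _ _ auction_well_defined q0); congr (_%:E).
have i1 := bmeas_integ sE (bwin2 (q - m%:num)).
rewrite (eq_Ex _ (dev_transfer2 m q)) (eq_Ex _ (dev_share2 m q)).
by rewrite (ExZ _ i1); ring.
Qed.

Let ceiling_payoff x q : q - S t0 - kickback E t0 - al * x - g q =
  q - g q - (p 0 - g (p 0)) + al * (t0 - x) + al * I t0.
Proof. by have := ceiling_plus_kickback sE tt0 lt01; lra. Qed.

(** A score below the ceiling beats only types above the threshold and falls under [rent_deviation];
    a score above it never wins; a score equal to it always wins but costs the kickback, and [p 0]
    is then the best quality. *)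
Lemma interim1_le x (m : {nonneg R}) q : types x -> 0 <= q ->
  (interim_payoff E sigma (i := firm1) x m q <= (payoff1 x)%:E)%E.
Proof.
move=> tx q0; rewrite interim1// lee_fin; have g0 := cost_ge0 sE q0.
have u0 := payoff1_ge0 tx.
set Sd := q - m%:num; have mE : m%:num = q - Sd by rewrite /Sd; ring.
have [Slt|Sgt|Seq] := ltgtP Sd (S t0).
- rewrite (eq_Ex _ (f := fun s => ((eq_score s <= Sd) && false)%:R) (h := fun=> 0)); last first.
    by move=> s _; rewrite andbF.
  rewrite (Ex_cst sE) mulr0 subr0 mE; apply: le_trans (rent_le_payoff1 tx).
  apply: rent_deviation => //; first by move=> s t; exact: win1_up.
  move=> s ts /andP[sS _]; have ls : t0 < s.
    rewrite ltNge; apply/negP => st; move: sS; rewrite leNgt => /negP; apply.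
    by rewrite /eq_score /top max_l.
  split => //; have : S s <= Sd by move: sS; rewrite /eq_score /top max_r// ltW.
  lra.
- rewrite (eq_Ex _ (f := fun s => ((eq_score s <= Sd) && false)%:R) (h := fun=> 0)); last first.
    by move=> s _; rewrite andbF.
  rewrite (eq_Ex _ (f := fun s => (win1 Sd s)%:R) (h := fun=> 0)); last first.
    by move=> s _; rewrite /win1 [Sd <= _]leNgt Sgt andbF.
  by rewrite (Ex_cst sE) !mulr0 subr0 sub0r; lra.
- rewrite (eq_Ex _ (f := fun s => (win1 _ _)%:R) (h := fun=> 1)); last first.
    by move=> s ts; rewrite /win1 Seq lexx eq_score_le_top.
  rewrite (eq_Ex _ (f := fun s => (_ && _)%:R) (h := fun=> 1)); last first.
    by move=> s ts; rewrite Seq eq_score_le_top.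
  rewrite (Ex_cst sE) !mulr1 mE Seq; apply: le_trans (ceil_le_payoff1 tx).
  by have := ceiling_payoff x q; have := profit_max sE q0; lra.
Qed.

(** Ties favor firm 1, so even at the ceiling firm 2 beats only types above the threshold, and a
    single application of [rent_deviation] covers every score. *)
Lemma interim2_le x (m : {nonneg R}) q : types x -> 0 <= q ->
  (interim_payoff E sigma (i := firm2) x m q <= (rent E x (top x))%:E)%E.
Proof.
move=> tx q0; rewrite interim2// lee_fin; have g0 := cost_ge0 sE q0.
set Sd := q - m%:num; have mE : m%:num = q - Sd by rewrite /Sd; ring.
rewrite mE; apply: rent_deviation => //; first by move=> s t; exact: win2_up.
move=> s ts /andP[sS Sb]; have ls : t0 < s.
  rewrite ltNge; apply/negP => st; move: sS; rewrite ltNge => /negP; apply.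
  by rewrite /eq_score /top max_l.
split => //; have : S s <= Sd by move: sS; rewrite /eq_score /top (max_r (ltW ls)) => /ltW.
lra.
Qed.

Lemma interim1_eq x : types x ->
  interim_payoff E sigma (i := firm1) x (sigma firm1 x).1 (sigma firm1 x).2 = (payoff1 x)%:E.
Proof.
move=> tx; rewrite interim1; last exact: (q_opt_ge0 sE).
have -> : (sigma firm1 x).2 - (((sigma firm1 x).1 : {nonneg R})%:num) = eq_score x.
  by rewrite eq_price//=; ring.
rewrite eq_price//= -/(q_opt E firm1 x) /payoff1; congr (_%:E).
case: (leP x t0) => xt.
  have eS : eq_score x = S t0 by rewrite /eq_score /top max_l.
  rewrite eS (eq_Ex _ (f := fun s => (win1 _ _)%:R) (h := fun=> 1)); last first.
    by move=> s ts; rewrite /win1 lexx eq_score_le_top.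
  rewrite (eq_Ex _ (f := fun s => (_ && _)%:R) (h := fun=> 1)); last first.
    by move=> s ts; rewrite eqxx eq_score_le_top.
  rewrite (Ex_cst sE) !mulr1 /q_opt/= xt.
  by have := ceiling_payoff x (p 0); lra.
have eS : eq_score x = S x by rewrite /eq_score /top max_r// ltW.
have Sx : S x < S t0 by rewrite (S_sym_lt sE).
rewrite (eq_Ex _ (f := fun s => (win1 _ _)%:R) (h := fun s => (x <= s)%R%:R)); last first.
  by move=> s ts; rewrite /win1 eq_score_le_top// andbT eq_score_cmp// leNgt xt.
rewrite (Ex_ge sE) (eq_Ex _ (f := fun s => (_ && _)%:R) (h := fun=> 0)); last first.
  by move=> s ts; rewrite eS (lt_eqF Sx) andbF.
rewrite (Ex_cst sE) mulr0 subr0 eS /q_opt/= leNgt xt/= -/(w x).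
by rewrite -rent_diag -(rent_eq sE).
Qed.

Lemma interim2_eq x : types x ->
  interim_payoff E sigma (i := firm2) x (sigma firm2 x).1 (sigma firm2 x).2 = (rent E x (top x))%:E.
Proof.
move=> tx; rewrite interim2; last exact: (q_opt_ge0 sE).
have -> : (sigma firm2 x).2 - (((sigma firm2 x).1 : {nonneg R})%:num) = eq_score x.
  by rewrite eq_price//=; ring.
rewrite eq_price//= /q_opt/=; congr (_%:E).
rewrite (eq_Ex _ (f := fun s => (win2 _ _)%:R) (h := fun s => (top x < s)%R%:R)); last first.
  move=> s ts; rewrite /win2 eq_score_le_top// andbT ltNge eq_score_cmp//.
  by rewrite -le_max -ltNge.
by rewrite (Ex_gt sE) -/(w _) -(rent_eq sE) //; exact: types_top.
Qed.

Lemma auction_feasible : feasible E sigma.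
Proof.
split.
- exact: auction_well_defined.
- move=> i x tx; split; first exact: (q_opt_ge0 sE).
  case: (firm_cases i) => -> m q q0.
    by rewrite interim1_eq//; exact: interim1_le.
  by rewrite interim2_eq//; exact: interim2_le.
- move=> i x tx; case: (firm_cases i) => ->.
    by rewrite interim1_eq// lee_fin payoff1_ge0.
  by rewrite interim2_eq// lee_fin rent_top_ge0.
- move=> v Tv; split=> [i|].
    by have := auction_share i Tv; rewrite /zeq => ->; rewrite /z_opt; case: ifP.
  have := auction_share firm1 Tv; have := auction_share firm2 Tv.
  rewrite /zeq sum_firms => -> ->; rewrite /z_opt/=.
  by case: (_ || _); rewrite ?addr0 ?add0r.
Qed.

Lemma auction_optimal : buyer_utility E sigma = U_asy E /\ solves_P E sigma.
Proof.
have t1 := @types1 R.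
apply: (optimal_of sE sc auction_feasible) => //; first exact: auction_share.
move=> i; case: (firm_cases i) => ->.
  by rewrite interim1_eq// /payoff1 leNgt lt01/= surv_tail1 ?mulr0.
by rewrite interim2_eq// /top max_r ?(ltW lt01)// rent_diag surv_tail1 ?mulr0.
Qed.

End Auction.

Theorem theorem3 (R : realType) (E : environment R) :
  standing_assumptions E ->
  sufficiently_concave E ->
  exists theta0 : R, 0 <= theta0 <= 1 /\
  exists (M : mechanism R) (sigma : strategy M),
    threshold_mechanism E theta0 sigma /\
    buyer_utility E sigma = U_asy E /\
    solves_P E sigma.
Proof.
move=> sE sc; exists (threshold E); have tt := types_threshold E.
have t01 : 0 <= threshold E <= 1 by rewrite -typesE.
split => //; have [lt1|ge1] := ltP (threshold E) 1.
  exists (score_ceiling_auction E (threshold E)), (auction_strategy E).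
  by split; [left|exact: auction_optimal].
have eq1 : threshold E = 1 by apply/eqP; rewrite eq_le ge1 andbT; case/andP: t01.
exists (sole_mechanism E), (sole_strategy E).
have [ss opt] := sole_sourcing_optimal sE sc eq1.
by split; first by right.
Qed.
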